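(* If $\mu\in\mathcal{M}$ has mean zero and finite variance $\sigma^2$, then $$\mathrm{Ind}(\mu)=\sup\left\{t\ge0:\ E_\mu=\sigma^2G_{\nu_t\boxplus\gamma_{t\sigma^2}}\ \text{for some}\ \nu_t\in\mathcal{M}\right\}.$$
   Context: $\mathcal{M}$ is the set of Borel probability measures on $\mathbb{R}$ and $\mathbb{C}^+$ is the open upper half-plane. For $\mu\in\mathcal{M}$: $G_\mu(z)=\int_{\mathbb{R}}\frac{d\mu(s)}{z-s}$, $F_\mu=1/G_\mu$, $E_\mu(z)=z-F_\mu(z)$ for $z\in\mathbb{C}^+$. $F_\mu$ has a right inverse $F_\mu^{-1}$ on some truncated cone $\Gamma_{\alpha,\beta}=\{x+iy: |x|\le\alpha y,\ y\ge\beta\}$, $\alpha,\beta>0$, and the Voiculescu transform is $\phi_\mu(z)=F_\mu^{-1}(z)-z$ there. The free additive convolution $\mu\boxplus\nu$ is the unique measure in $\mathcal{M}$ with $\phi_{\mu\boxplus\nu}=\phi_\mu+\phi_\nu$ on some truncated cone. For $p\ge1$, $\mu^{\boxplus p}\in\mathcal{M}$ is the unique measure with $\phi_{\mu^{\boxplus p}}=p\,\phi_\mu$ on some truncated cone (it always exists). For $q\ge0$, $\mu^{\uplus q}\in\mathcal{M}$ is the unique measure with $E_{\mu^{\uplus q}}=qE_\mu$. For $t\ge0$, $\mathbb{B}_t(\mu)=\left(\mu^{\boxplus(t+1)}\right)^{\uplus\frac{1}{t+1}}$, and the $\boxplus$-divisibility indicator is $\mathrm{Ind}(\mu)=\sup\{t\ge0:\mu\in\mathbb{B}_t(\mathcal{M})\}\in[0,\infty]$.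 $\gamma_t$ is the centered semicircular distribution of variance $t$ ($\gamma_0=\delta_0$). *)

(* Defs.v *)
From HB Require Import structures.
From mathcomp Require Import all_boot all_order all_algebra.
From mathcomp Require Import all_classical all_reals all_analysis.
From mathcomp Require Import measurable_realfun.
From mathcomp Require Import ring lra complex.

Set Implicit Arguments.
Unset Strict Implicit.
Unset Printing Implicit Defensive.

Import Order.TTheory GRing.Theory Num.Theory.
Import numFieldNormedType.Exports.

Local Open Scope classical_set_scope.
Local Open Scope ring_scope.
Local Open Scope complex_scope.

Notation borel_probability R := (probability (measurableTypeR R) R).

(* [Num.sqrt] vanishes on negative reals, so this is already supported in
   [-2 sqrt t, 2 sqrt t]. *)
Definition semicircular_pdf {R : realType} (t x : R) : R :=
  Num.sqrt (4 * t - x ^+ 2) / (2 * pi * t).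

(* Centered semicircular distribution of variance t; the Dirac mass at 0 for
   t = 0 (and, by convention, for t < 0). *)
Definition semicircular {R : realType} (t : R) :
    set (measurableTypeR R) -> \bar R :=
  fun A => if 0 < t then
    (\int[lebesgue_measure]_(x in A) (semicircular_pdf t x)%:E)%E
  else dirac (0 : measurableTypeR R) A.

Section semicircular_probability.
Context {R : realType}.
Variable t : R.
Local Notation leb := (@lebesgue_measure R).

Lemma semicircular_pdf_ge0 (x : R) : 0 < t -> 0 <= semicircular_pdf t x.
Proof.
by move=> t0; rewrite divr_ge0 ?sqrtr_ge0// ltW// !mulr_gt0// pi_gt0.
Qed.

Lemma continuous_semicircular_pdf : continuous (semicircular_pdf t).
Proof.
move=> x; apply: cvgM; last exact: cvg_cst.
apply: (cvg_comp _ (@Num.sqrt R)); last exact: sqrt_continuous.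
apply: cvgB; first exact: cvg_cst.
exact: sqr_continuous.
Qed.

Lemma measurable_semicircular_pdf :
  measurable_fun [set: R] (EFin \o semicircular_pdf t).
Proof.
apply/measurable_EFinP; apply: continuous_measurable_fun.
exact: continuous_semicircular_pdf.
Qed.

Let r : R := 2 * Num.sqrt t.
Let F (x : R) : R := r * sin x.
Let H (x : R) : R := pi^-1 * (x + sin x * cos x).

Let dF (x : R) : is_derive x 1 F (r * cos x).
Proof. by apply: is_derive_eq; rewrite /GRing.scale/=; ring. Qed.

Let dH (x : R) : is_derive x 1 H (2 / pi * cos x ^+ 2).
Proof.
apply: is_derive_eq; rewrite /GRing.scale/=.
by rewrite -[X in X + _](cos2Dsin2 x); ring.
Qed.

Let F'E : (F^`())%classic = fun x => r * cos x.
Proof. by apply/funext => x; rewrite derive1E; apply: derive_val. Qed.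

Let H'E : (H^`())%classic = fun x => 2 / pi * cos x ^+ 2.
Proof. by apply/funext => x; rewrite derive1E; apply: derive_val. Qed.

Let cF : continuous F.
Proof.
by move=> x; apply: differentiable_continuous; apply/derivable1_diffP.
Qed.

Let cH : continuous H.
Proof.
by move=> x; apply: differentiable_continuous; apply/derivable1_diffP.
Qed.

Let ccos c : continuous (fun x : R => c * cos x).
Proof. by move=> x; apply: cvgM; [exact: cvg_cst|exact: continuous_cos]. Qed.

Lemma integral_semicircular_pdf : 0 < t ->
  (\int[leb]_x (semicircular_pdf t x)%:E = 1)%E.
Proof.
move=> t0.
have r0 : 0 < r by rewrite mulr_gt0// sqrtr_gt0.
have r2 : r ^+ 2 = 4 * t by rewrite exprMn sqr_sqrtr ?ltW//; ring.
have pi0 : 0 < (pi : R) := pi_gt0 R.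
have lt_pi : - (pi / 2) < pi / 2 :> R by lra.
have FN : F (- (pi / 2)) = - r by rewrite /F sinN sin_pihalf mulrN1.
have FP : F (pi / 2) = r by rewrite /F sin_pihalf mulr1.
transitivity (\int[leb]_(x in `[(- r)%R, r]) (semicircular_pdf t x)%:E)%E.
  rewrite [RHS]integral_mkcond; apply: eq_integral => x _.
  rewrite patchE; case: ifPn => // /negP xr.
  rewrite /semicircular_pdf ler0_sqrtr ?mul0r// -r2 subr_le0 leNgt.
  apply/negP => xr2; apply: xr; rewrite inE/= in_itv/= -ler_norml.
  by rewrite -(ler_pXn2r (_ : 0 < 2)%N) ?nnegrE ?(ltW r0)// real_normK
    ?num_real// ltW.
rewrite -{1}FN -FP integration_by_substitution_increasing; last 7 first.
- exact: ltW.
- move=> x y xI yI xy; rewrite /F ltr_pM2l//.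
  by rewrite ltr_sin.
- by rewrite F'E => x _; exact: ccos.
- rewrite F'E; apply/cvg_ex; exists (r * cos (- (pi / 2))).
  by apply: cvg_at_right_filter; exact: ccos.
- rewrite F'E; apply/cvg_ex; exists (r * cos (pi / 2)).
  by apply: cvg_at_left_filter; exact: ccos.
- split => //.
  + by apply: cvg_at_right_filter; exact: cF.
  + by apply: cvg_at_left_filter; exact: cF.
- by apply: continuous_subspaceT; exact: continuous_semicircular_pdf.
transitivity
  (\int[leb]_(x in `[(- (pi / 2))%R, (pi / 2)%R]) (2 / pi * cos x ^+ 2)%:E)%E.
  apply: eq_integral => x; rewrite inE/= in_itv/= => xI.
  congr EFin; rewrite F'E /= /semicircular_pdf /F fctE/=.
  have -> : 4 * t - (r * sin x) ^+ 2 = (r * cos x) ^+ 2.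
    by rewrite (exprMn _ r (sin x)) (exprMn _ r (cos x)) cos2sin2 -r2; ring.
  rewrite sqrtr_sqr ger0_norm; last by rewrite mulr_ge0 ?(ltW r0)// cos_ge0_pihalf.
  have -> : r * cos x / (2 * pi * t) * (r * cos x) =
    r ^+ 2 * cos x ^+ 2 / (2 * pi * t) by ring.
  rewrite r2; move: (cos x) (pi : R) pi0 => c p p0.
  by field; rewrite (gt_eqF p0) (gt_eqF t0).
rewrite (@continuous_FTC2 _ _ H)//.
- rewrite /H sinN cosN cos_pihalf !mulr0 !addr0 -EFinB -mulrBr opprK.
  by congr EFin; move: (pi : R) pi0 => p p0; field; rewrite (gt_eqF p0).
- apply: continuous_subspaceT => x; apply: cvgM; first exact: cvg_cst.
  by apply: (cvg_comp _ (fun y : R => y ^+ 2));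
    [exact: continuous_cos|exact: sqr_continuous].
- split => //.
  + by apply: cvg_at_right_filter; exact: cH.
  + by apply: cvg_at_left_filter; exact: cH.
- by move=> x _; rewrite H'E.
Qed.

Let semicircular0 : semicircular t set0 = 0%E.
Proof.
by rewrite /semicircular; case: ifP => _; [exact: integral_set0|exact: measure0].
Qed.

Let semicircular_ge0 A : (0 <= semicircular t A)%E.
Proof.
rewrite /semicircular; case: ifPn => // t0; apply: integral_ge0 => x _.
by rewrite lee_fin semicircular_pdf_ge0.
Qed.

Let semicircular_sigma_additive : semi_sigma_additive (semicircular t).
Proof.
have [t0|/negbTE t0] := boolP (0 < t); last first.
  have -> : semicircular t = dirac (0 : measurableTypeR R).
    by apply/funext => A; rewrite /semicircular t0.
  exact: measure_semi_sigma_additive.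
move=> /= A mA tA mUA; rewrite /semicircular t0.
rewrite ge0_integral_bigcup//=; last 2 first.
- by apply: measurable_funTS; exact: measurable_semicircular_pdf.
- by move=> x _; rewrite lee_fin semicircular_pdf_ge0.
apply: is_cvg_ereal_nneg_natsum_cond => n _ _.
by apply: integral_ge0 => /= x ?; rewrite lee_fin semicircular_pdf_ge0.
Qed.

HB.instance Definition _ := isMeasure.Build _ _ _ (semicircular t)
  semicircular0 semicircular_ge0 semicircular_sigma_additive.

Let semicircular_setT : semicircular t setT = 1%E.
Proof.
rewrite /semicircular; case: ifPn => [|_]; first exact: integral_semicircular_pdf.
exact: diracT.
Qed.

HB.instance Definition _ :=
  @Measure_isProbability.Build _ _ R (semicircular t) semicircular_setT.

End semicircular_probability.

Section free_probability.
Context {R : realType}.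
Implicit Types (mu nu rho : borel_probability R) (z : R[i]).

Definition upper_half_plane : set R[i] := [set z | 0 < complex.Im z].

Definition truncated_cone (alpha beta : R) : set R[i] :=
  [set z | `|complex.Re z| <= alpha * complex.Im z /\ beta <= complex.Im z].

(* The integral of the complex-valued function s |-> 1 / (z - s), taken
   componentwise. *)
Definition cauchy_transform mu z : R[i] :=
  (\int[mu]_s complex.Re ((z - s%:C)^-1))%R +i*
  (\int[mu]_s complex.Im ((z - s%:C)^-1))%R.

Definition F_transform mu z : R[i] := (cauchy_transform mu z)^-1.

Definition E_transform mu z : R[i] := z - F_transform mu z.

(* A right inverse of F_mu on a cone need not be unique as a C^+-valued map:
   for F_mu(w) = w - 1/w both roots of F_mu(w) = z can lie in C^+. As usual,
   F_mu^{-1} is the inverse of the restriction of F_mu to a truncated cone on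
   which F_mu is injective; its germ at infinity is then unique. *)
Definition is_F_inverse mu (alpha beta : R) (Finv : R[i] -> R[i]) : Prop :=
  exists alpha' beta' : R,
    [/\ 0 < alpha', 0 < beta',
        {in truncated_cone alpha' beta' &, injective (F_transform mu)} &
        forall z, truncated_cone alpha beta z ->
          truncated_cone alpha' beta' (Finv z) /\
          F_transform mu (Finv z) = z].

Definition is_voiculescu_transform mu (alpha beta : R)
    (phi : R[i] -> R[i]) : Prop :=
  exists2 Finv, is_F_inverse mu alpha beta Finv &
    forall z, truncated_cone alpha beta z -> phi z = Finv z - z.

(* The operations below are given by their graphs: "rho is the result". *)

Definition is_free_convolution mu nu rho : Prop :=
  exists (alpha beta : R) (phi_mu phi_nu phi_rho : R[i] -> R[i]),
    [/\ 0 < alpha /\ 0 < beta,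
        is_voiculescu_transform mu alpha beta phi_mu,
        is_voiculescu_transform nu alpha beta phi_nu,
        is_voiculescu_transform rho alpha beta phi_rho &
        forall z, truncated_cone alpha beta z ->
          phi_rho z = phi_mu z + phi_nu z].

(* rho = mu^{boxplus p}, meant for p >= 1 *)
Definition is_free_power (p : R) mu rho : Prop :=
  exists (alpha beta : R) (phi_mu phi_rho : R[i] -> R[i]),
    [/\ 0 < alpha /\ 0 < beta,
        is_voiculescu_transform mu alpha beta phi_mu,
        is_voiculescu_transform rho alpha beta phi_rho &
        forall z, truncated_cone alpha beta z -> phi_rho z = p%:C * phi_mu z].

(* rho = mu^{uplus q}, meant for q >= 0 *)
Definition is_boolean_power (q : R) mu rho : Prop :=
  forall z, upper_half_plane z -> E_transform rho z = q%:C * E_transform mu z.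

(* rho = B_t(mu), meant for t >= 0 *)
Definition is_belinschi_nica (t : R) mu rho : Prop :=
  exists2 nu, is_free_power (t + 1) mu nu & is_boolean_power (t + 1)^-1 nu rho.

Definition free_divisibility_indicator mu : \bar R :=
  ereal_sup [set t%:E | t in
    [set t : R | 0 <= t /\ exists nu, is_belinschi_nica t nu mu]].

End free_probability.

(* Main.v *)
Require Import Defs.
From HB Require Import structures.
From mathcomp Require Import all_boot all_order all_algebra.
From mathcomp Require Import finmap.
From mathcomp Require Import all_classical all_reals all_analysis.
From mathcomp Require Import measurable_realfun spectral.
From mathcomp Require Import ring lra complex.

(**
   Write s = sigma^2. For s = 0 the measure mu is the Dirac mass at 0, E_mu
   vanishes, and both sets consist of all t >= 0. For s > 0 the two sets of
   parameters t coincide.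

   Everything is read off the subordination form of the Voiculescu transforms.
   Substituting z = F_rho(w) in phi_nu(z) = c phi_rho(z) - s / z gives an
   identity for F_nu at a point close to w, valid for w far out in a cone
   [voiculescu_relationP]. As phi(z) = s / z for the semicircular distribution
   of variance s [F_semicircular], rho is the free convolution of nu and
   gamma_(ts) exactly when F_nu(w - t s G_rho(w)) = F_rho(w)
   [free_convolution_semicircularP], and nu1 is the (t + 1)-st free power of
   nu0 exactly when F_nu0(w - t E_nu1(w) / (t + 1)) = F_nu1(w) [free_powerP].
   If E_mu = E_nu1 / (t + 1) = s G_rho and E_nu0 = s G_nu, both identities say
   that G_nu(w - t s G_rho(w)) = G_rho(w). So the corollary reduces to passing
   between measures with E = s G_nu and arbitrary measures nu:

   - every z - c G_nu with c >= 0 is some F_mu [F_transform_sub_cauchy];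
   - if mu is centered with variance s > 0 then E_mu = s G_rho for some rho
     [E_transform_representation].

   For finitely supported measures both are statements about resolvents of
   Hermitian matrices: a bordered matrix, respectively the compression of a
   diagonal matrix to the complement of a vector ([atoms_inverse],
   [atoms_E_transform]). In general the measure is discretized, and Helly
   compactness provides a limit; the behaviour of iy G(iy) at infinity keeps
   mass from escaping [cauchy_transform_limit].

   The second representation needs moments, and nothing is assumed about those
   of nu0. They are recovered from the growth of E_nu0 along the imaginary
   axis [moments_of_E_transform], which subordination transfers from G_rho
   [E_transform_imag_subordination].

   The germs at infinity are controlled by one estimate: far out in a cone,
   E_mu is Lipschitz with a small constant [E_transform_cone]. Hence F_mu is
   injective there, so that the germ of its inverse is unique
   [F_inverse_near], and a fixed-point iteration inverts it
   [F_transform_invertible].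
*)

Set Implicit Arguments.
Unset Strict Implicit.
Unset Printing Implicit Defensive.

Import Order.TTheory GRing.Theory Num.Theory.
Import numFieldNormedType.Exports.

Local Open Scope classical_set_scope.
Local Open Scope ring_scope.
Local Open Scope complex_scope.

Notation normc := ComplexField.Normc.normc.
Notation Re := complex.Re.
Notation Im := complex.Im.

(** * Complex numbers and complex-valued integrals *)

Section modulus.
Context {R : realType}.
Implicit Types (z w : R[i]) (x : R).

Lemma normc_ge0 z : 0 <= normc z.
Proof. by case: z => a b; exact: sqrtr_ge0. Qed.

Lemma normcM z w : normc (z * w) = normc z * normc w.
Proof. exact: ComplexField.Normc.normcM. Qed.

Lemma normcV z : normc z^-1 = (normc z)^-1.
Proof. exact: ComplexField.Normc.normcV. Qed.

Lemma normcf_div z w : normc (z / w) = normc z / normc w.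
Proof. by rewrite normcM normcV. Qed.

Lemma normcN z : normc (- z) = normc z.
Proof. exact: complex.normcN. Qed.

Lemma normc0 : normc (0 : R[i]) = 0.
Proof. exact: ComplexField.Normc.normc0. Qed.

Lemma normc1 : normc (1 : R[i]) = 1.
Proof. exact: ComplexField.Normc.normc1. Qed.

Lemma ler_normcD z w : normc (z + w) <= normc z + normc w.
Proof. exact: le_normcD. Qed.

Lemma ler_normcB z w : normc (z - w) <= normc z + normc w.
Proof. by rewrite -(normcN w) ler_normcD. Qed.

Lemma normcBC z w : normc (z - w) = normc (w - z).
Proof. by rewrite -normcN opprB. Qed.

Lemma normcX z n : normc (z ^+ n) = normc z ^+ n.
Proof. by elim: n => [|n ih]; rewrite ?normc1// !exprS normcM ih. Qed.

Lemma normc_eq0 z : (normc z == 0) = (z == 0).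
Proof.
apply/eqP/eqP => [/ComplexField.Normc.eq0_normc//|->]; exact: normc0.
Qed.

Lemma normc_gt0 z : (0 < normc z) = (z != 0).
Proof. by rewrite lt_neqAle normc_ge0 andbT eq_sym normc_eq0. Qed.

Lemma normc_real x : normc x%:C = `|x|.
Proof. by rewrite /normc/= expr0n addr0 sqrtr_sqr. Qed.

Lemma normc_Re z : `|Re z| <= normc z.
Proof.
case: z => a b /=; rewrite -sqrtr_sqr ler_sqrt; last first.
  by rewrite addr_ge0// sqr_ge0.
by rewrite lerDl sqr_ge0.
Qed.

Lemma normc_Im z : `|Im z| <= normc z.
Proof.
case: z => a b /=; rewrite -sqrtr_sqr ler_sqrt; last first.
  by rewrite addr_ge0// sqr_ge0.
by rewrite lerDr sqr_ge0.
Qed.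

Lemma normc_ReIm z : normc z <= `|Re z| + `|Im z|.
Proof.
rewrite {1}(complexE z); apply: (le_trans (ler_normcD _ _)).
by rewrite normcM !normc_real /normc/= expr0n expr1n add0r sqrtr1 mul1r.
Qed.

Lemma ReD z w : Re (z + w) = Re z + Re w. Proof. by case: z; case: w. Qed.
Lemma ImD z w : Im (z + w) = Im z + Im w. Proof. by case: z; case: w. Qed.
Lemma ReN z : Re (- z) = - Re z. Proof. by case: z. Qed.
Lemma ImN z : Im (- z) = - Im z. Proof. by case: z. Qed.
Lemma ReB z w : Re (z - w) = Re z - Re w. Proof. by rewrite ReD ReN. Qed.
Lemma ImB z w : Im (z - w) = Im z - Im w. Proof. by rewrite ImD ImN. Qed.
Lemma ReM z w : Re (z * w) = Re z * Re w - Im z * Im w.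
Proof. by case: z; case: w. Qed.
Lemma ImM z w : Im (z * w) = Re z * Im w + Im z * Re w.
Proof. by case: z => a b; case: w => c d /=; rewrite (mulrC b). Qed.
Lemma ReV z : Re z^-1 = Re z / (Re z ^+ 2 + Im z ^+ 2).
Proof. by case: z. Qed.
Lemma ImV z : Im z^-1 = - (Im z / (Re z ^+ 2 + Im z ^+ 2)).
Proof. by case: z. Qed.

Lemma ReZ (c : R) z : Re (c%:C * z) = c * Re z.
Proof. by rewrite ReM mul0r subr0. Qed.
Lemma ImZ (c : R) z : Im (c%:C * z) = c * Im z.
Proof. by rewrite ImM mul0r addr0. Qed.

Lemma complexP z w : Re z = Re w -> Im z = Im w -> z = w.
Proof. by case: z => a b; case: w => c d /= -> ->. Qed.

Lemma upper_neq0 z : 0 < Im z -> z != 0.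
Proof. by apply: contraTneq => ->; rewrite ltxx. Qed.

Lemma upper_subr_neq0 z x : 0 < Im z -> z - x%:C != 0.
Proof. by move=> z0; apply: upper_neq0; rewrite ImB subr0. Qed.

(* At distance Im z from the real axis, the kernel is bounded by 1 / Im z. *)
Lemma normc_kernel z x : 0 < Im z -> normc (z - x%:C)^-1 <= (Im z)^-1.
Proof.
move=> z0; rewrite normcV lef_pV2 ?posrE// ?normc_gt0 ?upper_subr_neq0//.
apply: le_trans (normc_Im _); rewrite ImB subr0; exact: ler_norm.
Qed.

End modulus.

Section complex_limits.
Context {R : realType} {T : Type} (F : set_system T) {FF : Filter F}.
Implicit Types (f g : T -> R[i]) (l : R[i]).

Definition ccvg f l :=
  Re (f t) @[t --> F] --> Re l /\ Im (f t) @[t --> F] --> Im l.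

Lemma ccvg_normP f l : ccvg f l <->
  (forall e : R, 0 < e -> \forall t \near F, normc (f t - l) <= e).
Proof.
split=> [[/cvgrPdist_le hr /cvgrPdist_le hi] e e0|h].
  have e2 : 0 < e / 2 by rewrite divr_gt0.
  near=> t; apply: (le_trans (normc_ReIm _)); rewrite (splitr e).
  rewrite ReB ImB lerD// distrC.
    by near: t; exact: hr.
  by near: t; exact: hi.
split; apply/cvgrPdist_le => e e0; apply: filterS (h e e0) => t H.
  by rewrite distrC -ReB; apply: le_trans H; exact: normc_Re.
by rewrite distrC -ImB; apply: le_trans H; exact: normc_Im.
Unshelve. all: by end_near. Qed.

Lemma ccvg_cst l : ccvg (fun=> l) l.
Proof. by split; exact: cvg_cst. Qed.

Lemma ccvg_real (f : T -> R) (l : R) : f t @[t --> F] --> l ->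
  ccvg (fun t => (f t)%:C) l%:C.
Proof. by move=> fl; split => //; exact: cvg_cst. Qed.

Lemma ccvgD f g l l' : ccvg f l -> ccvg g l' -> ccvg (fun t => f t + g t) (l + l').
Proof.
move=> [fr fi] [gr gi]; split; rewrite ?ReD ?ImD.
  by under eq_fun do rewrite ReD; exact: cvgD.
by under eq_fun do rewrite ImD; exact: cvgD.
Qed.

Lemma ccvgN f l : ccvg f l -> ccvg (fun t => - f t) (- l).
Proof.
move=> [fr fi]; split; rewrite ?ReN ?ImN.
  by under eq_fun do rewrite ReN; exact: cvgN.
by under eq_fun do rewrite ImN; exact: cvgN.
Qed.

Lemma ccvgB f g l l' : ccvg f l -> ccvg g l' -> ccvg (fun t => f t - g t) (l - l').
Proof. by move=> fl gl; apply: ccvgD => //; exact: ccvgN. Qed.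

Lemma ccvgM f g l l' : ccvg f l -> ccvg g l' -> ccvg (fun t => f t * g t) (l * l').
Proof.
move=> [fr fi] [gr gi]; split; rewrite ?ReM ?ImM.
  by under eq_fun do rewrite ReM; apply: cvgB; exact: cvgM.
by under eq_fun do rewrite ImM; apply: cvgD; exact: cvgM.
Qed.

Lemma ccvgV f l : l != 0 -> ccvg f l -> ccvg (fun t => (f t)^-1) l^-1.
Proof.
move=> l0 [fr fi].
have d0 : Re l ^+ 2 + Im l ^+ 2 != 0.
  apply: contra l0 => /eqP; case: l {fr fi} => a b /= H.
  rewrite eq_complex/=; apply/andP.
  move/eqP: H; rewrite paddr_eq0 ?sqr_ge0// !sqrf_eq0 => /andP[/eqP-> /eqP->].
  by rewrite eqxx.
have sqr (h : T -> R) (c : R) : h t @[t --> F] --> c ->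
    h t ^+ 2 @[t --> F] --> c ^+ 2.
  by move=> hc; under eq_fun do rewrite expr2; rewrite expr2; exact: cvgM.
have dV : (Re (f t) ^+ 2 + Im (f t) ^+ 2)^-1 @[t --> F] -->
    (Re l ^+ 2 + Im l ^+ 2)^-1.
  by apply: cvgV => //; apply: cvgD; exact: sqr.
split; rewrite ?ReV ?ImV.
  by under eq_fun do rewrite ReV; exact: cvgM.
by under eq_fun do rewrite ImV; apply: cvgN; exact: cvgM.
Qed.

Lemma ccvg_near_eq f g l : (\forall t \near F, f t = g t) ->
  ccvg f l -> ccvg g l.
Proof.
move=> fg [fr fi]; split.
  by apply: cvg_trans fr; apply: near_eq_cvg; apply: filterS fg => t ->.
by apply: cvg_trans fi; apply: near_eq_cvg; apply: filterS fg => t ->.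
Qed.

End complex_limits.

Lemma Rintegral_cst_probability d (T : measurableType d) (R : realType)
  (P : probability T R) (c : R) : (\int[P]_x c)%R = c.
Proof.
rewrite Rintegral_cst//.
by have /(congr1 fine)/= -> := @probability_setT _ _ _ P; rewrite mulr1.
Qed.

Lemma Rintegral_dominated_cvg d (T : measurableType d) (R : realType)
    (mu : {measure set T -> \bar R}) (f_ : nat -> T -> R) (f g : T -> R) :
  (forall n, measurable_fun setT (f_ n)) ->
  (forall x, f_ n x @[n --> \oo] --> f x) ->
  mu.-integrable setT (EFin \o g) ->
  (forall n x, `|f_ n x| <= g x) ->
  mu.-integrable setT (EFin \o f) /\
  (\int[mu]_x f_ n x)%R @[n --> \oo] --> (\int[mu]_x f x)%R.
Proof.
move=> mf ff ig fg.
have mF n : measurable_fun setT (EFin \o f_ n) by exact/measurable_EFinP.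
have FF x : setT x -> (EFin \o f_ n) x @[n --> \oo] --> (EFin \o f) x.
  by move=> _; apply: cvg_EFin (ff x); exact: nearW.
have FG n x : setT x -> (`|(EFin \o f_ n) x| <= (EFin \o g) x)%E.
  by move=> _; rewrite lee_fin fg.
have ifl : mu.-integrable setT (EFin \o f).
  apply: (le_integrable measurableT _ _ ig).
    exact: (emeasurable_fun_cvg (fun n => EFin \o f_ n) _ mF FF).
  move=> x _; rewrite lee_fin.
  apply: (cvgr_to_le (cvg_norm (ff x))).
  by apply: nearW => n; rewrite (le_trans (fg n x))// ler_norm.
split => //; apply: (fine_cvg (a := (\int[mu]_x f x)%R)).
rewrite fineK; last exact: integrable_fin_num.
exact: (@dominated_cvg _ _ _ mu setT measurableT (fun n => EFin \o f_ n)
  (EFin \o f) (EFin \o g) mF FF _ ig FG).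
Qed.

Section complex_integral.
Context d (T : measurableType d) (R : realType).
Variable mu : {measure set T -> \bar R}.
Variables (D : set T) (mD : measurable D).
Implicit Types (f g : T -> R[i]).

Definition cint f : R[i] :=
  (\int[mu]_(x in D) Re (f x))%R +i* (\int[mu]_(x in D) Im (f x))%R.

Definition cintegrable f :=
  mu.-integrable D (EFin \o (fun x => Re (f x))) /\
  mu.-integrable D (EFin \o (fun x => Im (f x))).

Lemma eq_cint f g : {in D, f =1 g} -> cint f = cint g.
Proof.
by move=> fg; congr (_ +i* _); apply: eq_Rintegral => x xD; rewrite fg.
Qed.

Lemma eq_cintegrable f g : {in D, f =1 g} -> cintegrable f -> cintegrable g.
Proof.
move=> fg [fr fi]; split.
  by apply: eq_integrable fr => // x xD /=; rewrite fg.
by apply: eq_integrable fi => // x xD /=; rewrite fg.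
Qed.

Lemma cintegrableD f g : cintegrable f -> cintegrable g ->
  cintegrable (fun x => f x + g x).
Proof.
move=> [fr fi] [gr gi]; split.
  apply: eq_integrable (integrableD mD fr gr) => // x _ /=.
  by rewrite ReD.
apply: eq_integrable (integrableD mD fi gi) => // x _ /=.
by rewrite ImD.
Qed.

Lemma cintegrableZ (c : R[i]) f : cintegrable f ->
  cintegrable (fun x => c * f x).
Proof.
move=> [fr fi]; split.
  apply: eq_integrable (integrableB mD (integrableZl mD (Re c) fr)
    (integrableZl mD (Im c) fi)) => // x _ /=.
  by rewrite ReM.
apply: eq_integrable (integrableD mD (integrableZl mD (Re c) fi)
    (integrableZl mD (Im c) fr)) => // x _ /=.
by rewrite ImM.
Qed.

Lemma cintegrableB f g : cintegrable f -> cintegrable g ->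
  cintegrable (fun x => f x - g x).
Proof.
move=> hf hg; apply: eq_cintegrable (cintegrableD hf (cintegrableZ (-1) hg)).
by move=> x _; rewrite mulN1r.
Qed.

Lemma cintD f g : cintegrable f -> cintegrable g ->
  cint (fun x => f x + g x) = cint f + cint g.
Proof.
move=> [fr fi] [gr gi]; apply: complexP => /=.
  by rewrite -RintegralD//; apply: eq_Rintegral => x _; rewrite ReD.
by rewrite -RintegralD//; apply: eq_Rintegral => x _; rewrite ImD.
Qed.

Lemma cintZ (c : R[i]) f : cintegrable f ->
  cint (fun x => c * f x) = c * cint f.
Proof.
move=> [fr fi]; apply: complexP; rewrite ?ReM ?ImM /=.
  rewrite -!RintegralZl// -RintegralB//; last 2 first.
  - exact: (integrableZl mD (Re c) fr).
  - exact: (integrableZl mD (Im c) fi).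
  by apply: eq_Rintegral => x _; rewrite ReM.
rewrite -!RintegralZl// -RintegralD//; last 2 first.
- exact: (integrableZl mD (Re c) fi).
- exact: (integrableZl mD (Im c) fr).
by apply: eq_Rintegral => x _; rewrite ImM.
Qed.

Lemma cintB f g : cintegrable f -> cintegrable g ->
  cint (fun x => f x - g x) = cint f - cint g.
Proof.
move=> hf hg.
rewrite -mulN1r -(cintZ _ hg) -cintD//; last exact: cintegrableZ.
by apply: eq_cint => x _; rewrite mulN1r.
Qed.

(** Bounding real and imaginary parts separately costs the factor 2. *)
Lemma normc_cint_le f (g : T -> R) : cintegrable f ->
  mu.-integrable D (EFin \o g) -> (forall x, D x -> normc (f x) <= g x) ->
  normc (cint f) <= 2 * \int[mu]_(x in D) g x.
Proof.
move=> [fr fi] ig fg; apply: (le_trans (normc_ReIm _)) => /=.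
have H h : mu.-integrable D (EFin \o h) -> (forall x, D x -> `|h x| <= g x) ->
    `|\int[mu]_(x in D) h x| <= \int[mu]_(x in D) g x.
  move=> ih hg; apply: (le_trans (le_normr_Rintegral mD ih)).
  apply: le_Rintegral => //.
  by have := integrable_norm ih; apply: eq_integrable.
rewrite mulr2n mulrDl mul1r lerD// H// => x Dx.
  exact: le_trans (normc_Re _) (fg _ Dx).
exact: le_trans (normc_Im _) (fg _ Dx).
Qed.

Definition cmeasurable f :=
  measurable_fun D (fun x => Re (f x)) /\ measurable_fun D (fun x => Im (f x)).

Lemma cmeasurableD f g : cmeasurable f -> cmeasurable g ->
  cmeasurable (fun x => f x + g x).
Proof.
move=> [fr fi] [gr gi]; split.
  by under eq_fun do rewrite ReD; exact: measurable_funD.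
by under eq_fun do rewrite ImD; exact: measurable_funD.
Qed.

Lemma cmeasurableM f g : cmeasurable f -> cmeasurable g ->
  cmeasurable (fun x => f x * g x).
Proof.
move=> [fr fi] [gr gi]; split.
  under eq_fun do rewrite ReM.
  by apply: measurable_funB; exact: measurable_funM.
under eq_fun do rewrite ImM.
by apply: measurable_funD; exact: measurable_funM.
Qed.

Lemma cmeasurable_real (f : T -> R) : measurable_fun D f ->
  cmeasurable (fun x => (f x)%:C).
Proof. by move=> mf; split => //; exact: measurable_cst. Qed.

Lemma cintegrable_bounded f (M : R) : (mu D < +oo)%E -> cmeasurable f ->
  (forall x, D x -> normc (f x) <= M) -> cintegrable f.
Proof.
move=> Doo [fr fi] fM; split; apply: measurable_bounded_integrable => //.
  exists M; split; first exact: num_real.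
  move=> x Mx t Dt /=; apply: le_trans (ltW Mx).
  exact: le_trans (normc_Re _) (fM _ Dt).
exists M; split; first exact: num_real.
move=> x Mx t Dt /=; apply: le_trans (ltW Mx).
exact: le_trans (normc_Im _) (fM _ Dt).
Qed.

End complex_integral.

Section kernel.
Context {R : realType}.
Implicit Types (z : R[i]).

Lemma sqrD_gt0 (a y : R) : 0 < y -> 0 < a ^+ 2 + y ^+ 2.
Proof. by move=> y0; rewrite ltr_wpDl ?sqr_ge0// exprn_gt0. Qed.

Lemma continuous_kernel z : 0 < Im z ->
  continuous (fun s : R => Re (z - s%:C)^-1) /\
  continuous (fun s : R => Im (z - s%:C)^-1).
Proof.
move=> z0.
have cd : continuous (fun s : R => (Re z - s) ^+ 2 + Im z ^+ 2).
  move=> s; apply: cvgD; last exact: cvg_cst.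
  apply: (cvg_comp (fun s => Re z - s) (fun y => y ^+ 2)); last exact: sqr_continuous.
  by apply: cvgB; [exact: cvg_cst|exact: cvg_id].
have cV : continuous (fun s : R => ((Re z - s) ^+ 2 + Im z ^+ 2)^-1).
  move=> s; apply: cvgV; last exact: cd.
  by rewrite gt_eqF// sqrD_gt0.
split.
  under eq_fun do rewrite ReV ReB ImB/= subr0.
  move=> s; apply: cvgM; last exact: cV.
  by apply: cvgB; [exact: cvg_cst|exact: cvg_id].
under eq_fun do rewrite ImV ReB ImB/= subr0.
move=> s; apply: cvgN.
by apply: cvgM; [exact: cvg_cst|exact: cV].
Qed.

Lemma measurable_kernel z : 0 < Im z ->
  cmeasurable (setT : set (measurableTypeR R)) (fun s : R => (z - s%:C)^-1).
Proof.
move=> /continuous_kernel[cr ci].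
by split; exact: continuous_measurable_fun.
Qed.

Lemma measurable_kernel_comp d (T : measurableType d) (f : T -> R) z :
  0 < Im z -> measurable_fun setT f ->
  cmeasurable setT (fun x => (z - (f x)%:C)^-1).
Proof.
move=> z0 mf; have [kr ki] := measurable_kernel z0.
split; [exact: (measurableT_comp kr mf)|exact: (measurableT_comp ki mf)].
Qed.

End kernel.

(** * Nontangential asymptotics of the Cauchy transform *)

Section kernel_estimates.
Context {R : realType}.
Implicit Types (mu : borel_probability R) (z w : R[i]) (a b e : R).

Lemma coneS a a' b b' : 0 <= a' -> a <= a' -> b' <= b -> 0 <= b ->
  truncated_cone a b `<=` truncated_cone a' b'.
Proof.
move=> a0 aa bb b0 z [zr zi]; split; last exact: le_trans zi.
by apply: (le_trans zr); rewrite ler_wpM2r// (le_trans b0 zi).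
Qed.

Lemma cone_upper a b z : 0 < b -> truncated_cone a b z -> 0 < Im z.
Proof. by move=> b0 [_]; exact: lt_le_trans. Qed.

Lemma cone_normc a b z : truncated_cone a b z -> 0 < b ->
  normc z <= (1 + a) * Im z.
Proof.
move=> [zr zi] b0; apply: (le_trans (normc_ReIm _)).
rewrite (gtr0_norm (lt_le_trans b0 zi)) mulrDl mul1r addrC; lra.
Qed.

Definition cauchy_kernel z (s : R) : R[i] := (z - s%:C)^-1.

(** The deviation of z / (z - s) from 1, see [kernel_defectE]. *)
Definition kernel_defect z (s : R) : R[i] := s%:C * cauchy_kernel z s.

Lemma kernel_defectE z s : 0 < Im z ->
  z * cauchy_kernel z s = 1 + kernel_defect z s.
Proof.
by move=> z0; rewrite /kernel_defect /cauchy_kernel; field; exact: upper_subr_neq0.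
Qed.

(** The first bound holds because |z| <= (1 + a) Im z in the cone; the second
    one is small when |s| is small compared to the height of z. *)
Lemma kernel_defect_le a b z s : 0 < a -> 0 < b -> truncated_cone a b z ->
  normc (kernel_defect z s) <= Num.min (2 + a) (`|s| / b).
Proof.
move=> a0 b0 zc; have z0 := cone_upper b0 zc; rewrite le_min; apply/andP; split.
  have -> : kernel_defect z s = z * cauchy_kernel z s - 1.
    by rewrite kernel_defectE// addrC addKr.
  apply: (le_trans (ler_normcB _ _)); rewrite normc1 normcM.
  have : normc z * normc (cauchy_kernel z s) <= (1 + a) * Im z * (Im z)^-1.
    by rewrite ler_pM ?normc_ge0 ?normc_kernel// (cone_normc zc).
  by rewrite mulfK ?gt_eqF//; lra.
rewrite normcM normc_real ler_wpM2l// (le_trans (normc_kernel _ z0))//.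
by rewrite lef_pV2 ?posrE//; case: zc.
Qed.

Lemma measurable_kernel_defect z : 0 < Im z ->
  cmeasurable (setT : set (measurableTypeR R)) (kernel_defect z).
Proof.
move=> z0; apply: cmeasurableM; last exact: measurable_kernel.
by apply: cmeasurable_real; exact: measurable_id.
Qed.

Lemma probability_lty mu : (mu setT < +oo)%E.
Proof. exact: (le_lt_trans (probability_le1 _ _) (ltry _)). Qed.

Lemma cintegrable_kernel mu z : 0 < Im z ->
  cintegrable mu setT (cauchy_kernel z).
Proof.
move=> z0; apply: (@cintegrable_bounded _ _ _ _ _ _ _ (Im z)^-1) => //.
- exact: probability_lty.
- exact: measurable_kernel.
- by move=> s _; exact: normc_kernel.
Qed.

Lemma cint_cst mu (c : R[i]) : cint mu setT (fun=> c) = c.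
Proof. by apply: complexP => /=; exact: Rintegral_cst_probability. Qed.

Lemma cintegrable_cst mu (c : R[i]) : cintegrable mu setT (fun=> c).
Proof. by split; exact: finite_measure_integrable_cst. Qed.

Lemma cauchy_transformE mu z : cauchy_transform mu z = cint mu setT (cauchy_kernel z).
Proof. by []. Qed.

(** This bounds the integral of [kernel_defect] uniformly over the cone, with
    no moment assumption on mu. *)
Definition tail_modulus mu a b := \int[mu]_s Num.min (2 + a) (`|s| / b).

Let measurable_tail a b : measurable_fun (setT : set (measurableTypeR R))
  (fun s : R => Num.min (2 + a) (`|s| / b)).
Proof.
apply: measurable_minr; first exact: measurable_cst.
apply: measurable_funM; last exact: measurable_cst.
by apply: measurableT_comp; [exact: normr_measurable|exact: measurable_id].
Qed.

Lemma integrable_tail mu a b : 0 < a -> 0 < b ->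
  mu.-integrable setT (EFin \o (fun s : R => Num.min (2 + a) (`|s| / b))).
Proof.
move=> a0 b0; apply: measurable_bounded_integrable => //.
- exact: probability_lty.
- exists (2 + a); split; first exact: num_real.
  move=> x xa t _ /=; rewrite ger0_norm; last first.
    by rewrite le_min; apply/andP; split; [lra|rewrite divr_ge0// ltW].
  by rewrite ge_min (ltW xa).
Qed.

(** Dominated convergence: the integrand is at most 2 + a. *)
Lemma tail_modulus_small mu a e : 0 < a -> 0 < e ->
  exists2 b, 0 < b & tail_modulus mu a b <= e.
Proof.
move=> a0 e0.
have [] := @Rintegral_dominated_cvg _ _ _ mu
  (fun n s => Num.min (2 + a) (`|s| / n.+1%:R)) (fun=> 0) (fun=> 2 + a) _ _ _ _.
- by move=> n; exact: measurable_tail.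
- move=> s; apply/cvgrPdist_le => d d0; near=> n.
  have n0 : 0 < n.+1%:R :> R by rewrite ltr0n.
  rewrite sub0r normrN ger0_norm; last first.
    by rewrite le_min; apply/andP; split; [lra|rewrite divr_ge0// ltW].
  rewrite ge_min; apply/orP; right; rewrite ler_pdivrMr//.
  rewrite -ler_pdivrMl// mulrC; apply: (@le_trans _ _ n%:R); last by rewrite ler_nat.
  by near: n; exact: nbhs_infty_ger.
- exact: finite_measure_integrable_cst.
- move=> n s; have n0 : 0 < n.+1%:R :> R by rewrite ltr0n.
  rewrite ger0_norm; first by rewrite ge_min lexx.
  by rewrite le_min; apply/andP; split; [lra|rewrite divr_ge0// ltW].
rewrite Rintegral_cst_probability => _ /cvgrPdist_le /(_ e e0)[n _ /(_ n (leqnn n))].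
rewrite /= sub0r normrN => H; exists n.+1%:R => //.
exact: le_trans (ler_norm _) H.
Unshelve. all: by end_near. Qed.

Lemma tail_modulus_ge0 mu a b : 0 < a -> 0 < b -> 0 <= tail_modulus mu a b.
Proof.
move=> a0 b0; apply: Rintegral_ge0 => s _.
by rewrite le_min; apply/andP; split; [lra|rewrite divr_ge0// ltW].
Qed.

Lemma cintegrable_defect mu a b z : 0 < a -> 0 < b -> truncated_cone a b z ->
  cintegrable mu setT (kernel_defect z).
Proof.
move=> a0 b0 zc; apply: (@cintegrable_bounded _ _ _ _ _ _ _ (2 + a)) => //.
- exact: probability_lty.
- exact/measurable_kernel_defect/(cone_upper b0 zc).
- move=> s _; apply: le_trans (kernel_defect_le s a0 b0 zc) _.
  by rewrite ge_min lexx.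
Qed.

Lemma cauchy_transform_cone mu a b z : 0 < a -> 0 < b -> truncated_cone a b z ->
  normc (z * cauchy_transform mu z - 1) <= 2 * tail_modulus mu a b.
Proof.
move=> a0 b0 zc; have z0 := cone_upper b0 zc.
rewrite cauchy_transformE -cintZ//; last exact: cintegrable_kernel.
rewrite (eq_cint mu (g := fun s : measurableTypeR R => 1 + kernel_defect z s)); last first.
  by move=> s _; rewrite kernel_defectE.
rewrite cintD//; [|exact: cintegrable_cst|exact: cintegrable_defect zc].
rewrite cint_cst addrC addKr; apply: normc_cint_le => //.
- exact: cintegrable_defect zc.
- exact: integrable_tail.
- by move=> s _; exact: kernel_defect_le.
Qed.

(** By the resolvent identity, A is the integral of
    z w / ((z - s) (w - s)) = (1 + k_z) (1 + k_w) where k is the defect. *)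
Lemma cauchy_transform_increment mu a b z w : 0 < a -> 0 < b ->
  truncated_cone a b z -> truncated_cone a b w ->
  exists2 A, cauchy_transform mu z - cauchy_transform mu w =
    (w - z) / (z * w) * A &
    normc (A - 1) <= 2 * ((4 + a) * tail_modulus mu a b).
Proof.
move=> a0 b0 zc wc; have z0 := cone_upper b0 zc; have w0 := cone_upper b0 wc.
have mk v : 0 < Im v -> cmeasurable (setT : set (measurableTypeR R)) (cauchy_kernel v).
  exact: measurable_kernel.
have iKK : cintegrable mu setT (fun s => cauchy_kernel z s * cauchy_kernel w s).
  apply: (@cintegrable_bounded _ _ _ _ _ _ _ ((Im z)^-1 * (Im w)^-1)) => //.
  - exact: probability_lty.
  - by apply: cmeasurableM; exact: mk.
  - by move=> s _; rewrite normcM ler_pM ?normc_ge0 ?normc_kernel.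
pose D s := kernel_defect z s + kernel_defect w s + kernel_defect z s * kernel_defect w s.
have Dle s : normc (D s) <= (4 + a) * Num.min (2 + a) (`|s| / b).
  have := kernel_defect_le s a0 b0 zc; have := kernel_defect_le s a0 b0 wc.
  set m := Num.min _ _ => mw mz.
  apply: (le_trans (ler_normcD _ _)).
  have := ler_normcD (kernel_defect z s) (kernel_defect w s).
  have m2 : m <= 2 + a by rewrite ge_min lexx.
  have : normc (kernel_defect z s * kernel_defect w s) <= (2 + a) * m.
    by rewrite normcM ler_pM ?normc_ge0// (le_trans mz).
  by lra.
have mD : cmeasurable (setT : set (measurableTypeR R)) D.
  have mz := measurable_kernel_defect z0; have mw := measurable_kernel_defect w0.
  by apply: cmeasurableD; [exact: cmeasurableD|exact: cmeasurableM].
have iD : cintegrable mu setT D.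
  apply: (@cintegrable_bounded _ _ _ _ _ _ _ ((4 + a) * (2 + a))) => //.
  - exact: probability_lty.
  - move=> s _; apply: (le_trans (Dle s)); rewrite ler_wpM2l//; first lra.
    by rewrite ge_min lexx.
exists (1 + cint mu setT D).
  rewrite !cauchy_transformE -cintB//; [|exact: cintegrable_kernel..].
  rewrite (eq_cint mu (g := fun s : measurableTypeR R => (w - z) * (cauchy_kernel z s * cauchy_kernel w s))).
    rewrite cintZ// -mulrA; congr (_ * _).
    have zw0 : z * w != 0 by rewrite mulf_neq0// upper_neq0.
    apply: (mulfI zw0); rewrite mulrA mulfV// mul1r -cintZ//.
    rewrite (eq_cint mu (g := fun s : measurableTypeR R => 1 + D s)).
      by rewrite cintD//; [rewrite cint_cst|exact: cintegrable_cst].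
    move=> s _; rewrite mulrACA !kernel_defectE// /D; ring.
  move=> s _; rewrite /cauchy_kernel; field.
  by rewrite !upper_subr_neq0.
rewrite addrC addKr -RintegralZl//; last exact: integrable_tail.
apply: normc_cint_le => //.
exact: (integrableZl measurableT (4 + a) (integrable_tail mu a0 b0)).
Qed.

Lemma cauchy_transform_asymptotic mu a e : 0 < a -> 0 < e ->
  exists2 b, 0 < b & forall z, truncated_cone a b z ->
    normc (z * cauchy_transform mu z - 1) <= e.
Proof.
move=> a0 e0; have [b b0 be] := tail_modulus_small mu a0 (divr_gt0 e0 (ltr0Sn _ 1)).
exists b => // z zc; apply: (le_trans (cauchy_transform_cone mu a0 b0 zc)); lra.
Qed.

(** With B = z G(z) and C = w G(w), the increment of F = 1 / G is
    (z - w) A / (B C) for the A of [cauchy_transform_increment]. All of A, B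
    and C are close to 1, so almost nothing is left for the increment of
    E = z - F. *)
Lemma E_transform_cone mu a e : 0 < a -> 0 < e ->
  exists2 b, 0 < b & forall z w, truncated_cone a b z -> truncated_cone a b w ->
    [/\ cauchy_transform mu z != 0,
        normc (E_transform mu z) <= e * normc z &
        normc (E_transform mu z - E_transform mu w) <= e * normc (z - w)].
Proof.
move=> a0 e0.
(* |B C - A| <= 4 d and |B C| >= 1 / 4 when A, B and C are within d <= 1 / 2
   of 1. *)
pose d : R := Num.min (2^-1) (e / 16).
have d0 : 0 < d by rewrite lt_min invr_gt0 ltr0Sn divr_gt0.
have d2 : d <= 2^-1 by rewrite ge_min lexx.
have de : 16 * d <= e.
  by have : d <= e / 16 by [rewrite ge_min lexx orbT]; lra.
have e' : 0 < d / (2 * (4 + a)) by rewrite divr_gt0// mulr_gt0//; lra.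
have [b b0 be] := tail_modulus_small mu a0 e'.
have bd : 2 * ((4 + a) * tail_modulus mu a b) <= d.
  by rewrite mulrA mulrC -ler_pdivlMr// mulr_gt0//; lra.
have bd' : 2 * tail_modulus mu a b <= d.
  apply: le_trans bd; rewrite ler_wpM2l// ler_peMl//; last lra.
  exact: tail_modulus_ge0.
exists b => // z w zc wc.
have z0 := upper_neq0 (cone_upper b0 zc); have w0 := upper_neq0 (cone_upper b0 wc).
have [A AE A1] := cauchy_transform_increment mu a0 b0 wc zc.
have {A1}A1 := le_trans A1 bd.
have Bz := le_trans (cauchy_transform_cone mu a0 b0 zc) bd'.
have Bw := le_trans (cauchy_transform_cone mu a0 b0 wc) bd'.
rewrite /E_transform /F_transform.
move: (cauchy_transform mu z) (cauchy_transform mu w) AE Bz Bw => Gz Gw AE Bz Bw.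
have lb B : normc (B - 1) <= d -> 2^-1 <= normc B.
  move=> Bd; have := ler_normcB B (B - 1); rewrite opprB addrC subrK normc1; lra.
have Bz2 := lb _ Bz; have Bw2 := lb _ Bw.
have n0 (B : R[i]) : 2^-1 <= normc B -> B != 0.
  by move=> H; rewrite -normc_gt0; apply: lt_le_trans H; rewrite invr_gt0.
have Gz0 : Gz != 0 by have := n0 _ Bz2; rewrite mulf_eq0 negb_or => /andP[].
have Gw0 : Gw != 0 by have := n0 _ Bw2; rewrite mulf_eq0 negb_or => /andP[].
split => //.
  have -> : z - Gz^-1 = z * ((z * Gz - 1) / (z * Gz)) by field; rewrite z0 Gz0.
  rewrite normcM mulrC ler_wpM2r ?normc_ge0// normcf_div ler_pdivrMr; last first.
    by rewrite normc_gt0 mulf_neq0.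
  apply: (le_trans Bz); have : d / 2 <= d * normc (z * Gz) by rewrite ler_pM2l.
  have : 16 * d * normc (z * Gz) <= e * normc (z * Gz) by rewrite ler_wpM2r ?normc_ge0.
  by rewrite -mulrA => *; lra.
have -> : z - Gz^-1 - (w - Gw^-1) = (z - w) - (Gw - Gz) / (Gz * Gw).
  by field; rewrite Gz0 Gw0.
rewrite AE.
have -> : z - w - (z - w) / (w * z) * A / (Gz * Gw) =
    (z - w) * ((z * Gz * (w * Gw) - A) / (z * Gz * (w * Gw))).
  by field; rewrite z0 w0 Gz0 Gw0.
move: (z * Gz) (w * Gw) (mulf_neq0 z0 Gz0) (mulf_neq0 w0 Gw0) Bz Bw Bz2 Bw2.
move=> B C B0 C0 Bz Bw Bz2 Bw2.
rewrite normcM mulrC ler_wpM2r ?normc_ge0// normcf_div ler_pdivrMr; last first.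
  by rewrite normc_gt0 mulf_neq0.
have BC : 4^-1 <= normc (B * C).
  have -> : 4^-1 = 2^-1 * 2^-1 :> R by rewrite -invfM; congr _^-1; ring.
  by rewrite normcM ler_pM ?invr_ge0.
have num : normc (B * C - A) <= 4 * d.
  have -> : B * C - A = ((B - 1) * (C - 1) + (B - 1) + (C - 1)) - (A - 1) by ring.
  apply: (le_trans (ler_normcB _ _)).
  have H1 := ler_normcD ((B - 1) * (C - 1) + (B - 1)) (C - 1).
  have H2 := ler_normcD ((B - 1) * (C - 1)) (B - 1).
  have H3 : normc ((B - 1) * (C - 1)) <= 2^-1 * d.
    by rewrite normcM ler_pM ?normc_ge0// (le_trans Bz).
  lra.
have : e * 4^-1 <= e * normc (B * C) by rewrite ler_wpM2l// ltW.
by lra.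
Qed.

End kernel_estimates.

(** * Inverting F near infinity *)

Section cone_filter.
Context {R : realType}.
Implicit Types (mu : borel_probability R) (z w v : R[i]) (a b e : R).

Definition cone_infty a : set_system R[i] :=
  [set P | exists2 b, 0 < b & truncated_cone a b `<=` P].

Global Instance cone_infty_filter a : Filter (cone_infty a).
Proof.
split.
- by exists 1.
- move=> P Q [b b0 bP] [c c0 cQ]; exists (Num.max b c).
    by rewrite lt_max b0.
  move=> z [zr]; rewrite ge_max => /andP[bz cz]; split.
    exact: bP.
  exact: cQ.
- by move=> P Q PQ [b b0 bP]; exists b => // z /bP /PQ.
Qed.

Lemma near_cone a b : \forall z \near cone_infty a, truncated_cone a b z.
Proof.
exists (Num.max b 1); first by rewrite lt_max ltr01 orbT.
by move=> z [zr]; rewrite ge_max => /andP[].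
Qed.

Lemma near_coneS a a' b : 0 <= a -> a <= a' ->
  \forall z \near cone_infty a, truncated_cone a' b z.
Proof.
move=> a0 aa; apply: filterS2 (near_cone a b) (near_cone a 0) => z zb z0.
case: zb => zr zb; split => //; apply: (le_trans zr).
by rewrite ler_wpM2r//; case: z0.
Qed.

(** Discs of radius [cone_radius a] * Im z around points of slope at most a have
    slope at most 2 a; in particular the radius is less than Im z / 2. *)
Definition cone_radius a : R := a / (1 + 2 * a).

Lemma cone_radius_gt0 a : 0 < a -> 0 < cone_radius a.
Proof. by move=> a0; rewrite divr_gt0//; lra. Qed.

Lemma cone_disc a b z v : 0 < a -> 0 < b -> truncated_cone a b z ->
  normc (v - z) <= cone_radius a * Im z -> truncated_cone (2 * a) (b / 2) v.
Proof.
move=> a0 b0 [zr zb]; set r := cone_radius a => vz.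
have r2 : r <= 2^-1 by rewrite /r /cone_radius ler_pdivrMr; lra.
have rE : r * (1 + 2 * a) = a by rewrite /r /cone_radius divfK// gt_eqF//; lra.
have z0 : 0 < Im z := lt_le_trans b0 zb.
have := normc_Re (v - z); have := normc_Im (v - z); rewrite ReB ImB.
rewrite !ler_norml => /andP[vi1 vi2] /andP[vr1 vr2].
have rz : r * Im z <= 2^-1 * Im z by rewrite ler_wpM2r// ltW.
have vi : (1 - r) * Im z <= Im v by lra.
have avi : 2 * a * ((1 - r) * Im z) <= 2 * a * Im v by rewrite ler_wpM2l//; lra.
have e1 : 2 * a * ((1 - r) * Im z) = (a + r) * Im z.
  by transitivity ((2 * a - (r * (1 + 2 * a) - r)) * Im z); [ring|rewrite rE; ring].
split; last by lra.
move: zr; rewrite !ler_norml => /andP[zr1 zr2]; apply/andP; split; lra.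
Qed.

(** Tangency to the identity at infinity, in each cone. Such maps send cones
    into slightly wider cones, so that properties that hold far out in cones
    can be pulled back along them [near_identity_cone]. *)
Definition near_identity (f : R[i] -> R[i]) := forall a e, 0 < a -> 0 < e ->
  \forall z \near cone_infty a, normc (f z - z) <= e * normc z.

Lemma near_identity_Im f a e : near_identity f -> 0 < a -> 0 < e ->
  \forall z \near cone_infty a, normc (f z - z) <= e * Im z.
Proof.
move=> nf a0 e0; have e1 : 0 < e / (1 + a) by rewrite divr_gt0// addr_gt0.
apply: filterS2 (near_cone a 1) (nf _ _ a0 e1) => z zc H.
apply: (le_trans H); rewrite mulrAC ler_pdivrMr ?addr_gt0// -mulrA.
by rewrite ler_wpM2l ?(ltW e0)// mulrC (cone_normc zc).
Qed.

Lemma near_identity_cone f a : near_identity f -> 0 < a ->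
  f z @[z --> cone_infty a] `=>` cone_infty (2 * a).
Proof.
move=> nf a0 P [b b0 bP].
apply: filterS2 (near_cone a (Num.max (2 * b) 1))
  (near_identity_Im nf a0 (cone_radius_gt0 a0)) => z zc Hz.
have m0 : 0 < Num.max (2 * b) 1 by rewrite lt_max ltr01 orbT.
apply: bP; apply: coneS (cone_disc a0 m0 zc Hz); rewrite ?lexx//; first lra.
- have : 2 * b <= Num.max (2 * b) 1 by rewrite le_max lexx.
  by lra.
- lra.
Qed.

Lemma near_identity_F mu : near_identity (F_transform mu).
Proof.
move=> a e a0 e0; have [b b0 H] := E_transform_cone mu a0 e0.
exists b => // z zc; have [_ + _] := H z z zc zc.
by rewrite /E_transform normcBC.
Qed.

(** The sequence u_n - 2 C / 2^n increases and stays below the decreasing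
    sequence u_n + 2 C / 2^n. *)
Lemma geometric_cvg (u : nat -> R) (C : R) :
  (forall n, `|u n.+1 - u n| <= C * (2^-1) ^+ n) ->
  exists l : R, u n @[n --> \oo] --> l.
Proof.
move=> uC.
have C0 : 0 <= C by have := uC 0%N; rewrite expr0 mulr1; apply: le_trans.
have p0 n : 0 <= C * (2^-1) ^+ n :> R by rewrite mulr_ge0// exprn_ge0// invr_ge0.
pose a n := u n - 2 * (C * (2^-1) ^+ n).
pose b n := u n + 2 * (C * (2^-1) ^+ n).
have h n : 2 * (C * 2^-1 ^+ n.+1) = C * 2^-1 ^+ n :> R.
  by rewrite exprS mulrCA mulVKf.
have a_nd : nondecreasing_seq a.
  apply/nondecreasing_seqP => n; rewrite /a h.
  by have := uC n; rewrite ler_norml => /andP[]; lra.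
have b_ni n : b n <= b 0%N.
  elim: n => // n; apply: le_trans; rewrite /b h.
  by have := uC n; rewrite ler_norml => /andP[]; lra.
have ca : cvgn a.
  apply: nondecreasing_is_cvgn => //; exists (b 0%N) => _ [n _ <-].
  by apply: le_trans (b_ni n); rewrite /a /b; have := p0 n; lra.
exists (limn a + 2 * (C * 0)).
have -> : u = (fun n => a n + 2 * (C * 2^-1 ^+ n)).
  by apply/funext => n; rewrite /a subrK.
apply: cvgD => //; apply: cvgMr; apply: cvgMr; apply: cvg_expr.
by rewrite ger0_norm ?invr_ge0// invf_lt1// ltr1n.
Qed.

Lemma le_addgt0 (x y : R) : (forall d, 0 < d -> x <= y + d) -> x <= y.
Proof. by move=> H; apply/ler_addgt0Pr => d d0; exact: H. Qed.

(** Iterating v |-> z + e(v) from z stays in the disc and halves the increments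
    at each step. *)
Lemma fixed_point (e : R[i] -> R[i]) z (rho : R) :
  0 <= rho ->
  (forall v, normc (v - z) <= rho -> normc (e v) <= rho) ->
  (forall v w, normc (v - z) <= rho -> normc (w - z) <= rho ->
    normc (e v - e w) <= 2^-1 * normc (v - w)) ->
  exists2 w, w - e w = z & normc (w - z) <= rho.
Proof.
move=> rho0 eself elip.
pose v n := iter n (fun v => z + e v) z.
have vD n : normc (v n - z) <= rho.
  case: n => [|n]; first by rewrite subrr normc0.
  by elim: n => [|n ih] /=; rewrite addrC addKr; apply: eself => //;
    rewrite ?subrr ?normc0.
have vS n : normc (v n.+1 - v n) <= rho * 2^-1 ^+ n.
  elim: n => [|n ih]; first by rewrite expr0 mulr1; exact: vD.
  have -> : v n.+2 - v n.+1 = e (v n.+1) - e (v n) by rewrite /v /=; ring.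
  apply: (le_trans (elip _ _ (vD _) (vD _))); rewrite exprS mulrCA ler_pM2l//.
have [x vx] : exists l : R, Re (v n) @[n --> \oo] --> l.
  apply: (@geometric_cvg _ rho) => n; rewrite -ReB.
  exact: le_trans (normc_Re _) (vS n).
have [y vy] : exists l : R, Im (v n) @[n --> \oo] --> l.
  apply: (@geometric_cvg _ rho) => n; rewrite -ImB.
  exact: le_trans (normc_Im _) (vS n).
pose w := x +i* y.
have /ccvg_normP vw : ccvg \oo v w by split.
have wD : normc (w - z) <= rho.
  apply: le_addgt0 => d d0; have [n _ /(_ n (leqnn n)) /= Hn] := vw d d0.
  have -> : w - z = (v n - z) - (v n - w) by ring.
  by apply: (le_trans (ler_normcB _ _)); rewrite lerD.
exists w => //; apply/eqP; rewrite -subr_eq0 -normc_eq0 eq_le normc_ge0 andbT.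
apply: le_addgt0 => d d0; rewrite add0r.
have [n _ Hn] := vw (d / 2) (divr_gt0 d0 (ltr0Sn _ 1)).
have H1 := Hn n (leqnn n); have H2 := Hn n.+1 (leqnSn n).
have -> : w - e w - z = (e (v n) - e w) - (v n.+1 - w) by rewrite /v/=; ring.
apply: (le_trans (ler_normcB _ _)).
have := elip _ _ (vD n) wD; move: H1 H2 => /=; lra.
Qed.

(** If F(z) = F(w) then z - w = E(z) - E(w), which is at most |z - w| / 2 in
    modulus. A preimage of z is a fixed point of v |-> z + E(v) near z. *)
Lemma F_transform_invertible mu a e : 0 < a -> 0 < e ->
  exists2 b0, 0 < b0 &
    {in truncated_cone (2 * a) b0 &, injective (F_transform mu)} /\
    forall b z, 2 * b0 <= b -> truncated_cone a b z ->
      exists w, [/\ truncated_cone (2 * a) (b / 2) w, F_transform mu w = z &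
                    normc (w - z) <= e * Im z].
Proof.
move=> a0 e0; have r0 := cone_radius_gt0 a0.
pose r := Num.min e (cone_radius a).
have rr : r <= cone_radius a by rewrite ge_min lexx orbT.
have re : r <= e by rewrite ge_min lexx.
have {}r0 : 0 < r by rewrite lt_min e0.
(* On the disc |E v| <= d |v| <= d (1 + a + r) Im z <= r Im z. *)
pose d := Num.min 2^-1 (r / (1 + a + r)).
have den0 : 0 < 1 + a + r by lra.
have d0 : 0 < d by rewrite lt_min invr_gt0 ltr0Sn divr_gt0.
have d2 : d <= 2^-1 by rewrite ge_min lexx.
have dr : d * (1 + a + r) <= r by rewrite -ler_pdivlMr// ge_min lexx orbT.
have aa : 0 < 2 * a by lra.
have [b0 b00 HE] := E_transform_cone mu aa d0.
have FE w : F_transform mu w = w - E_transform mu w by rewrite /E_transform; ring.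
exists b0 => //; split.
  move=> z w /set_mem zc /set_mem wc Fzw; have [_ _ H] := HE z w zc wc.
  apply/eqP; rewrite -subr_eq0 -normc_eq0 eq_le normc_ge0 andbT.
  have EE : E_transform mu z - E_transform mu w = z - w.
    by rewrite /E_transform Fzw; ring.
  rewrite EE in H.
  have : d * normc (z - w) <= 2^-1 * normc (z - w) by rewrite ler_wpM2r ?normc_ge0.
  lra.
move=> b z bb zc; have b_gt0 : 0 < b by lra.
have z0 : 0 < Im z := cone_upper b_gt0 zc.
have disc v : normc (v - z) <= r * Im z -> truncated_cone (2 * a) (b / 2) v.
  move=> vz; apply: cone_disc zc _ => //; apply: (le_trans vz).
  by rewrite ler_wpM2r// ltW.
have disc0 v : normc (v - z) <= r * Im z -> truncated_cone (2 * a) b0 v.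
  by move=> /disc; apply: coneS => //; lra.
have [] := @fixed_point (E_transform mu) z (r * Im z).
- by rewrite mulr_ge0// ltW.
- move=> v vz; have [_ H _] := HE v v (disc0 v vz) (disc0 v vz).
  apply: (le_trans H).
  have vn : normc v <= (1 + a + r) * Im z.
    rewrite -[v](subrK z); apply: (le_trans (ler_normcD _ _)).
    have := cone_normc zc b_gt0; lra.
  apply: (@le_trans _ _ (d * ((1 + a + r) * Im z))); first by rewrite ler_wpM2l// ltW.
  by rewrite mulrA ler_wpM2r// ltW.
- move=> v w /disc0 vc /disc0 wc; have [_ _ H] := HE v w vc wc.
  by apply: (le_trans H); rewrite ler_wpM2r ?normc_ge0.
move=> w wz wr; exists w; split; [exact: disc|by rewrite FE|].
by apply: (le_trans wr); rewrite ler_wpM2r// ltW.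
Qed.

(** Since F(w) is close to w, it lies in the domain of the inverse; both w and
    the chosen preimage of F(w) lie in the cone where F is injective. *)
Lemma F_inverse_near mu a b Finv : 0 < a -> is_F_inverse mu a b Finv ->
  exists2 a0, 0 < a0 & forall a', 0 < a' -> a' <= a0 ->
    \forall w \near cone_infty a',
      truncated_cone a b (F_transform mu w) /\ Finv (F_transform mu w) = w.
Proof.
move=> a0 [a1 [b1 [a10 b10 inj FinvE]]].
pose m := Num.min a a1; have m0 : 0 < m by rewrite lt_min a0.
have ma : m <= a by rewrite ge_min lexx.
have ma1 : m <= a1 by rewrite ge_min lexx orbT.
exists (m / 2) => [|a' a'0 a'm]; first by rewrite divr_gt0.
have H1 : \forall w \near cone_infty a', truncated_cone a b (F_transform mu w).
  apply: (near_identity_cone (near_identity_F mu) a'0).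
  by apply: near_coneS; lra.
have H2 : \forall w \near cone_infty a', truncated_cone a1 b1 w.
  by apply: near_coneS; lra.
apply: filterS2 H1 H2 => w Fw wc; split=> //.
have [FFc FF] := FinvE _ Fw.
by apply: inj; rewrite ?inE.
Qed.

(** The relation phi_1 = c phi_2 - s / z freed from inverse functions by the
    substitution z = F_2(w), for which phi_2(z) = w - z. *)
Lemma voiculescu_relationP mu1 mu2 (c s : R) :
  (exists (a b : R) (phi1 phi2 : R[i] -> R[i]),
    [/\ 0 < a /\ 0 < b, is_voiculescu_transform mu1 a b phi1,
        is_voiculescu_transform mu2 a b phi2 &
        forall z, truncated_cone a b z -> phi1 z = c%:C * phi2 z - s%:C / z]) <->
  exists2 a, 0 < a & \forall w \near cone_infty a,
    F_transform mu1 (F_transform mu2 w + c%:C * (w - F_transform mu2 w) -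
      s%:C / F_transform mu2 w) = F_transform mu2 w.
Proof.
split.
  move=> [a [b [phi1 [phi2 [[a0 b0] [I1 FI1 phi1E] [I2 FI2 phi2E] phiE]]]]].
  have [a2 a20 H] := F_inverse_near a0 FI2.
  exists a2 => //; apply: filterS (H a2 a20 (lexx _)) => w [Fc FK].
  have [a' [b' [_ _ _ /(_ _ Fc)[_ F1]]]] := FI1.
  rewrite -[RHS]F1; congr (F_transform mu1 _).
  have := phiE _ Fc; rewrite phi1E// phi2E// FK => e.
  by rewrite -addrA -e; ring.
move=> [a2 a20 [b2 b20 Hw]].
pose a := a2 / 2; have a0 : 0 < a by rewrite divr_gt0.
have a2E : 2 * a = a2 by rewrite /a; field.
have r0 := cone_radius_gt0 a0; set r := cone_radius a in r0.
have c1 : 0 < 2 * (`|c| + 1) by rewrite mulr_gt0// ltr_wpDl.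
(* Chosen so that z + c (w - z) - s / z stays within the cone radius of z. *)
pose e := r / (2 * (`|c| + 1)); have e0 : 0 < e by rewrite divr_gt0.
have [b3 b30 [inj2 F2]] := F_transform_invertible mu2 a0 e0.
have [b4 b40 [inj1 _]] := F_transform_invertible mu1 a0 e0.
(* Above this height |s / z| is at most half the cone radius. *)
pose b5 := 1 + 2 * `|s| / r.
have s0 : 0 <= 2 * `|s| / r by apply: divr_ge0; [exact: mulr_ge0|exact: ltW].
pose b := 2 * b2 + 2 * b3 + 2 * b4 + b5.
have b5b : 1 + 2 * `|s| / r <= b by rewrite /b /b5; lra.
have b0 : 0 < b by rewrite /b /b5; lra.
have b3b : 2 * b3 <= b by rewrite /b /b5; lra.
have ex z : exists w, truncated_cone a b z ->
    [/\ truncated_cone a2 (b / 2) w, F_transform mu2 w = z &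
        normc (w - z) <= e * Im z].
  have [zc|zc] := pselect (truncated_cone a b z); last by exists z.
  by have [w] := F2 b z b3b zc; rewrite a2E => Hw'; exists w.
have [I2 I2E] := choice ex.
pose I1 z := z + c%:C * (I2 z - z) - s%:C / z.
have b2b (x : R) : x <= b2 + b3 + b4 -> x <= b / 2 by rewrite /b /b5; lra.
have FI2 : is_F_inverse mu2 a b I2.
  exists a2, b3; split => //; first by rewrite -a2E.
  move=> z zc; have [wc Fw _] := I2E z zc; split => //.
  by apply: coneS wc; [exact: ltW a20|exact: lexx|by apply: b2b; lra|lra].
have FI1 : is_F_inverse mu1 a b I1.
  exists a2, b4; split => //; first by rewrite -a2E.
  move=> z zc; have [wc Fw wz] := I2E z zc; have z0 := cone_upper b0 zc; split.
    have u : truncated_cone (2 * a) (b / 2) (I1 z).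
      apply: (cone_disc a0 b0 zc); rewrite -/r.
      have -> : I1 z - z = c%:C * (I2 z - z) - s%:C / z by rewrite /I1; ring.
      apply: (le_trans (ler_normcB _ _)); rewrite normcM normcf_div !normc_real.
      have A1 : `|c| * normc (I2 z - z) <= r / 2 * Im z.
        apply: (@le_trans _ _ ((`|c| + 1) * (e * Im z))).
          by apply: ler_pM; rewrite ?normc_ge0// lerDl.
        by rewrite le_eqVlt; apply/orP; left; apply/eqP; rewrite /e; field;
           rewrite gt_eqF// ltr_wpDl.
      have bz : b <= Im z by case: zc.
      have A2 : `|s| / normc z <= r / 2 * Im z.
        apply: (@le_trans _ _ `|s|).
          rewrite ler_pdivrMr ?normc_gt0 ?upper_neq0//.
          rewrite ler_peMr//; apply: le_trans (le_trans _ (normc_Im z)) => //.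
          apply: le_trans (ler_norm _); lra.
        have : 2 * `|s| / r <= Im z by lra.
        by rewrite ler_pdivrMr//; lra.
      by lra.
    by rewrite a2E in u; apply: coneS u; [exact: ltW a20|exact: lexx|by apply: b2b; lra|lra].
  have : truncated_cone a2 b2 (I2 z).
    by apply: coneS wc; [exact: ltW a20|exact: lexx|by apply: b2b; lra|lra].
  by move=> /Hw; rewrite Fw.
exists a, b, (fun z => I1 z - z), (fun z => I2 z - z); split => //.
- by exists I1.
- by exists I2.
- by move=> z _; rewrite /I1; ring.
Qed.

End cone_filter.

(** * Finitely supported measures and Hermitian matrices *)

Section atomic.
Context {R : realType}.
Implicit Types (L : seq (R * R)) (z : R[i]).

(** A finite list of pairs (weight, atom) stands for a discrete measure. Atoms
    may be repeated and weights may vanish, so that spectra can be listed with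
    multiplicity. *)
Definition atoms_mass L : R := \sum_(a <- L) a.1.
Definition atoms_cauchy L z : R[i] := \sum_(a <- L) a.1%:C / (z - a.2%:C).
Definition atoms_ge0 L : Prop := forall a, a \in L -> 0 <= a.1.

Lemma conjC_normc (z : R[i]) : Num.conj z * z = (normc z ^+ 2)%:C.
Proof.
rewrite -[LHS]/(conjc z * z); case: z => a b.
by rewrite sqr_sqrtr ?addr_ge0 ?sqr_ge0//; apply: complexP => /=; ring.
Qed.

Local Open Scope sesquilinear_scope.

Lemma realsym_hermitian n (H : 'M[R[i]]_n) (h : 'I_n -> 'I_n -> R) :
  (forall i j, H i j = (h i j)%:C) -> (forall i j, h i j = h j i) ->
  H \is hermsymmx.
Proof.
move=> Hh hs; apply: realsym_hermsym.
  apply/is_hermitianmxP; rewrite expr0 scale1r map_mx_id//.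
  by apply/matrixP => i j; rewrite !mxE !Hh hs.
apply/mxOverP => i j; rewrite Hh; apply/complex_realP; by exists (h i j).
Qed.

(** In an orthonormal eigenbasis the resolvent is diagonal: the atoms are the
    eigenvalues, weighted by the squared moduli of the coordinates of u. *)
Lemma hermitian_resolvent n (H : 'M[R[i]]_n) (u : 'cV[R[i]]_n) :
  H \is hermsymmx ->
  exists L, [/\ atoms_ge0 L, atoms_mass L = \sum_j normc (u j 0) ^+ 2 &
    forall z (y : 'cV[R[i]]_n), 0 < Im z -> z *: y - H *m y = u ->
      \sum_j Num.conj (u j 0) * y j 0 = atoms_cauchy L z].
Proof.
move=> Hh.
have HE := orthomx_spectralP (hermitian_normalmx Hh).
have dr := hermitian_spectral_diag_real Hh.
have PU := spectral_unitarymx H; have Pu := spectral_unit H.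
move: (spectralmx H) (spectral_diag H) HE dr PU Pu => P D HE dr PU Pu.
have dE j : D 0 j = (Re (D 0 j))%:C.
  by rewrite RRe_real//; exact: (mxOverP dr).
have PP (a b : 'cV[R[i]]_n) :
    \sum_j Num.conj (a j 0) * b j 0 =
    \sum_j Num.conj ((P *m a) j 0) * (P *m b) j 0.
  have E (c e : 'cV[R[i]]_n) :
      \sum_j Num.conj (c j 0) * e j 0 = (c^t* *m e) 0 0.
    by rewrite mxE; apply: eq_bigr => j _; rewrite !mxE.
  rewrite !E trmx_mul map_mxM -mulmxA (mulmxA _ P) -(invmx_unitary PU).
  by rewrite mulVmx// mul1mx.
exists [seq (normc ((P *m u) j 0) ^+ 2, Re (D 0 j)) | j <- enum 'I_n]; split.
- by move=> a /mapP[j _ ->] /=; rewrite sqr_ge0.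
- rewrite /atoms_mass big_map big_enum/=; apply: complexI.
  rewrite !rmorph_sum/=.
  transitivity (\sum_j Num.conj ((P *m u) j 0) * (P *m u) j 0).
    by apply: eq_bigr => j _; rewrite conjC_normc.
  by rewrite -PP; apply: eq_bigr => j _; rewrite conjC_normc.
move=> z y z0 yE; rewrite PP /atoms_cauchy big_map big_enum/=.
apply: eq_bigr => j _; rewrite -conjC_normc -mulrA; congr (_ * _).
have zn0 := upper_subr_neq0 (Re (D 0 j)) z0.
apply: (mulIf zn0); rewrite mulfVK//.
rewrite -yE mulmxBr HE !mulmxA mulmxV// mul1mx -!mulmxA -scalemxAr.
by move: (P *m y) => q; rewrite mul_diag_mx -dE !mxE; ring.
Qed.

(** By the Schur complement formula, z - c G is the inverse of the upper left
    entry of the resolvent of the matrix with rows (0, a^T) and (a, D), where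
    D is the diagonal matrix of the atoms and a_i^2 is c times the i-th
    weight. *)
Lemma atoms_inverse L (c : R) : 0 <= c -> atoms_ge0 L ->
  exists N, [/\ atoms_ge0 N, atoms_mass N = 1 &
    forall z, 0 < Im z -> z - c%:C * atoms_cauchy L z != 0 ->
      (z - c%:C * atoms_cauchy L z)^-1 = atoms_cauchy N z].
Proof.
move=> c0 L0; pose n := size L.
pose m (i : 'I_n) : R := (tnth (in_tuple L) i).1.
pose x (i : 'I_n) : R := (tnth (in_tuple L) i).2.
have m0 i : 0 <= m i by apply: L0; exact: mem_tnth.
pose a : 'cV[R[i]]_n := \col_i (Num.sqrt (c * m i))%:C.
pose D : 'M[R[i]]_n := diag_mx (\row_i (x i)%:C).
pose H : 'M[R[i]]_(1 + n) := block_mx 0 a^T a D.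
pose u : 'cV[R[i]]_(1 + n) := col_mx 1%:M 0.
have HH : H \is hermsymmx.
  apply: (@realsym_hermitian _ _ (fun i j => Re (H i j))).
    move=> i j; rewrite RRe_real//.
    case: (split_ordP i) => i' ->; case: (split_ordP j) => j' ->.
    - by rewrite block_mxEul mxE.
    - by rewrite block_mxEur !mxE; apply/complex_realP; eexists.
    - by rewrite block_mxEdl !mxE; apply/complex_realP; eexists.
    - by rewrite block_mxEdr !mxE rpredMn//; apply/complex_realP; eexists.
  suff HT : H^T = H by move=> i j; rewrite -[in LHS]HT mxE.
  by rewrite /H tr_block_mx trmx0 trmxK /D tr_diag_mx.
have [N [N0 NM NE]] := hermitian_resolvent u HH.
exists N; split => //.
  rewrite NM big_split_ord/= big_ord1 big1 ?addr0.
    by rewrite col_mxEu mxE eqxx normc1 expr1n.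
  by move=> i _; rewrite col_mxEd mxE normc0 expr0n.
move=> z z0; set g := (_ - _) => g0.
pose w : 'cV[R[i]]_n := \col_i (g^-1 * (Num.sqrt (c * m i))%:C / (z - (x i)%:C)).
(* The first column of the resolvent. *)
pose y : 'cV[R[i]]_(1 + n) := col_mx (g^-1)%:M w.
rewrite -(NE z y)//.
  rewrite big_split_ord/= big_ord1 [X in _ + X]big1 ?addr0.
    by rewrite !col_mxEu !mxE !eqxx !mulr1n rmorph1 mul1r.
  by move=> i _; rewrite !col_mxEd !mxE rmorph0 mul0r.
rewrite /H /y mul_block_col scale_col_mx opp_col_mx add_col_mx /u.
congr col_mx; apply/matrixP => i j; rewrite (ord1 j) {j}.
  rewrite (ord1 i) !mxE big1 ?add0r; last first.
    by move=> k _; rewrite !mxE mul0r.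
  rewrite !eqxx !mulr1n.
  have -> : \sum_j a^T 0 j * w j 0 = g^-1 * (c%:C * atoms_cauchy L z).
    rewrite /atoms_cauchy [in RHS]big_tnth !mulr_sumr; apply: eq_bigr => k _.
    rewrite !mxE -/(m k) -/(x k).
    have -> : c%:C * ((m k)%:C / (z - (x k)%:C)) =
        (Num.sqrt (c * m k))%:C ^+ 2 / (z - (x k)%:C).
      by rewrite -rmorphXn sqr_sqrtr ?mulr_ge0// rmorphM mulrA.
    by ring.
  by rewrite -(mulVf g0) /g; ring.
rewrite !mxE big_ord1.
have -> : \sum_j D i j * w j 0 = (x i)%:C * w i 0.
  by transitivity ((D *m w) i 0); [rewrite mxE|rewrite mul_diag_mx !mxE].
rewrite !mxE !eqxx !mulr1n.
have zx := upper_subr_neq0 (x i) z0.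
by field; rewrite zx g0.
Qed.

(** Let D be the diagonal matrix of the atoms, v the unit vector of the square
    roots of the weights, and Q the orthogonal projection along v. Then
    z - 1 / G(z) - b is the quadratic form of the resolvent of Q D Q at the
    vector Q D v, whose squared length is the variance. *)
Lemma atoms_E_transform L : atoms_ge0 L -> atoms_mass L = 1 ->
  let b := \sum_(a <- L) a.1 * a.2 in
  exists N, [/\ atoms_ge0 N,
    atoms_mass N = \sum_(a <- L) a.1 * a.2 ^+ 2 - b ^+ 2 &
    forall z, 0 < Im z -> atoms_cauchy L z != 0 ->
      z - (atoms_cauchy L z)^-1 = b%:C + atoms_cauchy N z].
Proof.
move=> L0 L1 b; pose n := size L.
pose m (i : 'I_n) : R := (tnth (in_tuple L) i).1.
pose x (i : 'I_n) : R := (tnth (in_tuple L) i).2.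
pose v i := Num.sqrt (m i).
have v2 i : v i ^+ 2 = m i.
  by rewrite sqr_sqrtr//; apply: L0; exact: mem_tnth.
have M1 : \sum_i v i ^+ 2 = 1.
  by rewrite -L1 /atoms_mass [RHS]big_tnth; apply: eq_bigr => i _; rewrite v2.
have Mb : \sum_i v i ^+ 2 * x i = b.
  by rewrite /b [RHS]big_tnth; apply: eq_bigr => i _; rewrite v2.
have M2 : \sum_i v i ^+ 2 * x i ^+ 2 = \sum_(a <- L) a.1 * a.2 ^+ 2.
  by rewrite [RHS]big_tnth; apply: eq_bigr => i _; rewrite v2.
have MG z : atoms_cauchy L z = \sum_i (v i)%:C ^+ 2 / (z - (x i)%:C).
  rewrite /atoms_cauchy big_tnth; apply: eq_bigr => i _.
  by rewrite -rmorphXn v2.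
(* The entries of Q D Q. *)
pose h i j : R := x i *+ (i == j) + v i * v j * (b - x i - x j).
pose H : 'M[R[i]]_n := \matrix_(i, j) (h i j)%:C.
pose u : 'cV[R[i]]_n := \col_i ((x i - b) * v i)%:C.
have HH : H \is hermsymmx.
  apply: (@realsym_hermitian _ _ h) => i j; first by rewrite mxE.
  rewrite /h eq_sym; case: eqVneq => [->//|_]; rewrite !mulr0n; ring.
have [N [N0 NM NE]] := hermitian_resolvent u HH.
exists N; split => //.
  rewrite NM -M2.
  transitivity (\sum_i (v i ^+ 2 * x i ^+ 2 - 2 * b * (v i ^+ 2 * x i)
    + b ^+ 2 * v i ^+ 2)).
    apply: eq_bigr => i _; rewrite mxE normc_real -normrX ger0_norm ?sqr_ge0//.
    by ring.
  rewrite !big_split/= sumrN -!mulr_sumr Mb M1; ring.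
move=> z z0; rewrite !MG; set g := \sum_i _ => g0.
pose y : 'cV[R[i]]_n :=
  \col_i ((v i)%:C / (z - (x i)%:C) / g - (v i)%:C).
have zx i := upper_subr_neq0 (x i) z0.
have S1 : \sum_i (v i)%:C * y i 0 = 0.
  transitivity (\sum_i ((v i)%:C ^+ 2 / (z - (x i)%:C) / g - (v i)%:C ^+ 2)).
    by apply: eq_bigr => i _; rewrite mxE; ring.
  rewrite big_split/= sumrN -mulr_suml -/g mulfV//.
  apply/eqP; rewrite subr_eq0; apply/eqP.
  have := congr1 (real_complex R) M1; rewrite rmorph_sum rmorph1 => <-.
  by apply: eq_bigr => i _; rewrite -rmorphXn.
have Sx : \sum_i (x i)%:C * ((v i)%:C * y i 0) = z - g^-1 - b%:C.
  transitivity (\sum_i (z / g * ((v i)%:C ^+ 2 / (z - (x i)%:C))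
     - g^-1 * (v i ^+ 2)%:C - (v i ^+ 2 * x i)%:C)).
    apply: eq_bigr => i _; rewrite mxE (rmorphM _ (v i ^+ 2)) !(rmorphXn (real_complex R)) /=.
    by rewrite /=; field; rewrite zx g0.
  rewrite !big_split/= !sumrN -!mulr_sumr -!rmorph_sum M1 Mb -/g.
  by rewrite rmorph1 mulr1 mulfVK.
have uy : z *: y - H *m y = u.
  apply/matrixP => i j; rewrite (ord1 j) {j} !mxE.
  have -> : \sum_j H i j * y j 0 = (x i)%:C * y i 0 +
      (v i)%:C * ((b - x i)%:C * (\sum_j (v j)%:C * y j 0) -
        \sum_j (x j)%:C * ((v j)%:C * y j 0)).
    rewrite mulrBr !mulr_sumr -sumrB.
    rewrite [RHS]addrC.
    have -> : (x i)%:C * y i 0 = \sum_j (if j == i then (x i)%:C * y i 0 else 0).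
      by rewrite -big_mkcond/= big_pred1_eq.
    rewrite -big_split/=; apply: eq_bigr => j _.
    rewrite mxE /h eq_sym; case: eqVneq => [->|_];
      rewrite ?mulr1n ?mulr0n ?rmorphD ?rmorphM ?rmorphB/=; ring.
  rewrite S1 Sx mulr0 sub0r mxE.
  by rewrite rmorphM rmorphB /=; field; rewrite zx g0.
rewrite -(NE _ _ z0 uy).
transitivity (b%:C + (\sum_i (x i)%:C * ((v i)%:C * y i 0) -
  b%:C * \sum_i (v i)%:C * y i 0)).
  by rewrite S1 Sx; ring.
congr (_ + _); rewrite mulr_sumr -sumrB; apply: eq_bigr => i _.
rewrite mxE.
rewrite (_ : Num.conj _ = ((x i - b) * v i)%:C); last first.
  by rewrite mxE; apply: conjc_real.
by rewrite rmorphM rmorphB/=; ring.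
Qed.

End atomic.

(** * Helly compactness for discrete measures *)

Section right_limit.
Context {R : realType} (F : R -> R).
Hypotheses (F_nd : {homo F : x y / x <= y}) (F_ge0 : forall x, 0 <= F x).
Hypotheses (F_le1 : forall x, F x <= 1).
Hypothesis F_tight : forall e, 0 < e ->
  exists y, F (- y) <= e /\ 1 - e <= F y.

(** The right-continuous modification of F, which is the distribution function
    of the limit measure. *)
Definition right_limit x := inf [set F y | y in [set y | x < y]].

Let lbF x : has_inf [set F y | y in [set y | x < y]].
Proof.
split; first by exists (F (x + 1)), (x + 1) => //=; rewrite ltrDl.
by exists 0 => _ [y _ <-].
Qed.

Lemma right_limit_le x y : x < y -> right_limit x <= F y.
Proof.
by move=> xy; apply: ge_inf; [exact: (lbF x).2|exists y].
Qed.

Lemma le_right_limit x : F x <= right_limit x.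
Proof.
apply: lb_le_inf; first exact: (lbF x).1.
by move=> _ [y /= xy <-]; exact/F_nd/ltW.
Qed.

Lemma right_limit_nd : {homo right_limit : x y / x <= y}.
Proof.
move=> x y; rewrite le_eqVlt => /predU1P[->//|xy].
exact: le_trans (right_limit_le xy) (le_right_limit y).
Qed.

Lemma right_limit_rc : right_continuous right_limit.
Proof.
move=> x; apply/cvgrPdist_le => e e0.
have [_ [y /= xy <-] Fy] := inf_adherent e0 (lbF x).
near=> z.
have xz : x < z by near: z; exact: nbhs_right_gt.
have zy : z < y by near: z; exact: nbhs_right_lt.
have := right_limit_nd (ltW xz); have := right_limit_le zy.
by move: Fy; rewrite -/(right_limit x) ler_norml => *; lra.
Unshelve. all: by end_near. Qed.

Lemma right_limit_ge0 x : 0 <= right_limit x.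
Proof. exact: le_trans (F_ge0 x) (le_right_limit x). Qed.

Lemma right_limit_le1 x : right_limit x <= 1.
Proof.
by apply: (le_trans (right_limit_le (_ : x < x + 1))); rewrite ?ltrDl.
Qed.

Lemma right_limit_cvgNy : right_limit x @[x --> -oo] --> (0 : R).
Proof.
apply/cvgrPdist_le => e e0; have [y [Fy _]] := F_tight e0.
near=> x; have xy : x < - y by near: x; apply: nbhs_ninfty_lt; exact: num_real.
rewrite sub0r normrN ger0_norm ?right_limit_ge0//.
exact: le_trans (right_limit_le xy) Fy.
Unshelve. all: by end_near. Qed.

Lemma right_limit_cvgy : right_limit x @[x --> +oo] --> (1 : R).
Proof.
apply/cvgrPdist_le => e e0; have [y [_ Fy]] := F_tight e0.
near=> x; have xy : y <= x by near: x; apply: nbhs_pinfty_ge; exact: num_real.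
rewrite ger0_norm ?subr_ge0 ?right_limit_le1//.
have := le_right_limit x; have := F_nd xy; lra.
Unshelve. all: by end_near. Qed.

HB.instance Definition _ := isCumulative.Build R _ R right_limit
  right_limit_nd right_limit_rc.
HB.instance Definition _ := isCumulativeBounded.Build R 0 1 right_limit
  right_limit_cvgNy right_limit_cvgy.

Lemma right_limit_measure : exists rho : borel_probability R,
  forall x, rho `]-oo, x]%classic = (right_limit x)%:E.
Proof.
exists (lebesgue_stieltjes_measure right_limit) => x.
rewrite -(cdf_lebesgue_stieltjes_id right_limit x).
by rewrite /cdf/= /pushforward/= preimage_id.
Qed.

End right_limit.

Section ultra.
Context {R : realType} (U : set_system nat) {FU : UltraFilter U}.

(** A cluster point in the compact interval is a limit along an ultrafilter. *)
Lemma ultra_cvg_bounded (u : nat -> R) (a b : R) :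
  (forall n, a <= u n <= b) -> exists l : R, u n @[n --> U] --> l.
Proof.
move=> uab.
have uI : (u @ U) [set` `[a, b]].
  by apply: (@filterS _ U _ setT) (@filterT _ U _) => n _ /=; rewrite in_itv/= uab.
have [l [_ ul]] := @segment_compact R a b (u @ U) _ uI.
exists l => A Al.
have [//|UA] := in_ultra_setVsetC (u @^-1` A) FU.
by have [x [/= Ax Ax']] := ul (~` A) A UA Al.
Qed.

End ultra.

Section staircase.
Context {R : realType} (h : R -> R) (a : nat -> R).
Hypothesis a_nd : {homo a : i j / (i <= j)%N >-> i <= j}.

(** An approximation of h by indicators of half-lines. The coefficients are the
    increments of h, so they are uniformly small on a fine grid; this is what
    makes the jumps of a limiting distribution function harmless. *)
Definition staircase (N : nat) (x : R) : R :=
  \sum_(i < N) (h (a i) - h (a i.+1)) * (x <= a i)%R%:R.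

(** On ]a_j, a_j+1] the sum telescopes. *)
Lemma staircase_cases (N : nat) (x : R) :
  [\/ x <= a 0%N /\ staircase N x = h (a 0%N) - h (a N),
      exists2 j, [&& (j < N)%N, a j < x & x <= a j.+1] & staircase N x = h (a j.+1) - h (a N) |
      a N < x /\ staircase N x = 0].
Proof.
rewrite /staircase; elim: N => [|N ih].
  have [xa|xa] := leP x (a 0%N); last by apply: Or33; rewrite big_ord0.
  by apply: Or31; rewrite big_ord0 subrr.
rewrite big_ord_recr/=; case: ih => [[xa ->]|[j /and3P[jN jx xj] ->]|[Nx ->]].
- by apply: Or31; split=> //; rewrite (le_trans xa) ?a_nd// mulr1; ring.
- apply: Or32; exists j; first by rewrite jx xj (ltn_trans jN).
  by rewrite (le_trans xj (a_nd jN)) mulr1; ring.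
- rewrite (leNgt x (a N)) Nx/= mulr0 addr0.
  have [xN|xN] := leP x (a N.+1); last exact: Or33.
  by apply: Or32; exists N; rewrite ?Nx ?ltnSn// subrr.
Qed.

Lemma staircase_approx (N : nat) (e : R) :
  (forall x y, a 0%N <= x -> y <= a N -> x <= y -> (exists2 j, a j <= x & y <= a j.+1) ->
     `|h x - h y| <= e) ->
  (forall x, x <= a 0%N \/ a N <= x -> `|h x| <= e) ->
  forall x, `|h x - staircase N x| <= 3 * e.
Proof.
move=> osc van x; have hN : `|h (a N)| <= e by apply: van; right.
case: (staircase_cases N x) => [[xa ->]|[j /and3P[jN jx xj] ->]|[Nx ->]].
- have h0 : `|h (a 0%N)| <= e by apply: van; left.
  have hx : `|h x| <= e by apply: van; left.
  by move: h0 hx hN; rewrite !ler_norml => *; lra.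
- have hx : `|h x - h (a j.+1)| <= e.
    apply: osc => //.
    + exact: le_trans (a_nd (leq0n j)) (ltW jx).
    + exact: a_nd.
    + by exists j => //; exact: ltW.
  have e0 : 0 <= e := le_trans (normr_ge0 _) hN.
  by move: hx hN; rewrite !ler_norml => *; lra.
- have hx : `|h x| <= e by apply: van; right; exact: ltW.
  have e0 : 0 <= e := le_trans (normr_ge0 _) hN.
  by move: hx hN; rewrite !ler_norml => *; lra.
Qed.

End staircase.

Section helly.
Context {R : realType}.
Implicit Types (L : seq (R * R)) (h : R -> R).

Definition atoms_sum L h : R := \sum_(p <- L) p.1 * h p.2.

Lemma atoms_sum_le L h g : atoms_ge0 L -> (forall x, h x <= g x) ->
  atoms_sum L h <= atoms_sum L g.
Proof.
move=> L0 hg; rewrite /atoms_sum !big_seq; apply: ler_sum => p pL.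
by rewrite ler_wpM2l ?L0.
Qed.

Lemma atoms_sum_dist L h g e : atoms_ge0 L -> atoms_mass L = 1 ->
  (forall x, `|h x - g x| <= e) -> `|atoms_sum L h - atoms_sum L g| <= e.
Proof.
move=> L0 L1 hg; rewrite /atoms_sum -sumrB; apply: (le_trans (ler_norm_sum _ _ _)).
rewrite -[leRHS]mul1r -L1 /atoms_mass mulr_suml !big_seq; apply: ler_sum => p pL.
by rewrite -mulrBr normrM ger0_norm ?L0// ler_wpM2l ?L0.
Qed.

Definition atoms_cdf L x : R := atoms_sum L (fun y => (y <= x)%R%:R).

Lemma atoms_cdf_nd L : atoms_ge0 L -> {homo atoms_cdf L : x y / x <= y}.
Proof.
move=> L0 x y xy; apply: atoms_sum_le => // t; rewrite ler_nat.
by have [tx|//] := leP t x; rewrite (le_trans tx xy).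
Qed.

Lemma atoms_cdf_ge0 L x : atoms_ge0 L -> 0 <= atoms_cdf L x.
Proof.
move=> L0; rewrite /atoms_cdf /atoms_sum big_seq; apply: sumr_ge0 => p pL.
by rewrite mulr_ge0 ?L0.
Qed.

Lemma atoms_cdf_le1 L x : atoms_ge0 L -> atoms_mass L = 1 -> atoms_cdf L x <= 1.
Proof.
move=> L0 <-; rewrite /atoms_cdf /atoms_mass /atoms_sum !big_seq.
by apply: ler_sum => p pL; rewrite ler_piMr ?L0// lern1 leq_b1.
Qed.

Lemma atoms_sum_staircase L h a N :
  atoms_sum L (staircase h a N) =
  \sum_(i < N) (h (a i) - h (a i.+1)) * atoms_cdf L (a i).
Proof.
rewrite /atoms_sum /staircase; under eq_bigr do rewrite mulr_sumr.
rewrite exchange_big/=; apply: eq_bigr => i _; rewrite mulr_sumr.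
by apply: eq_bigr => p _; ring.
Qed.

Lemma Rintegral_sum d (T : measurableType d) (mu : {measure set T -> \bar R})
    (J : Type) (s : seq J) (f : J -> T -> R) :
  (forall i, mu.-integrable setT (EFin \o f i)) ->
  mu.-integrable setT (EFin \o (fun x => \sum_(i <- s) f i x)) /\
  \int[mu]_x (\sum_(i <- s) f i x) = \sum_(i <- s) \int[mu]_x f i x.
Proof.
move=> fi; elim: s => [|j s [i1 e1]].
  split.
    apply: (eq_integrable _ (EFin \o cst 0)) => //.
      by move=> x _ /=; rewrite big_nil.
    exact: integrable0.
  rewrite big_nil (_ : (fun x => _) = cst 0) ?Rintegral_cst ?mul0r//.
  by apply/funext => x; rewrite big_nil.
split.
  apply: eq_integrable (integrableD measurableT (fi j) i1) => // x _ /=.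
  by rewrite big_cons.
under eq_Rintegral do rewrite big_cons.
by rewrite RintegralD// e1 big_cons.
Qed.

Lemma Rintegral_ray (rho : borel_probability R) x :
  rho.-integrable setT (EFin \o (fun y : R => (y <= x)%R%:R)) /\
  \int[rho]_y ((y <= x)%R%:R) = fine (rho `]-oo, x]%classic).
Proof.
have E : (fun y : R => (y <= x)%R%:R : R) = \1_(`]-oo, x]%classic : set (measurableTypeR R)).
  by apply/funext => y; rewrite indicE mem_setE in_itv.
rewrite E; split; last first.
  by rewrite /Rintegral integral_indic// setIT.
apply: measurable_bounded_integrable => //.
  exact: (le_lt_trans (probability_le1 _ _) (ltry _)).
exists 1; split; first exact: num_real.
by move=> y y1 t _ /=; rewrite indicE ger0_norm// (le_trans _ (ltW y1))// lern1 leq_b1.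
Qed.

End helly.

Section helly_theorem.
Context {R : realType}.
Implicit Types (L : nat -> seq (R * R)) (h : R -> R).

(** The distribution functions converge pointwise along an ultrafilter to some
    F, and rho is the measure of the right-continuous modification of F.
    A test function h is replaced by a staircase on a fine grid. At the grid
    points a_i the modification exceeds F by at most F(a_i+1) - F(a_i); these
    jumps have total mass at most 1 and are multiplied by small increments
    of h, so that replacing F by its modification changes little. *)
Lemma helly_atoms L :
  (forall n, atoms_ge0 (L n)) -> (forall n, atoms_mass (L n) = 1) ->
  (forall e, 0 < e -> exists y, \forall n \near \oo,
     atoms_cdf (L n) (- y) <= e /\ 1 - e <= atoms_cdf (L n) y) ->
  exists (rho : borel_probability R) (U : set_system nat),
    [/\ UltraFilter U, \oo `<=` U &
    forall h (K B : R), (forall x y, `|h x - h y| <= K * `|x - y|) ->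
      (forall x, `|h x| <= B) ->
      (forall e, 0 < e -> exists2 M, 0 < M & forall x, M <= `|x| -> `|h x| <= e) ->
      atoms_sum (L n) h @[n --> U] --> \int[rho]_x h x].
Proof.
move=> L0 L1 tight.
have [U [UU oU]] := @ultraFilterLemma nat \oo _.
have Fl x : exists l : R, atoms_cdf (L n) x @[n --> U] --> l.
  apply: (@ultra_cvg_bounded _ _ _ _ 0 1) => n.
  by rewrite atoms_cdf_ge0//= atoms_cdf_le1.
have [F FE] := choice Fl.
have F_le x (b : R) : (\forall n \near U, atoms_cdf (L n) x <= b) -> F x <= b.
  by move=> H; exact: cvgr_to_le (FE x) H.
have F_ge x (b : R) : (\forall n \near U, b <= atoms_cdf (L n) x) -> b <= F x.
  by move=> H; exact: cvgr_to_ge (FE x) H.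
have F_nd : {homo F : x y / x <= y}.
  move=> x y xy; rewrite -subr_ge0.
  apply: (cvgr_to_ge (cvgB (FE y) (FE x))).
  by near=> n; rewrite subr_ge0; exact: atoms_cdf_nd.
have F_ge0 x : 0 <= F x by apply: F_ge; near=> n; exact: atoms_cdf_ge0.
have F_le1 x : F x <= 1 by apply: F_le; near=> n; exact: atoms_cdf_le1.
have F_tight e : 0 < e -> exists y, F (- y) <= e /\ 1 - e <= F y.
  move=> /tight[y /oU Uy]; exists y; split.
    by apply: F_le; apply: filterS Uy => n [].
  by apply: F_ge; apply: filterS Uy => n [].
have [rho rhoE] := right_limit_measure F_nd F_ge0 F_le1 F_tight.
exists rho, U; split => // h K B hK hB hvan.
have ih : rho.-integrable setT (EFin \o h).
  apply: measurable_bounded_integrable => //.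
  - exact: (le_lt_trans (probability_le1 _ _) (ltry _)).
  - apply: continuous_measurable_fun => x; apply/cvgrPdist_le => e e0.
    have K1 : 0 < `|K| + 1 by rewrite ltr_wpDl.
    near=> y; apply: (le_trans (hK _ _)).
    apply: (@le_trans _ _ ((`|K| + 1) * `|x - y|)).
      by rewrite ler_wpM2r// (le_trans (ler_norm K))// lerDl.
    rewrite mulrC -ler_pdivlMr//; near: y.
    have /cvgrPdist_le : id y @[y --> x] --> x by exact: cvg_id.
    by apply; rewrite divr_gt0.
  - exists B; split; first exact: num_real.
    by move=> y By t _ /=; exact: le_trans (hB t) (ltW By).
apply/cvgrPdist_le => e' e'0.
(* The four estimates below contribute 3 e, 3 e, e and e. *)
pose e : R := e' / 8; have e0 : 0 < e by rewrite divr_gt0.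
have [M M0 hM] := hvan e e0.
have K1 : 0 < `|K| + 1 by rewrite ltr_wpDl.
pose d : R := e / (`|K| + 1); have d0 : 0 < d by rewrite divr_gt0.
pose a (i : nat) : R := - M + i%:R * d.
have a_nd : {homo a : i j / (i <= j)%N >-> i <= j}.
  by move=> i j ij; rewrite lerD2l ler_wpM2r ?(ltW d0)// ler_nat.
pose N := (Num.Def.truncn (2 * M / d)).+1.
have aN : M <= a N.
  have : 2 * M / d < N%:R by rewrite /N; apply: truncnS_gt.
  rewrite ltr_pdivrMr// /a; lra.
have hd x y : `|x - y| <= d -> `|h x - h y| <= e.
  move=> xy; apply: (le_trans (hK _ _)).
  apply: (@le_trans _ _ ((`|K| + 1) * `|x - y|)).
    by rewrite ler_wpM2r// (le_trans (ler_norm K))// lerDl.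
  by rewrite mulrC -ler_pdivlMr.
have aS i : a i.+1 = a i + d by rewrite /a -natr1; ring.
have Sh x : `|h x - staircase h a N x| <= 3 * e.
  apply: staircase_approx => //.
    move=> x' y _ _ xy [j jx yj]; apply: hd; move: yj; rewrite aS.
    by rewrite ler_norml => yj; apply/andP; split; lra.
  move=> x' [xa|xa]; apply: hM.
    by rewrite ler_normr; apply/orP; right; move: xa; rewrite /a mul0r; lra.
  by rewrite ler_normr; apply/orP; left; apply: le_trans xa.
pose c (i : nat) := h (a i) - h (a i.+1).
have ce i : `|c i| <= e.
  by apply: hd; rewrite aS opprD addrA subrr sub0r normrN ger0_norm// ltW.
have [iS IS] : rho.-integrable setT (EFin \o staircase h a N) /\
    \int[rho]_x staircase h a N x = \sum_(i < N) c i * right_limit F (a i).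
  have H i : rho.-integrable setT (EFin \o (fun x : R => c i * (x <= a i)%R%:R)).
    exact: (integrableZl measurableT (c i) (Rintegral_ray rho (a i)).1).
  have [I1 I2] := @Rintegral_sum R _ _ rho 'I_N (index_enum _) (fun i x => c i * (x <= a i)%R%:R)
    (fun i => H i).
  split=> //; rewrite I2; apply: eq_bigr => i _.
  rewrite (RintegralZl _ _ (Rintegral_ray rho (a i)).1)//.
  by rewrite (Rintegral_ray rho (a i)).2 rhoE.
have IhS : `|\int[rho]_x h x - \int[rho]_x staircase h a N x| <= 3 * e.
  rewrite -RintegralB//; apply: (le_trans (le_normr_Rintegral measurableT _)).
    exact: (integrableB measurableT ih iS).
  apply: (@le_trans _ _ (\int[rho]_x (cst (3 * e) x))).
    apply: le_Rintegral => //.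
    - by have := integrable_norm (integrableB measurableT ih iS); apply: eq_integrable.
    - exact: finite_measure_integrable_cst.
  by rewrite Rintegral_cst_probability.
have SF : `|\sum_(i < N) c i * right_limit F (a i) - \sum_(i < N) c i * F (a i)| <= e.
  rewrite -sumrB; apply: (le_trans (ler_norm_sum _ _ _)).
  apply: (@le_trans _ _ (\sum_(i < N) e * (F (a i.+1) - F (a i)))).
    apply: ler_sum => i _; rewrite -mulrBr normrM.
    rewrite [X in _ * X]ger0_norm; last by rewrite subr_ge0 le_right_limit.
    apply: ler_pM => //; first by rewrite subr_ge0 le_right_limit.
    by rewrite lerD2r right_limit_le// aS ltrDl.
  rewrite -mulr_sumr -[leRHS]mulr1 ler_wpM2l ?(ltW e0)//.
  rewrite -(big_mkord xpredT (fun i => F (a i.+1) - F (a i))).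
  rewrite (telescope_sumr (fun i => F (a i)))//=.
  have := F_ge0 (a 0%N); have := F_le1 (a N); lra.
have cvgS : \sum_(i < N) c i * atoms_cdf (L n) (a i) @[n --> U] -->
    \sum_(i < N) c i * F (a i).
  elim: N {aN Sh iS IS IhS SF} => [|N ih'].
    by under eq_fun do rewrite big_ord0; rewrite big_ord0; exact: cvg_cst.
  under eq_fun do rewrite big_ord_recr/=; rewrite big_ord_recr/=.
  by apply: cvgD => //; apply: cvgMr; exact: FE.
near=> n.
have A1 : `|atoms_sum (L n) h - atoms_sum (L n) (staircase h a N)| <= 3 * e.
  exact: atoms_sum_dist.
have A2 : `|\sum_(i < N) c i * F (a i) -
    \sum_(i < N) c i * atoms_cdf (L n) (a i)| <= e.
  by near: n; move/cvgrPdist_le : cvgS; apply.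
move: A1 A2 IhS SF; rewrite atoms_sum_staircase IS -/c !ler_norml /e.
by move=> /andP[? ?] /andP[? ?] /andP[? ?] /andP[? ?]; apply/andP; split; lra.
Unshelve. all: by end_near. Qed.

End helly_theorem.

(** * Limits of Cauchy transforms *)

Section cauchy_continuity.
Context {R : realType}.
Implicit Types (z : R[i]) (g : R[i] -> R[i]).

Lemma kernel_lipschitz z (s t : R) : 0 < Im z ->
  normc ((z - s%:C)^-1 - (z - t%:C)^-1) <= (Im z)^-1 ^+ 2 * `|s - t|.
Proof.
move=> z0.
have -> : (z - s%:C)^-1 - (z - t%:C)^-1 =
    (z - s%:C)^-1 * (z - t%:C)^-1 * (s - t)%:C.
  by rewrite rmorphB /=; field; rewrite !upper_subr_neq0.
rewrite !normcM normc_real ler_wpM2r// expr2.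
by rewrite ler_pM ?normc_ge0// normc_kernel.
Qed.

Lemma kernel_vanish z (e : R) : 0 < e ->
  exists2 M, 0 < M & forall s : R, M <= `|s| -> normc (z - s%:C)^-1 <= e.
Proof.
move=> e0; exists (normc z + e^-1); first by rewrite ltr_wpDl ?normc_ge0 ?invr_gt0.
move=> s Ms.
have : e^-1 <= normc (z - s%:C).
  have := ler_normcB z (z - s%:C); rewrite opprB addrC subrK normc_real; lra.
by move=> H; rewrite normcV -[leRHS]invrK lef_pV2 ?posrE ?invr_gt0// (lt_le_trans _ H) ?invr_gt0.
Qed.

Lemma Re_atoms_cauchy (L : seq (R * R)) z :
  Re (atoms_cauchy L z) = atoms_sum L (fun s => Re (z - s%:C)^-1).
Proof.
rewrite /atoms_cauchy /atoms_sum; elim: L => [|p L ih]; rewrite ?big_nil//.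
by rewrite !big_cons ReD ih ReM mul0r subr0.
Qed.

Lemma Im_atoms_cauchy (L : seq (R * R)) z :
  Im (atoms_cauchy L z) = atoms_sum L (fun s => Im (z - s%:C)^-1).
Proof.
rewrite /atoms_cauchy /atoms_sum; elim: L => [|p L ih]; rewrite ?big_nil//.
by rewrite !big_cons ImD ih ImM mul0r addr0.
Qed.

(** The real part of 1 - iy G(iy) is the integral of s^2 / (s^2 + y^2), and the
    integrand is at least 1/2 when |s| >= y. *)
Lemma atoms_tail (L : seq (R * R)) (y : R) : atoms_ge0 L -> atoms_mass L = 1 ->
  0 < y ->
  let r := Re (1 - (0 +i* y) * atoms_cauchy L (0 +i* y)) in
  atoms_cdf L (- y) <= 2 * r /\ 1 - 2 * r <= atoms_cdf L y.
Proof.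
move=> L0 L1 y0 r.
have rE : 2 * r = atoms_sum L (fun s => 2 * (s ^+ 2 / (s ^+ 2 + y ^+ 2))).
  rewrite /r ReB ReM /= mul0r sub0r opprK Im_atoms_cauchy.
  rewrite -[X in X + _]L1 /atoms_mass /atoms_sum [y * _]mulr_sumr -big_split mulr_sumr.
  apply: eq_bigr => p _ /=; rewrite !oppr0 !addr0 add0r sqrrN.
  by field; rewrite gt_eqF// sqrD_gt0.
have key s : y <= `|s| -> 1 <= 2 * (s ^+ 2 / (s ^+ 2 + y ^+ 2)).
  move=> ys; rewrite mulrA ler_pdivlMr ?sqrD_gt0// mul1r.
  have : y ^+ 2 <= s ^+ 2 by rewrite -(real_normK (num_real s)) ler_pXn2r ?nnegrE// ltW.
  lra.
have pos s : 0 <= 2 * (s ^+ 2 / (s ^+ 2 + y ^+ 2)).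
  by rewrite mulr_ge0// divr_ge0// ?sqr_ge0// ltW// sqrD_gt0.
rewrite rE; split.
  apply: atoms_sum_le => // s; have [sy|_] := leP s (- y); last exact: pos.
  by apply: key; rewrite ler_normr; apply/orP; right; lra.
rewrite lerBlDr -lerBlDl.
have -> : 1 - atoms_cdf L y = atoms_sum L (fun s => 1 - (s <= y)%R%:R).
  rewrite -[X in X - _]L1 /atoms_mass /atoms_cdf /atoms_sum -sumrB.
  by apply: eq_bigr => p _; ring.
apply: atoms_sum_le => // s; have [sy|sy] := leP s y; rewrite ?subrr ?subr0//.
by apply: key; rewrite ler_normr; apply/orP; left; exact: ltW.
Qed.

(** The hypothesis on iy g(iy) gives tightness by [atoms_tail]; then real and
    imaginary part of the kernel are admissible test functions for
    [helly_atoms]. *)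
Lemma cauchy_transform_limit (L : nat -> seq (R * R)) g :
  (forall n, atoms_ge0 (L n)) -> (forall n, atoms_mass (L n) = 1) ->
  (forall z, 0 < Im z -> ccvg \oo (fun n => atoms_cauchy (L n) z) (g z)) ->
  (forall e, 0 < e -> exists2 y, 0 < y & normc (1 - (0 +i* y) * g (0 +i* y)) <= e) ->
  exists rho : borel_probability R,
    forall z, 0 < Im z -> cauchy_transform rho z = g z.
Proof.
move=> L0 L1 Lg gy.
have [|rho [U [UU oU rhoE]]] := helly_atoms L0 L1.
  move=> e e0; have e4 : 0 < e / 4 by rewrite divr_gt0.
  have [y y0 Hy] := gy _ e4; exists y.
  have iy0 : 0 < Im (0 +i* y) by [].
  have Lc : ccvg \oo (fun n => 1 - (0 +i* y) * atoms_cauchy (L n) (0 +i* y))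
      (1 - (0 +i* y) * g (0 +i* y)).
    by apply: ccvgB; [exact: ccvg_cst|apply: ccvgM; [exact: ccvg_cst|exact: Lg]].
  near=> n.
  have : normc (1 - (0 +i* y) * atoms_cauchy (L n) (0 +i* y) -
      (1 - (0 +i* y) * g (0 +i* y))) <= e / 4.
    by near: n; move/ccvg_normP : Lc; apply.
  move=> Hn; have [] := atoms_tail (L0 n) (L1 n) y0.
  set w := 1 - _ * atoms_cauchy _ _ in Hn *.
  set v := 1 - _ * g _ in Hn Hy.
  have : Re w <= e / 2.
    have -> : w = (w - v) + v by ring.
    rewrite ReD; have := normc_Re (w - v); have := normc_Re v.
    by rewrite !ler_norml => *; lra.
  by move=> *; split; lra.
exists rho => z z0.
have HRe : atoms_sum (L n) (fun s => Re (z - s%:C)^-1) @[n --> U] -->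
    \int[rho]_s Re (z - s%:C)^-1.
  apply: (rhoE _ ((Im z)^-1 ^+ 2) (Im z)^-1).
  - by move=> s t; rewrite -ReB; apply: le_trans (normc_Re _) (kernel_lipschitz _ _ z0).
  - by move=> s; apply: le_trans (normc_Re _) (normc_kernel _ z0).
  - move=> e /(kernel_vanish z)[M M0 HM]; exists M => // s sM.
    exact: le_trans (normc_Re _) (HM s sM).
have GRe : atoms_sum (L n) (fun s => Re (z - s%:C)^-1) @[n --> U] --> Re (g z).
  under eq_fun do rewrite -Re_atoms_cauchy.
  by apply: cvg_trans (Lg z z0).1; apply: cvg_app.
have HIm : atoms_sum (L n) (fun s => Im (z - s%:C)^-1) @[n --> U] -->
    \int[rho]_s Im (z - s%:C)^-1.
  apply: (rhoE _ ((Im z)^-1 ^+ 2) (Im z)^-1).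
  - by move=> s t; rewrite -ImB; apply: le_trans (normc_Im _) (kernel_lipschitz _ _ z0).
  - by move=> s; apply: le_trans (normc_Im _) (normc_kernel _ z0).
  - move=> e /(kernel_vanish z)[M M0 HM]; exists M => // s sM.
    exact: le_trans (normc_Im _) (HM s sM).
have GIm : atoms_sum (L n) (fun s => Im (z - s%:C)^-1) @[n --> U] --> Im (g z).
  under eq_fun do rewrite -Im_atoms_cauchy.
  by apply: cvg_trans (Lg z z0).2; apply: cvg_app.
apply: complexP; [exact: (cvg_unique _ HRe GRe)|exact: (cvg_unique _ HIm GIm)].
Unshelve. all: by end_near. Qed.

End cauchy_continuity.

(** * Discretization of a probability measure *)

Section discretization.
Import HBSimple HBNNSimple.
Context {R : realType}.
Implicit Types (mu : borel_probability R) (z : R[i]).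

(** The law of a function with finite range is a list of atoms. *)
Lemma finite_range_law mu (f : R -> R) :
  measurable_fun (setT : set (measurableTypeR R)) f -> finite_set (range f) ->
  exists L, [/\ atoms_ge0 L, atoms_mass L = 1 & forall h,
    mu.-integrable setT (EFin \o (fun x => h (f x))) /\
    \int[mu]_x h (f x) = atoms_sum L h].
Proof.
move=> mf ff; pose S := fset_set (range f).
pose A y : set (measurableTypeR R) := f @^-1` [set y].
have mA y : measurable (A y) by rewrite -[A y]setTI; exact: mf.
have fE (h : R -> R) x : h (f x) = \sum_(y <- S) h y * \1_(A y) x.
  have fxS : f x \in S by rewrite in_fset_set// inE; exists x.
  rewrite (bigD1_seq (f x)) ?fset_uniq//= indicE mem_set// mulr1 big1 ?addr0//.
  by move=> y /negP yx; rewrite indicE memNset ?mulr0// => /= xy; apply: yx; rewrite xy.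
have iA y : mu.-integrable setT (EFin \o \1_(A y)).
  apply: measurable_bounded_integrable => //.
  - exact: probability_lty.
  - exists 1; split; first exact: num_real.
    move=> c c1 x _ /=; rewrite indicE ger0_norm// (le_trans _ (ltW c1))//.
    by rewrite lern1 leq_b1.
pose L := [seq (fine (mu (A y)), y) | y <- S].
have LE h : mu.-integrable setT (EFin \o (fun x => h (f x))) /\
    \int[mu]_x h (f x) = atoms_sum L h.
  have ihA y : mu.-integrable setT (EFin \o (fun x => h y * \1_(A y) x)).
    exact: (integrableZl measurableT (h y) (iA y)).
  have [i1 e1] := @Rintegral_sum R _ _ mu _ S (fun y x => h y * \1_(A y) x) ihA.
  split; first by apply: eq_integrable i1 => // x _ /=; rewrite fE.
  under eq_Rintegral do rewrite fE.
  rewrite e1 /atoms_sum big_map; apply: eq_bigr => y _ /=.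
  rewrite RintegralZl// mulrC; congr (_ * _).
  by rewrite /Rintegral integral_indic// setIT.
exists L; split => //.
- by move=> a /mapP[y _ ->] /=; exact: fine_ge0.
- have [_] := LE (fun=> 1); rewrite Rintegral_cst_probability => ->.
  by apply: eq_bigr => p _; rewrite mulr1.
Qed.

(** The approximants are differences of the standard simple approximations of
    the positive and negative parts of x, whence the domination by |x|. *)
Lemma discretization mu : exists (L : nat -> seq (R * R)) (f_ : nat -> R -> R),
  [/\ forall n, atoms_ge0 (L n) /\ atoms_mass (L n) = 1,
      forall n, measurable_fun (setT : set (measurableTypeR R)) (f_ n),
      forall x, f_ n x @[n --> \oo] --> x,
      forall n x, `|f_ n x| <= `|x| &
      forall n h, mu.-integrable setT (EFin \o (fun x => h (f_ n x))) /\
        \int[mu]_x h (f_ n x) = atoms_sum (L n) h].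
Proof.
have mp : measurable_fun (setT : set (measurableTypeR R)) (fun x : R => (Num.max x 0)%:E).
  by apply/measurable_EFinP; apply: measurable_maxr.
have mm : measurable_fun (setT : set (measurableTypeR R)) (fun x : R => (Num.max (- x) 0)%:E).
  by apply/measurable_EFinP; apply: measurable_maxr => //; exact: measurableT_comp.
pose p := nnsfun_approx measurableT mp; pose m := nnsfun_approx measurableT mm.
have p0 (x : measurableTypeR R) : setT x -> (0 <= (Num.max (x : R) 0)%:E)%E.
  by move=> _; rewrite lee_fin le_max lexx orbT.
have m0 (x : measurableTypeR R) : setT x -> (0 <= (Num.max (- (x : R)) 0)%:E)%E.
  by move=> _; rewrite lee_fin le_max lexx orbT.
pose f_ n (x : R) : R := p n x - m n x.
have cp (x : R) : p n x @[n --> \oo] --> Num.max x 0.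
  exact: (fine_cvg (@cvg_nnsfun_approx _ _ _ _ measurableT _ mp p0 x Logic.I)).
have cm (x : R) : m n x @[n --> \oo] --> Num.max (- x) 0.
  exact: (fine_cvg (@cvg_nnsfun_approx _ _ _ _ measurableT _ mm m0 x Logic.I)).
have pE (x : R) : x = Num.max x 0 - Num.max (- x) 0.
  have [x0|x0] := leP 0 x; first by rewrite (@max_r _ _ (- x)) ?subr0//; lra.
  by rewrite (@max_l _ _ (- x)) ?opprK ?add0r//; lra.
have cf (x : R) : f_ n x @[n --> \oo] --> x.
  by rewrite [X in _ --> X]pE; exact: cvgB.
have pl n (x : R) : p n x <= Num.max x 0.
  by rewrite -lee_fin /p nnsfun_approxE; exact: le_approx.
have ml n (x : R) : m n x <= Num.max (- x) 0.
  by rewrite -lee_fin /m nnsfun_approxE; exact: le_approx.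
have fle n (x : R) : `|f_ n x| <= `|x|.
  have := pl n x; have := ml n x; rewrite /f_.
  have : 0 <= p n x by []. have : 0 <= m n x by [].
  rewrite ler_norml; have [x0|x0] := leP 0 x.
    rewrite (@max_r _ _ (- x)) ?(ger0_norm x0); last lra.
    by move=> *; apply/andP; split; lra.
  rewrite (@max_l _ _ (- x)) ?(ltr0_norm x0); last lra.
  by move=> *; apply/andP; split; lra.
have mf n : measurable_fun (setT : set (measurableTypeR R)) (f_ n).
  exact: measurable_funB.
have ff n : finite_set (range (f_ n)).
  by apply: (finite_image11 (fun x y : R => x - y) (fa := p n) (fb := m n)); exact: fimfunP.
have [L LE] := choice (fun n => finite_range_law mu (mf n) (ff n)).
exists L, f_; split => // n.
  by have [L0 L1 _] := LE n.
by have [_ _ +] := LE n; apply.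
Qed.

End discretization.

(** * Reciprocals of z - c G *)

Section cauchy_sign.
Context {R : realType}.
Implicit Types (mu : borel_probability R) (z : R[i]).

Lemma Im_kernel z (s : R) : Im (cauchy_kernel z s) =
  - (Im z / ((Re z - s) ^+ 2 + Im z ^+ 2)).
Proof. by rewrite /cauchy_kernel ImV ReB ImB /= subr0. Qed.

Lemma Im_kernel_lt0 z (s : R) : 0 < Im z -> Im (cauchy_kernel z s) < 0.
Proof. by move=> z0; rewrite Im_kernel oppr_lt0 divr_gt0// sqrD_gt0. Qed.

(** The imaginary part of the kernel is negative everywhere, so a vanishing
    integral would make the whole line negligible. *)
Lemma Im_cauchy_lt0 mu z : 0 < Im z -> Im (cauchy_transform mu z) < 0.
Proof.
move=> z0; have [_ ik] := cintegrable_kernel mu z0.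
have le0 : Im (cauchy_transform mu z) <= 0.
  rewrite /cauchy_transform/= -oppr_ge0.
  have -> : - (\int[mu]_s Im (z - s%:C)^-1) = \int[mu]_s (- Im (cauchy_kernel z s)).
    rewrite -mulN1r -RintegralZl//.
    by apply: eq_Rintegral => s _; rewrite mulN1r.
  by apply: Rintegral_ge0 => s _; rewrite oppr_ge0 ltW// Im_kernel_lt0.
rewrite lt_neqAle le0 andbT; apply/eqP => I0.
have fin := integrable_fin_num measurableT ik.
have A0 : (\int[mu]_(x in setT) `|(EFin \o (fun s : R => Im (cauchy_kernel z s))) x| = 0)%E.
  transitivity (- \int[mu]_x (Im (cauchy_kernel z x))%:E)%E.
    rewrite -integralN; last exact: integrable_add_def.
    by apply: eq_integral => s _; rewrite /= ltr0_norm ?Im_kernel_lt0// EFinN.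
  by rewrite -[X in (- X)%E]fineK// -[fine _]/(Im (cauchy_transform mu z)) I0 oppe0.
have [mk _] := integrableP _ _ _ ik.
have /ae_eq_integral_abs : measurable_fun setT
   (EFin \o (fun s : measurableTypeR R => Im (cauchy_kernel z s))) := mk.
move=> /(_ mu measurableT) [/(_ A0)[N [mN N0 sub]] _].
have : (mu setT <= mu N)%E.
  apply: le_measure; rewrite ?inE// => s _; apply: sub => /= H.
  have := Im_kernel_lt0 s z0; have := H Logic.I; case=> ->; rewrite ltxx//.
by rewrite N0 probability_setT lee_fin ler10.
Qed.

Lemma cauchy_neq0 mu z : 0 < Im z -> cauchy_transform mu z != 0.
Proof.
by move=> z0; apply: contraTneq (Im_cauchy_lt0 mu z0) => ->; rewrite ltxx.
Qed.

Lemma normc_cauchy mu z : 0 < Im z -> normc (cauchy_transform mu z) <= 2 * (Im z)^-1.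
Proof.
move=> z0; rewrite -[X in _ <= _ * X](Rintegral_cst_probability mu).
apply: normc_cint_le => //.
- exact: cintegrable_kernel.
- exact: finite_measure_integrable_cst.
- by move=> s _; exact: normc_kernel.
Qed.

Lemma Im_atoms_cauchy_le0 (L : seq (R * R)) z : atoms_ge0 L -> 0 < Im z ->
  Im (atoms_cauchy L z) <= 0.
Proof.
move=> L0 z0; rewrite Im_atoms_cauchy.
have -> : 0 = atoms_sum L (fun=> 0).
  by rewrite /atoms_sum big1// => p _; rewrite mulr0.
by apply: atoms_sum_le => // s; rewrite ltW// Im_kernel_lt0.
Qed.

(** Besides the Cauchy transform, integrals of dominated test functions converge;
    this provides the convergence of moments. *)
Lemma cauchy_discretization mu : exists L : nat -> seq (R * R),
  [/\ forall n, atoms_ge0 (L n), forall n, atoms_mass (L n) = 1,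
      forall z, 0 < Im z -> ccvg \oo (fun n => atoms_cauchy (L n) z) (cauchy_transform mu z) &
      forall (h : R -> R), continuous h ->
        forall (g : R -> R), mu.-integrable setT (EFin \o g) ->
        (forall x y, `|x| <= `|y| -> `|h x| <= g y) ->
        atoms_sum (L n) h @[n --> \oo] --> \int[mu]_x h x].
Proof.
have [L [f_ [L01 mf cf fle LE]]] := discretization mu.
have key (h : R -> R) (g : R -> R) : continuous h -> mu.-integrable setT (EFin \o g) ->
    (forall x y, `|x| <= `|y| -> `|h x| <= g y) ->
    atoms_sum (L n) h @[n --> \oo] --> \int[mu]_x h x.
  move=> ch ig hg.
  under eq_fun do rewrite -(LE _ h).2.
  have [| | |_ //] := @Rintegral_dominated_cvg _ _ _ mu (fun n x => h (f_ n x)) h g _ _ ig _.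
  - move=> n; apply: measurableT_comp (mf n).
    exact: continuous_measurable_fun.
  - by move=> x; apply: (cvg_comp _ _ (cf x)); exact: ch.
  - by move=> n x; exact: hg.
exists L; split.
- by move=> n; have [] := L01 n.
- by move=> n; have [] := L01 n.
- move=> z z0; have [cr ci] := continuous_kernel z0.
  have ic := finite_measure_integrable_cst mu (Im z)^-1 (measurableT : measurable setT).
  split.
    under eq_fun do rewrite Re_atoms_cauchy.
    apply: (key _ _ cr ic) => x y _.
    exact: le_trans (normc_Re _) (normc_kernel _ z0).
  under eq_fun do rewrite Im_atoms_cauchy.
  apply: (key _ _ ci ic) => x y _.
  exact: le_trans (normc_Im _) (normc_kernel _ z0).
- by move=> h ch g ig hg; exact: (key h g).
Qed.

(** Discretize rho, invert with [atoms_inverse], and take the limit. The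
    normalization at infinity holds because G is bounded by 2 / Im z. *)
Lemma F_transform_sub_cauchy (rho : borel_probability R) (c : R) : 0 <= c ->
  exists mu : borel_probability R, forall z, 0 < Im z ->
    F_transform mu z = z - c%:C * cauchy_transform rho z.
Proof.
move=> c0; have [L [L0 L1 Lc _]] := cauchy_discretization rho.
have [N NE] := choice (fun n => atoms_inverse c0 (L0 n)).
have Imle z w : Im w <= 0 -> Im z <= Im (z - c%:C * w).
  by move=> w0; rewrite ImB ImM /= mul0r addr0 lerDl oppr_ge0 mulr_ge0_le0.
pose g z : R[i] := (z - c%:C * cauchy_transform rho z)^-1.
have dn z : 0 < Im z -> z - c%:C * cauchy_transform rho z != 0.
  move=> z0; apply: upper_neq0; apply: (lt_le_trans z0); apply: Imle.
  exact: ltW (Im_cauchy_lt0 rho z0).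
have [| | | |mu muE] := @cauchy_transform_limit _ N g.
- by move=> n; have [+ _ _] := NE n.
- by move=> n; have [_ -> _] := NE n.
- move=> z z0.
  have H : ccvg \oo (fun n => (z - c%:C * atoms_cauchy (L n) z)^-1) (g z).
    apply: ccvgV; first exact: dn.
    apply: ccvgB; first exact: ccvg_cst.
    by apply: ccvgM; [exact: ccvg_cst|exact: Lc].
  apply: ccvg_near_eq H; apply: nearW => n.
  have [_ _ -> //] := NE n.
  apply: upper_neq0; apply: (lt_le_trans z0); apply: Imle.
  exact: Im_atoms_cauchy_le0.
- move=> e e0; pose y := 1 + 2 * c / e.
  have ce : 0 <= 2 * c / e by rewrite divr_ge0 ?mulr_ge0// ltW.
  have y1 : 1 <= y by rewrite lerDl.
  have y0 : 0 < y by lra.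
  have z0 : 0 < Im (0 +i* y) by [].
  exists y => //; rewrite /g; have := dn _ z0; have := normc_cauchy rho z0.
  have := Imle (0 +i* y) _ (ltW (Im_cauchy_lt0 rho z0)).
  set G := cauchy_transform rho _; set D := _ - _ * G => DI Gle D0.
  have -> : 1 - (0 +i* y) / D = - (c%:C * G) / D.
    by apply: (mulIf D0); rewrite mulrBl !divfK// mul1r /D; ring.
  rewrite normcf_div normcN normcM normc_real (ger0_norm c0).
  have Dy : y <= normc D by apply: le_trans (normc_Im D); apply: le_trans (ler_norm _).
  rewrite ler_pdivrMr; last exact: lt_le_trans Dy.
  apply: (@le_trans _ _ (2 * c)).
    apply: (@le_trans _ _ (c * (2 * 1))); last by rewrite mulr1 mulrC.
    rewrite ler_wpM2l//; apply: (le_trans Gle); rewrite ler_wpM2l//.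
    by rewrite invf_le1.
  have : 2 * c <= e * y by rewrite /y mulrDr mulrCA divff ?gt_eqF// !mulr1; lra.
  by move=> /le_trans; apply; rewrite ler_wpM2l// ltW.
by exists mu => z z0; rewrite /F_transform muE// invrK.
Qed.

End cauchy_sign.

(** * Second moments and E on the imaginary axis *)

Section moments.
Context {R : realType}.
Implicit Types (mu : borel_probability R) (x y : R).

Definition imag y : R[i] := 0 +i* y.

Lemma imag_cone y b : 0 < y -> b <= y -> truncated_cone 1 b (imag y).
Proof. by move=> y0 by_; split => //=; rewrite normr0 mul1r ltW. Qed.

Lemma integrable_bounded_real mu (f : R -> R) (M : R) :
  measurable_fun (setT : set (measurableTypeR R)) f -> (forall x, `|f x| <= M) ->
  mu.-integrable setT (EFin \o f).
Proof.
move=> mf fM; apply: measurable_bounded_integrable => //.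
- exact: probability_lty.
- exists M; split; first exact: num_real.
  by move=> c Mc x _ /=; apply: le_trans (fM x) (ltW Mc).
Qed.

Lemma measurable_rational (p : R -> R) y : continuous p -> 0 < y ->
  measurable_fun (setT : set (measurableTypeR R)) (fun x => p x / (x ^+ 2 + y ^+ 2)).
Proof.
move=> cp y0; apply: continuous_measurable_fun => x; apply: cvgM; first exact: cp.
apply: cvgV; first by rewrite gt_eqF// sqrD_gt0.
by apply: cvgD; [exact: sqr_continuous|exact: cvg_cst].
Qed.

Lemma continuous_sqr_scale (c : R) : continuous (fun x : R => c * x ^+ 2).
Proof. by move=> x; apply: cvgM; [exact: cvg_cst|exact: sqr_continuous]. Qed.

(** Both integrands are components of x / (x - iy). *)
Lemma defect_integrals mu y : 0 < y ->
  let w := 1 - imag y * cauchy_transform mu (imag y) in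
  Re w = \int[mu]_x (x ^+ 2 / (x ^+ 2 + y ^+ 2)) /\
  Im w = \int[mu]_x (x * y / (x ^+ 2 + y ^+ 2)).
Proof.
move=> y0 w; have z0 : 0 < Im (imag y) by [].
have wE : w = - cint mu setT (kernel_defect (imag y)).
  rewrite /w cauchy_transformE -cintZ//; last exact: cintegrable_kernel.
  rewrite (eq_cint mu (g := fun s : measurableTypeR R => 1 + kernel_defect (imag y) s)).
    rewrite cintD//; last 2 first.
    - exact: cintegrable_cst.
    - exact: (cintegrable_defect _ ltr01 y0 (imag_cone y0 (lexx y))).
    by rewrite cint_cst; ring.
  by move=> s _; rewrite kernel_defectE.
have [ir ii] := cintegrable_defect mu ltr01 y0 (imag_cone y0 (lexx y)).
rewrite wE ReN ImN; split.
  rewrite -[LHS]mulN1r -(@RintegralZl _ _ _ mu setT _ (-1) measurableT ir).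
  apply: eq_Rintegral => x _; rewrite /kernel_defect ReM /cauchy_kernel ReV ReB ImB /=.
  by rewrite mul0r subr0 sub0r sqrrN subr0; ring.
rewrite -[LHS]mulN1r -(@RintegralZl _ _ _ mu setT _ (-1) measurableT ii).
apply: eq_Rintegral => x _; rewrite /kernel_defect ImM /cauchy_kernel ImV ReB ImB /=.
by rewrite mul0r subr0 sub0r sqrrN addr0; ring.
Qed.

Lemma integrable_of_square mu :
  mu.-integrable setT (EFin \o (fun x : R => x ^+ 2)) ->
  mu.-integrable setT (EFin \o (fun x : R => x)).
Proof.
move=> i2.
apply: (le_integrable measurableT _ _
  (integrableD measurableT (finite_measure_integrable_cst mu 1 measurableT) i2)).
  by apply/measurable_EFinP; exact: measurable_id.
move=> x _; rewrite lee_fin [leRHS]ger0_norm ?addr_ge0 ?sqr_ge0//.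
rewrite -(real_normK (num_real x)); have := sqr_ge0 (`|x| - 1).
by rewrite sqrrB -[cst 1 x]/(1 : R); have := normr_ge0 x; lra.
Qed.

Let y_ n : R := n.+1%:R.

Let y_gt0 n : 0 < y_ n. Proof. by rewrite ltr0n. Qed.

Lemma cauchy_imag_cvg mu : ccvg \oo (fun n => imag (y_ n) * cauchy_transform mu (imag (y_ n))) 1.
Proof.
apply/ccvg_normP => e e0.
have [b b0 H] := cauchy_transform_asymptotic mu ltr01 e0.
near=> n; apply: H; apply: imag_cone => //.
apply: (@le_trans _ _ n%:R); last by rewrite ler_nat.
by near: n; exact: nbhs_infty_ger.
Unshelve. all: by end_near. Qed.

Lemma small_ratio_cvg (x c : R) :
  x ^+ 2 * c / (x ^+ 2 + y_ n ^+ 2) * y_ n @[n --> \oo] --> (0 : R).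
Proof.
apply/cvgrPdist_le => e e0; near=> n.
rewrite sub0r normrN; set y := y_ n; have yn := y_gt0 n; rewrite -/y in yn.
have D := sqrD_gt0 x yn.
rewrite mulrAC normrM normfV (gtr0_norm D) ler_pdivrMr// normrM (gtr0_norm yn).
have Hy : `|x ^+ 2 * c| / e <= y.
  apply: (@le_trans _ _ n%:R); last by rewrite ler_nat.
  by near: n; exact: nbhs_infty_ger.
rewrite ler_pdivrMr// in Hy.
have H2 : `|x ^+ 2 * c| * y <= y * e * y by rewrite ler_wpM2r// ltW.
apply: (le_trans H2); rewrite (_ : y * e * y = e * y ^+ 2); last ring.
by rewrite ler_wpM2l ?lerDr ?sqr_ge0// ltW.
Unshelve. all: by end_near. Qed.

Lemma ratioE (x y : R) : 0 < y ->
  y ^+ 2 * (x ^+ 2 / (x ^+ 2 + y ^+ 2)) = x ^+ 2 - x ^+ 2 * x ^+ 2 / (x ^+ 2 + y ^+ 2).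
Proof. by move=> y0; have D := sqrD_gt0 x y0; field; rewrite gt_eqF. Qed.

Lemma ratio_cvg (x : R) :
  y_ n ^+ 2 * (x ^+ 2 / (x ^+ 2 + y_ n ^+ 2)) @[n --> \oo] --> x ^+ 2.
Proof.
under eq_fun do rewrite ratioE//.
suff H : x ^+ 2 * x ^+ 2 / (x ^+ 2 + y_ n ^+ 2) @[n --> \oo] --> (0 : R).
  have := cvgB (cvg_cst (x ^+ 2)) H; rewrite subr0; exact.
apply/cvgrPdist_le => e e0; near=> n.
rewrite sub0r normrN; have yn := y_gt0 n; have D := sqrD_gt0 x yn.
have : `|x ^+ 2 * x ^+ 2 / (x ^+ 2 + y_ n ^+ 2) * y_ n| <= e.
  by near: n; apply: cvgr0_norm_le => //; exact: small_ratio_cvg.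
apply: le_trans.
have n0 : 0 <= x ^+ 2 by exact: sqr_ge0.
have q0 : 0 <= x ^+ 2 * x ^+ 2 / (x ^+ 2 + y_ n ^+ 2).
  by apply: divr_ge0; [exact: mulr_ge0|exact: ltW].
rewrite (ger0_norm q0) (ger0_norm (mulr_ge0 q0 (ltW yn))).
by rewrite ler_peMr// ler1n.
Unshelve. all: by end_near. Qed.

Lemma odd_ratio_cvg (x : R) :
  y_ n * (x * y_ n / (x ^+ 2 + y_ n ^+ 2)) @[n --> \oo] --> x.
Proof.
have [->|x0] := eqVneq x 0.
  by under eq_fun do rewrite !mul0r mulr0; exact: cvg_cst.
have -> : (fun n => y_ n * (x * y_ n / (x ^+ 2 + y_ n ^+ 2))) =
    (fun n => x^-1 * (y_ n ^+ 2 * (x ^+ 2 / (x ^+ 2 + y_ n ^+ 2)))).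
  apply/funext => n; have D := sqrD_gt0 x (y_gt0 n).
  by move: (y_ n) D => y D; field; rewrite x0 gt_eqF.
have H : x^-1 * (y_ n ^+ 2 * (x ^+ 2 / (x ^+ 2 + y_ n ^+ 2))) @[n --> \oo] -->
    x^-1 * x ^+ 2.
  by apply: cvgMr; exact: ratio_cvg.
by rewrite expr2 mulKf// in H.
Qed.

Lemma ratio_le (x y : R) : 0 < y -> 0 <= y ^+ 2 * (x ^+ 2 / (x ^+ 2 + y ^+ 2)) <= x ^+ 2.
Proof.
move=> y0; have D := sqrD_gt0 x y0; apply/andP; split.
  by rewrite mulr_ge0 ?sqr_ge0// divr_ge0 ?sqr_ge0// ltW.
rewrite mulrA ler_pdivrMr// mulrC ler_wpM2l ?sqr_ge0// lerDr sqr_ge0//.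
Qed.

Lemma odd_ratio_le (x y : R) : 0 < y -> `|x ^+ 2 * x / (x ^+ 2 + y ^+ 2) * y| <= x ^+ 2.
Proof.
move=> y0; have D := sqrD_gt0 x y0.
rewrite mulrAC normrM normfV (gtr0_norm D) ler_pdivrMr// -(mulrA (x ^+ 2)).
rewrite (normrM (x ^+ 2)) (ger0_norm (sqr_ge0 x)) ler_wpM2l ?sqr_ge0//.
rewrite normrM (gtr0_norm y0).
rewrite -(real_normK (num_real x)).
have := sqr_ge0 (`|x| - y); have := mulr_ge0 (normr_ge0 x) (ltW y0).
by rewrite sqrrB; lra.
Qed.

(** With B = iy G(iy) -> 1 one has iy E(iy) = y^2 (1 - B) / B. By
    [defect_integrals] the real part of y^2 (1 - B) is the integral of
    y^2 x^2 / (x^2 + y^2). The integrand of its imaginary part is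
    y^3 x / (x^2 + y^2) = y x - y x^3 / (x^2 + y^2); the first term integrates
    to zero, and the second one is dominated by x^2 and tends to 0. *)
Lemma E_transform_imag_cvg mu (s : R) :
  mu.-integrable setT (EFin \o (fun x : R => x ^+ 2)) ->
  mu.-integrable setT (EFin \o (fun x : R => x)) ->
  \int[mu]_x x = 0 -> \int[mu]_x (x ^+ 2) = s ->
  ccvg \oo (fun n => imag (y_ n) * E_transform mu (imag (y_ n))) s%:C.
Proof.
move=> i2 i1 m1 m2.
have Bc := cauchy_imag_cvg mu.
pose B n := imag (y_ n) * cauchy_transform mu (imag (y_ n)).
have Dc : ccvg \oo (fun n => (y_ n ^+ 2)%:C * (1 - B n)) s%:C.
  split.
    have E n : Re ((y_ n ^+ 2)%:C * (1 - B n)) =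
        \int[mu]_x (y_ n ^+ 2 * (x ^+ 2 / (x ^+ 2 + y_ n ^+ 2))).
      have [rE _] := defect_integrals mu (y_gt0 n).
      rewrite ReZ rE RintegralZl//.
      apply: (@integrable_bounded_real _ _ 1).
        by apply: measurable_rational => //; exact: sqr_continuous.
      move=> x; have D := sqrD_gt0 x (y_gt0 n).
      by rewrite ger0_norm ?divr_ge0 ?sqr_ge0 ?(ltW D)// ler_pdivrMr// mul1r lerDl sqr_ge0.
    suff : \int[mu]_x (y_ n ^+ 2 * (x ^+ 2 / (x ^+ 2 + y_ n ^+ 2))) @[n --> \oo] --> s.
      by apply: cvg_trans; apply: near_eq_cvg; apply: nearW => n; rewrite E.
    rewrite -m2; have [| | |_ //] := @Rintegral_dominated_cvg _ _ _ mu
      (fun n x => y_ n ^+ 2 * (x ^+ 2 / (x ^+ 2 + y_ n ^+ 2))) (fun x => x ^+ 2)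
      (fun x => x ^+ 2) _ _ i2 _.
    - move=> n; under eq_fun do rewrite mulrA.
      by apply: measurable_rational => //; exact: continuous_sqr_scale.
    - exact: ratio_cvg.
    - by move=> n x; have /andP[h1 h2] := ratio_le x (y_gt0 n); rewrite ger0_norm.
  have E n : Im ((y_ n ^+ 2)%:C * (1 - B n)) =
      - \int[mu]_x (x ^+ 2 * x / (x ^+ 2 + y_ n ^+ 2) * y_ n).
    have [_ iE] := defect_integrals mu (y_gt0 n).
    have yn := y_gt0 n.
    rewrite ImZ iE.
    have mc : measurable_fun (setT : set (measurableTypeR R))
        (fun x : R => x * y_ n / (x ^+ 2 + y_ n ^+ 2)).
      apply: measurable_rational => // x.
      by apply: cvgM; [exact: cvg_id|exact: cvg_cst].
    have ixy : mu.-integrable setT (EFin \o (fun x : R => x * y_ n / (x ^+ 2 + y_ n ^+ 2))).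
      apply: (@integrable_bounded_real _ _ 1) => // x.
      have D := sqrD_gt0 x yn.
      rewrite normrM normfV (gtr0_norm D) ler_pdivrMr// mul1r normrM (gtr0_norm yn).
      rewrite -(real_normK (num_real x)).
      have := sqr_ge0 (`|x| - y_ n); have := mulr_ge0 (normr_ge0 x) (ltW yn).
      by rewrite sqrrB; lra.
    rewrite -RintegralZl// -[LHS]addr0 -[X in _ + X]oppr0 -(mulr0 (y_ n)) -[X in _ * X]m1.
    rewrite -RintegralZl// -RintegralB//; last 2 first.
    - exact: (integrableZl measurableT (y_ n ^+ 2) ixy).
    - exact: (integrableZl measurableT (y_ n) i1).
    rewrite -mulN1r -RintegralZl//.
      apply: eq_Rintegral => x _; have D := sqrD_gt0 x yn.
      by move: (y_ n) D => y D; field; rewrite gt_eqF.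
    apply: (le_integrable measurableT _ _ i2).
      apply/measurable_EFinP; apply: measurable_funM; last exact: measurable_cst.
      apply: measurable_rational => // x.
      by apply: cvgM; [exact: sqr_continuous|exact: cvg_id].
    move=> x _; rewrite lee_fin (ger0_norm (sqr_ge0 x)); exact: odd_ratio_le.
  suff H : \int[mu]_x (x ^+ 2 * x / (x ^+ 2 + y_ n ^+ 2) * y_ n) @[n --> \oo] --> (0 : R).
    suff : Im ((y_ n ^+ 2)%:C * (1 - B n)) @[n --> \oo] --> (0 : R) by [].
    by under eq_fun do rewrite E; rewrite -oppr0; exact: cvgN.
  have [| | |_] := @Rintegral_dominated_cvg _ _ _ mu
      (fun n x => x ^+ 2 * x / (x ^+ 2 + y_ n ^+ 2) * y_ n) (fun x => 0)
      (fun x => x ^+ 2) _ _ i2 _.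
  - move=> n; apply: measurable_funM; last exact: measurable_cst.
    apply: measurable_rational => // x.
    by apply: cvgM; [exact: sqr_continuous|exact: cvg_id].
  - by move=> x; exact: small_ratio_cvg.
  - by move=> n x; exact: odd_ratio_le.
  by rewrite Rintegral_cst_probability.
have : ccvg \oo (fun n => (y_ n ^+ 2)%:C * (1 - B n) / B n) (s%:C / 1).
  by apply: ccvgM => //; apply: ccvgV => //; exact: oner_neq0.
rewrite divr1; apply: ccvg_near_eq; apply: nearW => n.
have z0 : imag (y_ n) != 0 by apply: upper_neq0.
have G0 : cauchy_transform mu (imag (y_ n)) != 0 by apply: cauchy_neq0.
have -> : (y_ n ^+ 2)%:C = - imag (y_ n) ^+ 2.
  by rewrite expr2; apply: complexP => /=; ring.
by rewrite /B /E_transform /F_transform; field; rewrite z0 G0.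
Qed.

(** The converse of [E_transform_imag_cvg]. The real part of y^2 (1 - B)
    increases to the second moment by monotone convergence. Then x is
    integrable, and the imaginary part of y (1 - B) converges to the mean, but
    also to 0 because y^2 (1 - B) is bounded. *)
Lemma moments_of_E_transform mu (s : R) :
  ccvg \oo (fun n => imag (y_ n) * E_transform mu (imag (y_ n))) s%:C ->
  [/\ mu.-integrable setT (EFin \o (fun x : R => x ^+ 2)),
      mu.-integrable setT (EFin \o (fun x : R => x)),
      \int[mu]_x x = 0 & \int[mu]_x (x ^+ 2) = s].
Proof.
move=> Ec.
have Bc := cauchy_imag_cvg mu.
pose B n := imag (y_ n) * cauchy_transform mu (imag (y_ n)).
have [Rec Imc] : ccvg \oo (fun n => (y_ n ^+ 2)%:C * (1 - B n)) s%:C.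
  have : ccvg \oo (fun n => imag (y_ n) * E_transform mu (imag (y_ n)) * B n) (s%:C * 1).
    exact: ccvgM.
  rewrite mulr1; apply: ccvg_near_eq; apply: nearW => n.
  have G0 : cauchy_transform mu (imag (y_ n)) != 0 by apply: cauchy_neq0.
  have -> : (y_ n ^+ 2)%:C = - imag (y_ n) ^+ 2.
    by rewrite expr2; apply: complexP => /=; ring.
  by rewrite /B /E_transform /F_transform; field.
pose g n x := y_ n ^+ 2 * (x ^+ 2 / (x ^+ 2 + y_ n ^+ 2)).
have mg n : measurable_fun (setT : set (measurableTypeR R)) (g n).
  rewrite /g; under eq_fun do rewrite mulrA.
  by apply: measurable_rational => //; exact: continuous_sqr_scale.
have g0 n x : 0 <= g n x by have /andP[] := ratio_le x (y_gt0 n).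
have ir n : mu.-integrable setT (EFin \o (fun x : R => x ^+ 2 / (x ^+ 2 + y_ n ^+ 2))).
  apply: (@integrable_bounded_real _ _ 1).
    by apply: measurable_rational => //; exact: sqr_continuous.
  move=> x; have D := sqrD_gt0 x (y_gt0 n).
  by rewrite ger0_norm ?divr_ge0 ?sqr_ge0 ?(ltW D)// ler_pdivrMr// mul1r lerDl sqr_ge0.
have ig n : mu.-integrable setT (EFin \o g n).
  exact: (integrableZl measurableT (y_ n ^+ 2) (ir n)).
have gE n : Re ((y_ n ^+ 2)%:C * (1 - B n)) = \int[mu]_x g n x.
  have [rE _] := defect_integrals mu (y_gt0 n).
  by rewrite ReZ rE -RintegralZl.
have gnd x : nondecreasing_seq (fun n => (g n x)%:E).
  apply/nondecreasing_seqP => n; rewrite lee_fin /g.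
  rewrite !ratioE// lerD2l lerN2; apply: ler_wpM2l.
    by apply: mulr_ge0; exact: sqr_ge0.
  rewrite lef_pV2 ?posrE ?sqrD_gt0//.
  by rewrite lerD2l ler_pXn2r ?nnegrE ?(ltW (y_gt0 _))// ler_nat.
have I2 : (\int[mu]_x (x ^+ 2)%:E = s%:E)%E.
  have H1 : (\int[mu]_x (g n x)%:E)%E @[n --> \oo] --> s%:E.
    have -> : (fun n => (\int[mu]_x (g n x)%:E)%E) =
        (fun n => (Re ((y_ n ^+ 2)%:C * (1 - B n)))%:E).
      apply/funext => n; rewrite gE /Rintegral fineK//.
      exact: integrable_fin_num (ig n).
    by apply: cvg_EFin Rec; exact: nearW.
  have H2 : (\int[mu]_x (g n x)%:E)%E @[n --> \oo] -->
      (\int[mu]_x (limn (fun n => (g n x)%:E)))%E.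
    apply: cvg_monotone_convergence => //.
    - by move=> n; exact/measurable_EFinP.
    - by move=> n x _; rewrite lee_fin.
  rewrite -(cvg_unique (@ereal_hausdorff R) H2 H1); apply: eq_integral => x _; apply/esym/cvg_lim => //.
  by apply/cvg_EFin; [exact: nearW|exact: ratio_cvg].
have m2 : measurable_fun (setT : set (measurableTypeR R)) (fun x : R => x ^+ 2).
  by apply: continuous_measurable_fun; exact: sqr_continuous.
have i2 : mu.-integrable setT (EFin \o (fun x : R => x ^+ 2)).
  apply/integrableP; split; first exact/measurable_EFinP.
  under eq_integral do rewrite /= ger0_norm ?sqr_ge0//.
  by rewrite I2 ltry.
have i1 := integrable_of_square i2.
split=> //; last by rewrite /Rintegral I2.
have H1 : y_ n * Im (1 - B n) @[n --> \oo] --> 0.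
  have : (y_ n)^-1 * Im ((y_ n ^+ 2)%:C * (1 - B n)) @[n --> \oo] --> 0 * (0 : R).
    apply: cvgM => //; apply/cvgrPdist_le => e e0; near=> n.
    rewrite sub0r normrN normfV gtr0_norm// invf_ple ?posrE//.
    apply: (@le_trans _ _ n%:R); last by rewrite ler_nat.
    by near: n; exact: nbhs_infty_ger.
  rewrite mul0r; apply: cvg_trans; apply: near_eq_cvg; apply: nearW => n.
  rewrite ImZ expr2 -mulrA mulKf// gt_eqF//.
have H2 : y_ n * Im (1 - B n) @[n --> \oo] --> \int[mu]_x x.
  have ixy n : mu.-integrable setT (EFin \o (fun x : R => x * y_ n / (x ^+ 2 + y_ n ^+ 2))).
    have yn := y_gt0 n; apply: (@integrable_bounded_real _ _ 1).
      apply: measurable_rational => // x.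
      by apply: cvgM; [exact: cvg_id|exact: cvg_cst].
    move=> x; have D := sqrD_gt0 x yn.
    rewrite normrM normfV (gtr0_norm D) ler_pdivrMr// mul1r normrM (gtr0_norm yn).
    rewrite -(real_normK (num_real x)).
    have := sqr_ge0 (`|x| - y_ n); have := mulr_ge0 (normr_ge0 x) (ltW yn).
    by rewrite sqrrB; lra.
  have E n : y_ n * Im (1 - B n) = \int[mu]_x (y_ n * (x * y_ n / (x ^+ 2 + y_ n ^+ 2))).
    by have [_ iE] := defect_integrals mu (y_gt0 n); rewrite RintegralZl// iE.
  under eq_fun do rewrite E.
  have [| | | |_ //] := @Rintegral_dominated_cvg _ _ _ mu
      (fun n x => y_ n * (x * y_ n / (x ^+ 2 + y_ n ^+ 2))) (fun x => x)
      (fun x => `|x|) _ _ _ _.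
  - move=> n; apply: measurable_funM; first exact: measurable_cst.
    apply: measurable_rational => // x.
    by apply: cvgM; [exact: cvg_id|exact: cvg_cst].
  - exact: odd_ratio_cvg.
  - by have := integrable_norm i1; apply: eq_integrable.
  - move=> n x; have yn := y_gt0 n; have D := sqrD_gt0 x yn.
    rewrite mulrA mulrCA normrM normfV (gtr0_norm D) normrM -mulrA.
    rewrite -[leRHS]mulr1 ler_wpM2l// ler_pdivrMr// mul1r ger0_norm ?mulr_ge0 ?(ltW yn)//.
    by rewrite -expr2 lerDr sqr_ge0.
exact: (cvg_unique _ H2 H1).
Unshelve. all: by end_near. Qed.

End moments.

(** * The semicircular distribution *)

Section semicircular_integral.
Context {R : realType}.
Local Notation leb := (@lebesgue_measure R).
Variables (t : R) (t0 : 0 < t).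

Lemma semicircular_dominates : (semicircular t : set (measurableTypeR R) -> \bar R) `<< leb.
Proof.
apply/null_content_dominatesP => A mA A0; rewrite /semicircular t0.
apply: null_set_integral => //.
by apply: measurable_funTS; exact: measurable_semicircular_pdf.
Qed.

(** The density is the Radon-Nikodym derivative. *)
Lemma integral_semicircular (f : R -> R) :
  (semicircular t).-integrable setT (EFin \o f) ->
  (\int[semicircular t]_x (f x)%:E =
   \int[leb]_x (f x * semicircular_pdf t x)%:E)%E.
Proof.
move=> intf; have mf : measurable_fun setT (EFin \o f) by exact: measurable_int intf.
have ipdf : leb.-integrable setT (EFin \o semicircular_pdf t).
  apply/integrableP; split; first exact: measurable_semicircular_pdf.
  under eq_integral do rewrite /= ger0_norm ?semicircular_pdf_ge0//.
  by rewrite integral_semicircular_pdf// ltry.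
rewrite -(Radon_Nikodym_change_of_variables semicircular_dominates)//=.
under [RHS]eq_integral do rewrite EFinM.
apply: ae_eq_integral => //.
- apply: emeasurable_funM => //; apply: (measurable_int leb).
  by apply: Radon_Nikodym_integrable; exact: semicircular_dominates.
- by apply: emeasurable_funM => //; exact: measurable_semicircular_pdf.
- apply: ae_eqe_mul2l => /=.
  rewrite Radon_NikodymE//=; first exact: semicircular_dominates.
  move=> dom; case: cid => /= h [h1 h2 h3].
  apply: integral_ae_eq => //=.
  + exact: measurable_semicircular_pdf.
  + by move=> E E01 mE; rewrite -h3//= /semicircular t0.
Qed.

Let r : R := 2 * Num.sqrt t.

(** Substituting x = 2 sqrt t sin(theta) removes the square root. *)
Lemma semicircular_substitution (f : R -> R) : continuous f ->
  (semicircular t).-integrable setT (EFin \o f) ->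
  (\int[semicircular t]_x (f x)%:E =
   \int[leb]_(x in `[(- (pi / 2))%R, (pi / 2)%R])
     (f (r * sin x) * (2 / pi * cos x ^+ 2))%:E)%E.
Proof.
move=> cf intf; rewrite integral_semicircular//.
have r0 : 0 < r by rewrite mulr_gt0// sqrtr_gt0.
have r2 : r ^+ 2 = 4 * t by rewrite exprMn sqr_sqrtr ?ltW//; ring.
have pi0 : 0 < (pi : R) := pi_gt0 R.
have lt_pi : - (pi / 2) < pi / 2 :> R by lra.
pose F (x : R) : R := r * sin x.
have dF (x : R) : is_derive x 1 F (r * cos x).
  by apply: is_derive_eq; rewrite /GRing.scale/=; ring.
have F'E : (F^`())%classic = fun x => r * cos x.
  by apply/funext => x; rewrite derive1E; apply: derive_val.
have cF : continuous F.
  by move=> x; apply: differentiable_continuous; apply/derivable1_diffP.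
have ccos : continuous (fun x : R => r * cos x).
  by move=> x; apply: cvgM; [exact: cvg_cst|exact: continuous_cos].
have FN : F (- (pi / 2)) = - r by rewrite /F sinN sin_pihalf mulrN1.
have FP : F (pi / 2) = r by rewrite /F sin_pihalf mulr1.
transitivity (\int[leb]_(x in `[(- r)%R, r]) (f x * semicircular_pdf t x)%:E)%E.
  rewrite [RHS]integral_mkcond; apply: eq_integral => x _.
  rewrite patchE; case: ifPn => // /negP xr.
  rewrite /semicircular_pdf ler0_sqrtr ?mul0r ?mulr0// -r2 subr_le0 leNgt.
  apply/negP => xr2; apply: xr; rewrite inE/= in_itv/= -ler_norml.
  by rewrite -(ler_pXn2r (_ : 0 < 2)%N) ?nnegrE ?(ltW r0)// real_normK
    ?num_real// ltW.
have := @integration_by_substitution_increasing R F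
  (fun x => f x * semicircular_pdf t x) (- (pi / 2)) (pi / 2).
rewrite FN FP => ->; last 7 first.
- exact: ltW.
- move=> x y xI yI xy; rewrite /F ltr_pM2l//.
  by rewrite ltr_sin.
- by rewrite F'E => x _; exact: ccos.
- rewrite F'E; apply/cvg_ex; exists (r * cos (- (pi / 2))).
  by apply: cvg_at_right_filter; exact: ccos.
- rewrite F'E; apply/cvg_ex; exists (r * cos (pi / 2)).
  by apply: cvg_at_left_filter; exact: ccos.
- split => //.
  + by apply: cvg_at_right_filter; exact: cF.
  + by apply: cvg_at_left_filter; exact: cF.
- apply: continuous_subspaceT => x; apply: cvgM; first exact: cf.
  exact: continuous_semicircular_pdf.
apply: eq_integral => x; rewrite inE/= in_itv/= => xI.
congr EFin; rewrite F'E /= /semicircular_pdf /F fctE/=.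
have -> : 4 * t - (r * sin x) ^+ 2 = (r * cos x) ^+ 2.
  by rewrite (exprMn _ r (sin x)) (exprMn _ r (cos x)) cos2sin2 -r2; ring.
rewrite sqrtr_sqr ger0_norm; last by rewrite mulr_ge0 ?(ltW r0)// cos_ge0_pihalf.
rewrite -(mulrA (f _)); congr (_ * _).
have -> : r * cos x / (2 * pi * t) * (r * cos x) =
  r ^+ 2 * cos x ^+ 2 / (2 * pi * t) by ring.
rewrite r2; move: (cos x) (pi : R) pi0 => c p p0.
by field; rewrite (gt_eqF p0) (gt_eqF t0).
Qed.

End semicircular_integral.

Section chebyshev.
Context {R : realType}.
Local Notation leb := (@lebesgue_measure R).
Implicit Types (n m : nat) (x : R).

(** This is sin (n psi) for psi = pi / 2 - x. These functions play the role of
    the Chebyshev polynomials of the second kind in sin x = cos psi, multiplied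
    by cos x = sin psi. *)
Definition sin_multiple n x : R := sin (n%:R * (pi / 2 - x)).

Lemma sin_multiple0 x : sin_multiple 0 x = 0.
Proof. by rewrite /sin_multiple mul0r sin0. Qed.

Lemma sin_multiple1 x : sin_multiple 1 x = cos x.
Proof. by rewrite /sin_multiple mul1r sinB sin_pihalf cos_pihalf; ring. Qed.

Lemma sin_multipleSS n x :
  sin_multiple n.+2 x + sin_multiple n x = 2 * sin x * sin_multiple n.+1 x.
Proof.
rewrite /sin_multiple; set p := pi / 2 - x.
have -> : n.+2%:R * p = n.+1%:R * p + p by rewrite -!natr1; ring.
have -> : n%:R * p = n.+1%:R * p - p by rewrite -!natr1; ring.
have cp : cos p = sin x by rewrite /p cosB cos_pihalf sin_pihalf; ring.
rewrite sinD (sinB (_ * p)) cp; ring.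
Qed.

Lemma sin_multiple_le1 n x : `|sin_multiple n x| <= 1.
Proof. by rewrite ler_norml sin_geN1 sin_le1. Qed.

Lemma sin_multiple_pihalf n : sin_multiple n (pi / 2) = 0.
Proof. by rewrite /sin_multiple subrr mulr0 sin0. Qed.

Lemma sin_multipleN_pihalf n : sin_multiple n (- (pi / 2)) = 0.
Proof.
rewrite /sin_multiple opprK -splitr; elim: n => [|n ih]; first by rewrite mul0r sin0.
by rewrite -natr1 mulrDl mul1r sinDpi ih oppr0.
Qed.

Lemma is_derive_sin_multiple n x :
  is_derive x 1 (sin_multiple n) (- (n%:R * cos (n%:R * (pi / 2 - x)))).
Proof.
by rewrite /sin_multiple; apply: is_derive_eq; rewrite /GRing.scale/=; ring.
Qed.

Lemma continuous_sin_multiple n : continuous (sin_multiple n).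
Proof.
move=> x; apply: differentiable_continuous; apply/derivable1_diffP.
by have := is_derive_sin_multiple n x => -[].
Qed.

(** Orthogonality to [sin_multiple] 1. The antiderivatives come from
    2 sin psi sin (m psi) = cos ((m - 1) psi) - cos ((m + 1) psi). *)
Lemma integral_cos_sin_multiple n :
  (\int[leb]_(x in `[(- (pi / 2))%R, (pi / 2)%R]) (cos x * sin_multiple n.+1 x))%R =
  if n == 0%N then pi / 2 else 0.
Proof.
have lt_pi : - (pi / 2) < pi / 2 :> R by have := pi_gt0 R; lra.
have cS : continuous (fun x : R => cos x * sin_multiple n.+1 x).
  move=> x; apply: cvgM; [exact: continuous_cos|exact: continuous_sin_multiple].
have FTC (H : R -> R) :
    (forall x : R, is_derive x 1 H (cos x * sin_multiple n.+1 x)) ->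
    (\int[leb]_(x in `[(- (pi / 2))%R, (pi / 2)%R]) (cos x * sin_multiple n.+1 x))%R =
    H (pi / 2) - H (- (pi / 2)).
  move=> dH; have cH : continuous H.
    by move=> x; apply: differentiable_continuous; apply/derivable1_diffP.
  rewrite /Rintegral (@continuous_FTC2 _ _ H)//.
  - exact: continuous_subspaceT.
  - split => //.
    + by apply: cvg_at_right_filter; exact: cH.
    + by apply: cvg_at_left_filter; exact: cH.
  - by move=> x _; rewrite derive1E; apply: derive_val.
case: n cS FTC => [|n] cS FTC /=.
  have dH (x : R) : is_derive x 1 (fun x : R => 2^-1 * (x + sin x * cos x))
      (cos x * sin_multiple 1 x).
    apply: is_derive_eq; rewrite sin_multiple1 /GRing.scale/=.
    rewrite -[X in _ * (X + _)](cos2Dsin2 x); lra.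
  rewrite (FTC _ dH) sinN cosN cos_pihalf !mulr0 !addr0; lra.
have dH (x : R) : is_derive x 1 (fun x : R => 2^-1 * (n.+3%:R^-1 * sin_multiple n.+3 x -
    n.+1%:R^-1 * sin_multiple n.+1 x)) (cos x * sin_multiple n.+2 x).
  have d1 := is_derive_sin_multiple n.+3 x; have d2 := is_derive_sin_multiple n.+1 x.
  apply: is_derive_eq; rewrite /GRing.scale/= /sin_multiple.
  rewrite !mulrN !mulrA !mulVf ?pnatr_eq0// !mul1r.
  set p := pi / 2 - x.
  have -> : n.+3%:R * p = n.+2%:R * p + p by rewrite -!natr1; ring.
  have -> : n.+1%:R * p = n.+2%:R * p - p by rewrite -!natr1; ring.
  have cp : cos x = sin p by rewrite /p sinB cos_pihalf sin_pihalf; ring.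
  by rewrite cosD (cosB (_ * p)) cp; field.
rewrite (FTC _ dH) !sin_multiple_pihalf !sin_multipleN_pihalf; ring.
Qed.

End chebyshev.

Section semicircular_cauchy.
Context {R : realType}.
Local Notation leb := (@lebesgue_measure R).
Local Notation I := (`[(- (pi / 2))%R, (pi / 2)%R]%classic : set R).

Section fixed_z.
Variables (t : R) (z : R[i]).
Let u : R := Num.sqrt t.
Let v : R[i] := z + t%:C / z.
Let q : R[i] := u%:C / z.
Hypotheses (t0 : 0 < t) (z0 : 0 < Im z) (v0 : 0 < Im v) (q1 : normc q < 1).

Let k (x : R) : R[i] := (v - (2 * u * sin x)%:C)^-1.
Let g n (x : R) : R[i] := (cos x * sin_multiple n x)%:C.

Let mI : measurable (I : set (measurableTypeR R)).
Proof. exact: measurable_itv. Qed.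

Let I_fin : (leb I < +oo)%E.
Proof. by rewrite lebesgue_measure_itv/=; case: ifP => _; rewrite ?ltry// -EFinB ltry. Qed.

Let mg n : cmeasurable I (g n).
Proof.
apply: cmeasurable_real; apply: measurable_funTS.
apply: continuous_measurable_fun => x; apply: cvgM; first exact: continuous_cos.
exact: continuous_sin_multiple.
Qed.

Let mk : cmeasurable I k.
Proof.
have ms : measurable_fun setT (fun x : R => 2 * u * sin x).
  apply: continuous_measurable_fun => x; apply: cvgM; first exact: cvg_cst.
  exact: continuous_sin.
by have [kr ki] := measurable_kernel_comp v0 ms; split; exact: measurable_funTS.
Qed.

Let g_le n x : normc (g n x) <= 1.
Proof.
rewrite normc_real normrM mulr_ile1 ?normr_ge0 ?sin_multiple_le1//.
by rewrite ler_norml cos_geN1 cos_le1.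
Qed.

Let ig n : cintegrable leb I (g n).
Proof. by apply: (cintegrable_bounded mI I_fin (mg n) (M := 1)) => x _; exact: g_le. Qed.

Let gk_le n x : normc (g n x * k x) <= (Im v)^-1.
Proof.
rewrite normcM -[leRHS]mul1r ler_pM ?normc_ge0 ?g_le//.
exact: normc_kernel.
Qed.

Let igk n : cintegrable leb I (fun x => g n x * k x).
Proof.
apply: (cintegrable_bounded mI I_fin (cmeasurableM (mg n) mk) (M := (Im v)^-1)).
by move=> x _; exact: gk_le.
Qed.

Let K n : R[i] := (2 / pi)%:C * cint leb I (fun x => g n x * k x).

Let pi0 : (pi : R) != 0. Proof. by rewrite gt_eqF// pi_gt0. Qed.

Let J n : (2 / pi)%:C * cint leb I (g n.+1) = (n == 0%N)%:R.
Proof.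
have -> : cint leb I (g n.+1) = (if n == 0%N then pi / 2 else 0)%:C.
  apply: complexP; first by rewrite -integral_cos_sin_multiple.
  by rewrite /cint/= Rintegral_cst ?mul0r.
rewrite -rmorphM/=; case: eqP => _; last by rewrite mulr0.
have H (p : R) : p != 0 -> 2 / p * (p / 2) = 1 by move=> p0; field.
by rewrite H.
Qed.

(** From sin_(n+2) + sin_n = 2 sin x sin_(n+1), where the factor 2 u sin x is
    absorbed by the kernel: 2 u sin x / (v - 2 u sin x) = v k - 1. *)
Let K_rec n : u%:C * (K n.+2 + K n) = v * K n.+1 - (n == 0%N)%:R.
Proof.
have iS : cintegrable leb I (fun x => g n.+2 x * k x + g n x * k x).
  exact: cintegrableD.
have -> : K n.+2 + K n = (2 / pi)%:C * cint leb I (fun x => g n.+2 x * k x + g n x * k x).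
  by rewrite /K -mulrDr cintD.
rewrite -J /K.
transitivity ((2 / pi)%:C *
    cint leb I (fun x => u%:C * (g n.+2 x * k x + g n x * k x))).
  by rewrite (cintZ mI u%:C iS); ring.
transitivity ((2 / pi)%:C *
    cint leb I (fun x => v * (g n.+1 x * k x) - g n.+1 x)); last first.
  rewrite (cintB mI _ (ig n.+1)); last exact: cintegrableZ.
  by rewrite (cintZ mI v (igk n.+1)); ring.
congr (_ * _).
apply: eq_cint => x _.
have kn0 := upper_subr_neq0 (2 * u * sin x) v0.
rewrite -mulrDl /g -rmorphD/= -mulrDr sin_multipleSS /k.
transitivity ((2 * u * sin x)%:C * (cos x * sin_multiple n.+1 x)%:C /
    (v - (2 * u * sin x)%:C)).
  by rewrite mulrA -!rmorphM; congr (_%:C / _); ring.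
have H (w c d : R[i]) : w - c != 0 -> c * d / (w - c) = w * (d * (w - c)^-1) - d.
  by move=> wc; field.
exact: H.
Qed.

Let K_le n : normc (K n) <= 2 * (2 * (Im v)^-1).
Proof.
rewrite /K normcM normc_real ger0_norm ?divr_ge0 ?pi_ge0//.
have H := normc_cint_le mI (igk n) (_ : leb.-integrable I (EFin \o cst (Im v)^-1))
  (fun x _ => gk_le n x).
apply: (le_trans (ler_wpM2l _ (H _))); first by rewrite divr_ge0 ?pi_ge0.
  apply: measurable_bounded_integrable => //.
  exists (Im v)^-1; split; first exact: num_real.
  move=> y vy x _ /=; rewrite ger0_norm ?invr_ge0 ?(ltW v0)//; exact: ltW.
have lt_pi : - (pi / 2) < pi / 2 :> R by have := pi_gt0 R; lra.
have -> : \int[leb]_(x in I) (Im v)^-1 = (Im v)^-1 * pi.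
  transitivity ((Im v)^-1 * fine (leb I)); first exact: Rintegral_cst.
  by rewrite lebesgue_measure_itv/= lte_fin lt_pi /= opprK -splitr.
have {}H (p y : R) : p != 0 -> 2 / p * (2 * (y * p)) = 2 * (2 * y).
  by move=> p0; field.
by rewrite H.
Qed.

Let K0 : K 0 = 0.
Proof.
rewrite /K (_ : cint _ _ _ = 0) ?mulr0//.
rewrite (_ : (fun x => g 0 x * k x) = fun=> 0).
  by apply: complexP; rewrite /cint/= Rintegral_cst ?mul0r.
by apply/funext => x; rewrite /g sin_multiple0 mulr0 mul0r.
Qed.

(** As v / u = q + 1 / q, the recurrence has the characteristic roots q and
    1 / q. The combination q^n (K_(n+1) - q K_n) is therefore constant for
    n >= 1, the only inhomogeneous term being the one for n = 0. *)
Let K1_remainder n : K 1 - z^-1 = q ^+ n.+1 * (K n.+2 - q * K n.+1).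
Proof.
have zn0 := upper_neq0 z0.
have un0 : u%:C != 0.
  apply/eqP => /(congr1 (fun w : R[i] => Re w)) /=.
  by apply/eqP; rewrite gt_eqF// sqrtr_gt0.
have uu : t%:C = u%:C ^+ 2 by rewrite -rmorphXn /= sqr_sqrtr ?ltW.
have step m : q * K m.+2 = (1 + q ^+ 2) * K m.+1 - (m == 0%N)%:R / z - q * K m.
  apply: (mulIf zn0); have := K_rec m.
  move: (K m.+2) (K m.+1) (K m) => a b c e.
  transitivity (u%:C * (a + c) - u%:C * c); first by rewrite /q; field.
  by rewrite e /v /q uu; field.
elim: n => [|n ->].
  by rewrite expr1 mulrBr step K0 /=; field.
rewrite [in RHS]exprSr -[RHS]mulrA; congr (_ * _).
by rewrite mulrBr (step n.+1) /= mul0r; ring.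
Qed.

(** The remainder tends to 0, because |q| < 1 and the K_n are bounded. *)
Lemma semicircular_kernel_integral : K 1 = z^-1.
Proof.
apply/eqP; rewrite -subr_eq0 -normc_eq0 eq_le normc_ge0 andbT.
set B := 2 * (2 * (Im v)^-1).
have B0 : 0 <= B by rewrite !mulr_ge0// invr_ge0 ltW.
have H n : normc (K 1 - z^-1) <= normc q ^+ n.+1 * (2 * B).
  rewrite (K1_remainder n) normcM normcX ler_wpM2l ?exprn_ge0 ?normc_ge0//.
  apply: (le_trans (ler_normcB _ _)).
  have := K_le n.+2; have : normc (q * K n.+1) <= 1 * B.
    by rewrite normcM ler_pM ?normc_ge0 ?(ltW q1)// K_le.
  by rewrite -/B; lra.
have lim : normc q ^+ n * (2 * B) @[n --> \oo] --> 0 * (2 * B).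
  by apply: cvgMl; apply: cvg_expr; rewrite ger0_norm ?normc_ge0.
rewrite mul0r in lim; apply: (cvgr_to_ge lim).
by exists 1%N => // -[//|n] _ /=; exact: H.
Qed.

Lemma semicircular_cauchy : cauchy_transform (semicircular t) v = z^-1.
Proof.
have [cr ci] := continuous_kernel v0.
have [ir ii] := cintegrable_kernel (semicircular t) v0.
have key (P : R[i] -> R) : continuous (fun s : R => P (cauchy_kernel v s)) ->
    (semicircular t).-integrable setT (EFin \o (fun s : R => P (cauchy_kernel v s))) ->
    leb.-integrable I (EFin \o (fun x => P (g 1 x * k x))) ->
    (forall (c : R) w, P (c%:C * w) = c * P w) ->
    \int[semicircular t]_s P (cauchy_kernel v s) =
    2 / pi * \int[leb]_(x in I) P (g 1 x * k x).
  move=> cP iP iQ Pl; rewrite -RintegralZl// /Rintegral.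
  rewrite (semicircular_substitution t0 cP iP); congr fine.
  apply: eq_integral => x _; congr EFin.
  by rewrite Pl sin_multiple1 /k /cauchy_kernel; ring.
have [igr igi] := igk 1.
rewrite -semicircular_kernel_integral /K; apply: complexP; rewrite ?ReM ?ImM /=.
  rewrite mul0r subr0; apply: key => // c w; by rewrite ReM /= mul0r subr0.
by rewrite mul0r addr0; apply: key => // c w; rewrite ImM /= mul0r addr0.
Qed.

End fixed_z.

Lemma F_semicircular (t : R) (a : R) : 0 <= t -> 0 < a ->
  \forall z \near cone_infty a,
    F_transform (semicircular t) (z + t%:C / z) = z.
Proof.
move=> t0 a0; exists (1 + t) => [|z [_ tz]]; first by rewrite ltr_wpDr.
have z0 : 0 < Im z by lra.
have nz : Im z <= normc z := le_trans (ler_norm _) (normc_Im z).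
rewrite /F_transform -[RHS]invrK; congr _^-1.
move: t0; rewrite le_eqVlt => /predU1P[<-|t0]; last first.
  have sq : t < normc z ^+ 2.
    have : (1 + t) * 1 <= normc z * normc z by rewrite ler_pM; lra.
    rewrite -expr2; lra.
  apply: semicircular_cauchy => //.
    rewrite ImD ImM /= mul0r addr0 ImV mulrN.
    have -> : Re z ^+ 2 + Im z ^+ 2 = normc z ^+ 2.
      case: (z) => x y /=; rewrite sqr_sqrtr// addr_ge0// sqr_ge0//.
    rewrite subr_gt0 mulrCA -[ltRHS]mulr1 ltr_pM2l// ltr_pdivrMr ?mul1r//.
    exact: lt_trans sq.
  rewrite normcf_div normc_real ger0_norm ?sqrtr_ge0// ltr_pdivrMr ?mul1r.
    by rewrite -(ltr_pXn2r (_ : 0 < 2)%N) ?nnegrE ?sqrtr_ge0 ?normc_ge0// sqr_sqrtr// ltW.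
  lra.
rewrite mul0r addr0 cauchy_transformE.
have [kr ki] := measurable_kernel z0.
have E : (semicircular 0 : set (measurableTypeR R) -> \bar R) =
    dirac (0 : measurableTypeR R).
  by apply/funext => A; rewrite /semicircular ltxx.
have D (f : R -> R) : measurable_fun (setT : set (measurableTypeR R)) f ->
    \int[semicircular (0:R)]_x f x = f 0.
  move=> mf; rewrite /Rintegral.
  rewrite (eq_measure_integral (dirac (0 : measurableTypeR R))).
    rewrite integral_dirac; last 2 first.
    - exact: measurableT.
    - by apply: measurableT_comp mf; exact: EFin_measurable.
    by rewrite diracT mul1e.
  by move=> A _ _; rewrite -[LHS]/(semicircular 0 A) E.
by apply: complexP; rewrite /= D//= /cauchy_kernel subr0.
Qed.

End semicircular_cauchy.

(** * E of a centered measure is a multiple of a Cauchy transform *)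

Section representation.
Context {R : realType}.
Implicit Types (mu nu rho : borel_probability R) (s t : R).

(** Discretize mu, apply [atoms_E_transform], and divide the weights by the
    variance of the discretization. The mean and the variance converge, and
    [E_transform_imag_cvg] provides the normalization at infinity. *)
Lemma E_transform_representation mu s : 0 < s ->
  mu.-integrable setT (EFin \o (fun x : R => x ^+ 2)) ->
  mu.-integrable setT (EFin \o (fun x : R => x)) ->
  \int[mu]_x x = 0 -> \int[mu]_x (x ^+ 2) = s ->
  exists rho : borel_probability R, forall z, 0 < Im z ->
    E_transform mu z = s%:C * cauchy_transform rho z.
Proof.
move=> s0 i2 i1 m1 m2.
have [L [L0 L1 Lc Lh]] := cauchy_discretization mu.
pose b n := \sum_(a <- L n) a.1 * a.2.
have bc : b n @[n --> \oo] --> (0 : R).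
  rewrite -m1; apply: (Lh (fun x => x) _ (fun x => `|x|)) => //.
    by move=> x; exact: cvg_id.
  by have := integrable_norm i1; apply: eq_integrable.
have qc : \sum_(a <- L n) a.1 * a.2 ^+ 2 @[n --> \oo] --> s.
  rewrite -m2; apply: (Lh (fun x => x ^+ 2) _ (fun x => x ^+ 2)) => //.
    exact: sqr_continuous.
  by move=> x y xy; rewrite normrX -(real_normK (num_real y)) ler_pXn2r ?nnegrE.
have [M ME] := choice (fun n => atoms_E_transform (L0 n) (L1 n)).
pose v n := atoms_mass (M n).
have vc : v n @[n --> \oo] --> s.
  have vE n : v n = \sum_(a <- L n) a.1 * a.2 ^+ 2 - b n * b n.
    by have [_ H _] := ME n; rewrite /v H expr2.
  under eq_fun do rewrite vE.
  have H := cvgB qc (cvgM bc bc); rewrite mulr0 subr0 in H; exact: H.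
(* The variance v n can vanish for finitely many n; a fixed measure is used
   for those. *)
pose N n := if 0 < v n then [seq (a.1 / v n, a.2) | a <- M n] else [:: (1, 0)].
pose g z : R[i] := s^-1%:C * E_transform mu z.
have [| | | |rho rhoE] := @cauchy_transform_limit _ N g.
- move=> n a; rewrite /N; case: ifPn => [v0|_].
    move=> /mapP[p pM ->] /=; rewrite divr_ge0 ?(ltW v0)//.
    by have [M0 _ _] := ME n; exact: M0.
  by rewrite inE => /eqP ->; exact: ler01.
- move=> n; rewrite /N; case: ifPn => [v0|_].
    by rewrite /atoms_mass big_map -mulr_suml -/(atoms_mass _) mulfV// gt_eqF.
  by rewrite /atoms_mass big_seq1.
- move=> z z0.
  have H : ccvg \oo (fun n => (v n)^-1%:C *
      (z - (atoms_cauchy (L n) z)^-1 - (b n)%:C)) (s^-1%:C * (E_transform mu z - 0%:C)).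
    apply: ccvgM; first by apply: ccvg_real; apply: cvgV; [rewrite gt_eqF|exact: vc].
    apply: ccvgB; last exact: ccvg_real.
    apply: ccvgB; first exact: ccvg_cst.
    by apply: ccvgV; [exact: cauchy_neq0|exact: Lc].
  rewrite subr0 in H; apply: ccvg_near_eq H; near=> n.
  have v0 : 0 < v n by near: n; exact: (cvgr_gt _ vc).
  have G0 : atoms_cauchy (L n) z != 0.
    have : Im (atoms_cauchy (L n) z) < 0.
      by near: n; apply: (cvgr_lt _ (Lc z z0).2); exact: Im_cauchy_lt0.
    by apply: contraTneq => ->; rewrite ltxx.
  rewrite /N v0; have [_ _ /(_ z z0 G0) ->] := ME n.
  rewrite addrC addKr /atoms_cauchy big_map mulr_sumr; apply: eq_bigr => p _ /=.
  by rewrite rmorphM /=; ring.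
- move=> e e0.
  have /ccvg_normP /(_ (e * s) (mulr_gt0 e0 s0)) [n _ /(_ n (leqnn n)) H] :=
    E_transform_imag_cvg i2 i1 m1 m2.
  exists n.+1%:R; first by rewrite ltr0n.
  have sC : s%:C != 0 by apply/eqP => -[] /eqP; rewrite gt_eqF.
  have -> : 1 - (0 +i* n.+1%:R) * g (0 +i* n.+1%:R) =
      s^-1%:C * (s%:C - imag n.+1%:R * E_transform mu (imag n.+1%:R)).
    by rewrite /g /imag fmorphV; field.
  rewrite normcM normc_real normfV (gtr0_norm s0) mulrC ler_pdivrMr//.
  by rewrite normcBC.
exists rho => z z0; rewrite rhoE// /g mulrA -rmorphM mulfV ?gt_eqF//.
by rewrite rmorph1 mul1r.
Unshelve. all: by end_near. Qed.

End representation.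

(** * Subordination form of free convolutions and powers *)

Section subordination.
Context {R : realType}.
Implicit Types (mu nu rho : borel_probability R) (s t : R) (z w : R[i]).

Lemma F_inverse_sub mu a b a' b' Finv :
  truncated_cone a' b' `<=` truncated_cone a b ->
  is_F_inverse mu a b Finv -> is_F_inverse mu a' b' Finv.
Proof.
move=> sub [c [d [c0 d0 inj FE]]]; exists c, d; split => // z /sub; exact: FE.
Qed.

Lemma voiculescu_sub mu a b a' b' phi :
  truncated_cone a' b' `<=` truncated_cone a b ->
  is_voiculescu_transform mu a b phi -> is_voiculescu_transform mu a' b' phi.
Proof.
move=> sub [Finv FI phiE]; exists Finv; first exact: F_inverse_sub FI.
by move=> z /sub; exact: phiE.
Qed.

Lemma near_identity_semicircular s : near_identity (fun z : R[i] => z + s%:C / z).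
Proof.
move=> a e a0 e0; apply: filterS (near_cone a (1 + `|s| / e)) => z [_ zs].
have se : 0 <= `|s| / e by rewrite divr_ge0// ltW.
have z1 : 1 + `|s| / e <= normc z.
  by apply: (le_trans zs); apply: le_trans (normc_Im z); exact: ler_norm.
have z_gt0 : 0 < normc z by lra.
rewrite addrC addKr normcf_div normc_real ler_pdivrMr//.
have H1 : `|s| <= e * normc z by rewrite mulrC -ler_pdivrMr//; lra.
by apply: (le_trans H1); rewrite ler_peMr ?mulr_ge0 ?normc_ge0 ?(ltW e0)//; lra.
Qed.

(** The point z + s / z is a preimage of z by [F_semicircular], and the germ of
    the inverse is unique by [F_inverse_near]. *)
Lemma voiculescu_semicircular s a b phi : 0 <= s -> 0 < a ->
  is_voiculescu_transform (semicircular s) a b phi ->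
  exists2 a0, 0 < a0 <= a & \forall z \near cone_infty a0, phi z = s%:C / z.
Proof.
move=> s0 a_gt0 [Finv FI phiE].
have [a1 a10 H] := F_inverse_near a_gt0 FI.
pose a0 := Num.min a (a1 / 2).
have a0a : a0 <= a by rewrite ge_min lexx.
have a01 : a0 <= a1 / 2 by rewrite ge_min lexx orbT.
have a00 : 0 < a0 by rewrite lt_min a_gt0 divr_gt0.
exists a0; first by rewrite a00.
have a02 : 0 < 2 * a0 by lra.
have a021 : 2 * a0 <= a1 by lra.
have H1 : \forall z \near cone_infty a0,
    Finv (F_transform (semicircular s) (z + s%:C / z)) = z + s%:C / z.
  have H0 : \forall w \near cone_infty (2 * a0), Finv (F_transform (semicircular s) w) = w.
    by apply: filterS (H _ a02 a021) => w [].
  exact: (near_identity_cone (near_identity_semicircular s) a00 H0).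
apply: filterS3 H1 (F_semicircular s0 a00) (near_coneS b (ltW a00) a0a) => z.
move=> + Fz zc; rewrite Fz => FK.
by rewrite phiE// FK addrC addKr.
Qed.

Lemma semicircular_voiculescu s a : 0 <= s -> 0 < a ->
  exists2 b, 0 < b & forall b', b <= b' ->
    is_voiculescu_transform (semicircular s) a b' (fun z => s%:C / z).
Proof.
move=> s0 a0.
have [b0 b00 [inj _]] := F_transform_invertible (semicircular s) a0 (ltr01 : 0 < 1 :> R).
have a2 : 0 < 2 * a by lra.
have H1 : \forall z \near cone_infty a, truncated_cone (2 * a) b0 (z + s%:C / z).
  exact: (near_identity_cone (near_identity_semicircular s) a0 (near_cone (2 * a) b0)).
have [b b_gt0 bP] : cone_infty a (fun z => truncated_cone (2 * a) b0 (z + s%:C / z) /\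
    F_transform (semicircular s) (z + s%:C / z) = z).
  by apply: filterS2 H1 (F_semicircular s0 a0) => z.
exists b => // b' bb'; exists (fun z => z + s%:C / z); last first.
  by move=> z _; rewrite addrC addKr.
exists (2 * a), b0; split => // z zc; apply: bP.
by case: zc => zr zb; split => //; exact: le_trans zb.
Qed.

(** Since phi = s / z for the semicircular distribution, this is
    [voiculescu_relationP] for phi_nu = phi_rho - s / z. *)
Lemma free_convolution_semicircularP nu rho s : 0 <= s ->
  is_free_convolution nu (semicircular s) rho <->
  exists2 a, 0 < a & \forall w \near cone_infty a,
    F_transform nu (w - s%:C * cauchy_transform rho w) = F_transform rho w.
Proof.
move=> s0.
have E w : F_transform rho w + 1%:C * (w - F_transform rho w) -
    s%:C / F_transform rho w = w - s%:C * cauchy_transform rho w.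
  by rewrite /F_transform invrK; ring.
split.
  move=> [a [b [phin [phig [phir [[a0 b0] Vn Vg Vr phiE]]]]]].
  have [a1 /andP[a10 a1a] [b1 b10 gE]] := voiculescu_semicircular s0 a0 Vg.
  have sub : truncated_cone a1 (Num.max b b1) `<=` truncated_cone a b.
    by apply: coneS => //; rewrite ?(ltW a0)// le_max ?lexx// ltW.
  have [a2 a20 H] : exists2 a, 0 < a & \forall w \near cone_infty a,
      F_transform nu (F_transform rho w + 1%:C * (w - F_transform rho w) -
        s%:C / F_transform rho w) = F_transform rho w.
    apply/voiculescu_relationP; exists a1, (Num.max b b1), phin, phir; split.
    - by rewrite lt_max b0.
    - exact: voiculescu_sub Vn.
    - exact: voiculescu_sub Vr.
    - move=> z zc; rewrite phiE; last exact: sub.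
      rewrite -gE; last first.
        by apply: coneS zc; rewrite ?lexx ?(ltW a10)// le_max ?lexx ?orbT// ltW.
      by rewrite rmorph1 mul1r addrK.
  by exists a2 => //; apply: filterS H => w; rewrite E.
move=> [a a0 H].
have [|a1 [b1 [phin [phir [[a10 b10] Vn Vr phiE]]]]] :=
  (voiculescu_relationP nu rho 1 s).2.
  by exists a => //; apply: filterS H => w; rewrite E.
have [b2 b20 Vg] := semicircular_voiculescu s0 a10.
pose b := Num.max b1 b2.
have sub : truncated_cone a1 b `<=` truncated_cone a1 b1.
  by apply: coneS; rewrite ?lexx ?(ltW a10)// le_max ?lexx// ltW.
exists a1, b, phin, (fun z => s%:C / z), phir; split.
- by rewrite lt_max b10.
- exact: voiculescu_sub Vn.
- by apply: Vg; rewrite le_max lexx orbT.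
- exact: voiculescu_sub Vr.
- by move=> z /sub /phiE ->; rewrite rmorph1; ring.
Qed.

(** This is [voiculescu_relationP] for phi_mu = p^-1 phi_rho. *)
Lemma free_powerP mu rho (p : R) : p != 0 ->
  is_free_power p mu rho <->
  exists2 a, 0 < a & \forall w \near cone_infty a,
    F_transform mu (w - (1 - p^-1)%:C * E_transform rho w) = F_transform rho w.
Proof.
move=> p0.
have pC : p%:C != 0 by apply/eqP => -[] /eqP; rewrite (negbTE p0).
have E w : F_transform rho w + p^-1%:C * (w - F_transform rho w) -
    0%:C / F_transform rho w = w - (1 - p^-1)%:C * E_transform rho w.
  by rewrite /E_transform rmorphB rmorph1 /=; ring.
split.
  move=> [a [b [phim [phir [[a0 b0] Vm Vr phiE]]]]].
  have [|a2 a20 H] := (voiculescu_relationP mu rho p^-1 0).1.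
    exists a, b, phim, phir; split => // z /phiE ->.
    by rewrite fmorphV mul0r subr0 mulKf.
  by exists a2 => //; apply: filterS H => w; rewrite E.
move=> [a a0 H].
have [|a1 [b1 [phim [phir [ab Vm Vr phiE]]]]] := (voiculescu_relationP mu rho p^-1 0).2.
  by exists a => //; apply: filterS H => w; rewrite E.
exists a1, b1, phim, phir; split => // z /phiE ->.
by rewrite fmorphV mul0r subr0 mulVKf.
Qed.

End subordination.

(** * The divisibility indicator *)

Section divisibility.
Context {R : realType}.
Implicit Types (mu nu rho : borel_probability R) (s t : R) (z w : R[i]).

Lemma moments_of_variance mu s :
  ('E_mu[idfun] = 0)%E -> ('V_mu[idfun] = s%:E)%E ->
  [/\ mu.-integrable setT (EFin \o (fun x : R => x ^+ 2)),
      mu.-integrable setT (EFin \o (fun x : R => x)),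
      \int[mu]_x x = 0 & \int[mu]_x (x ^+ 2) = s].
Proof.
move=> E0 Vs.
have m1 : (\int[mu]_x x%:E = 0)%E by move: E0; rewrite expectation.unlock.
have m2 : (\int[mu]_x (x ^+ 2)%:E = s%:E)%E.
  move: Vs; rewrite /variance covariance.unlock E0 /= expectation.unlock => <-.
  by apply: eq_integral => x _; rewrite /= fctE /= subr0 expr2.
have i2 : mu.-integrable setT (EFin \o (fun x : R => x ^+ 2)).
  apply/integrableP; split.
    by apply/measurable_EFinP; apply: continuous_measurable_fun; exact: sqr_continuous.
  under eq_integral do rewrite /= ger0_norm ?sqr_ge0//.
  by rewrite m2 ltry.
split => //; last 2 first.
- by rewrite /Rintegral m1.
- by rewrite /Rintegral m2.
exact: integrable_of_square.
Qed.

(** Here mu is the Dirac mass at 0. The bound |x| <= x^2 / d + d shows that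
    |z G(z) - 1| is at most a constant times d, for every d > 0. *)
Lemma F_transform_variance0 mu z :
  mu.-integrable setT (EFin \o (fun x : R => x ^+ 2)) ->
  \int[mu]_x (x ^+ 2) = 0 -> 0 < Im z -> F_transform mu z = z.
Proof.
move=> i2 m2 z0.
have ikd : cintegrable mu setT (fun s => z * cauchy_kernel z s).
  by apply: cintegrableZ => //; exact: cintegrable_kernel.
have kE (s : measurableTypeR R) : z * cauchy_kernel z s - 1 = kernel_defect z s.
  by rewrite kernel_defectE// addrC addKr.
have H d : 0 < d -> normc (z * cauchy_transform mu z - 1) <= 0 + 2 * (d / Im z).
  move=> d0.
  have ig : mu.-integrable setT (EFin \o (fun x : R => (Im z * d)^-1 * x ^+ 2 + d / Im z)).
    exact: (integrableD measurableT (integrableZl measurableT (Im z * d)^-1 i2)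
      (finite_measure_integrable_cst mu (d / Im z) measurableT)).
  have -> : z * cauchy_transform mu z - 1 =
      cint mu setT (fun s => z * cauchy_kernel z s - 1).
    rewrite cauchy_transformE (cintB measurableT ikd (cintegrable_cst mu 1)) cint_cst.
    by rewrite cintZ//; exact: cintegrable_kernel.
  have Ig : \int[mu]_x ((Im z * d)^-1 * x ^+ 2 + d / Im z) = d / Im z.
    rewrite RintegralD//; last 2 first.
    - exact: (integrableZl measurableT (Im z * d)^-1 i2).
    - exact: (finite_measure_integrable_cst mu (d / Im z) measurableT).
    by rewrite RintegralZl// m2 mulr0 add0r Rintegral_cst_probability.
  rewrite add0r -Ig; apply: normc_cint_le => //.
    by apply: cintegrableB => //; exact: cintegrable_cst.
  move=> x _; rewrite kE normcM normc_real.
  apply: (@le_trans _ _ (`|x| / Im z)).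
    by rewrite ler_wpM2l// normc_kernel.
  rewrite ler_pdivrMr// mulrDl divfK ?gt_eqF//.
  rewrite (_ : _ * Im z = d^-1 * `|x| ^+ 2); last first.
    by rewrite real_normK ?num_real//; move: (Im z) z0 => y y0; field; rewrite !gt_eqF.
  rewrite -(ler_pM2l d0) mulrDr mulrA mulfV ?gt_eqF// mul1r.
  have := sqr_ge0 (`|x| - d); rewrite sqrrB.
  by have := mulr_ge0 (normr_ge0 x) (ltW d0); lra.
have : normc (z * cauchy_transform mu z - 1) <= 0.
  apply: le_addgt0 => d d0; rewrite add0r.
  have d' : 0 < d * Im z / 2 by rewrite divr_gt0 ?mulr_gt0.
  have := H _ d'; rewrite add0r => /le_trans; apply.
  by rewrite le_eqVlt; apply/orP; left; apply/eqP; field; rewrite gt_eqF.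
rewrite le_eqVlt ltNge normc_ge0 orbF normc_eq0 subr_eq0 => /eqP zG.
rewrite /F_transform -[LHS]mul1r -zG -mulrA mulfV ?mulr1//.
exact: cauchy_neq0.
Qed.

Lemma Im_sub_cauchy rho z (c : R) : 0 <= c -> 0 < Im z ->
  Im z <= Im (z - c%:C * cauchy_transform rho z).
Proof.
move=> c0 z0; rewrite ImB ImZ lerBrDr gerDl mulr_ge0_le0// ltW//.
exact: Im_cauchy_lt0.
Qed.

Lemma E_of_F mu z w : F_transform mu z = z - w -> E_transform mu z = w.
Proof. by rewrite /E_transform => ->; ring. Qed.

(** As w - t s G_rho(w) is itself some F_m, each iy with y large equals
    w - t s G_rho(w) for some w far out in a cone, where w G_rho(w) -> 1.
    There iy E_nu(iy) = (w - t s G_rho(w)) s G_rho(w) is close to s. *)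
Lemma E_transform_imag_subordination nu rho (s t a : R) :
  0 < s -> 0 <= t -> 0 < a ->
  (\forall w \near cone_infty a,
    E_transform nu (w - (t * s)%:C * cauchy_transform rho w) =
    s%:C * cauchy_transform rho w) ->
  ccvg \oo (fun n => imag n.+1%:R * E_transform nu (imag n.+1%:R)) s%:C.
Proof.
move=> s0 t0 a0 Hw; have ts0 : 0 <= t * s by rewrite mulr_ge0// ltW.
have [m mE] := F_transform_sub_cauchy rho ts0.
have a2 : 0 < a / 2 by rewrite divr_gt0.
have aE : 2 * (a / 2) = a by field.
have [b0 b00 [_ inv]] := F_transform_invertible m a2 (ltr01 : 0 < 1 :> R).
apply/ccvg_normP => e e0.
(* (w - t s G) s G - s = s (w G - 1) - t s^2 G^2, and |G| <= d far out. *)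
pose k := s + t * s ^+ 2; have k0 : 0 < k by rewrite ltr_pwDl// mulr_ge0 ?sqr_ge0.
pose d := Num.min 1 (e / k).
have d0 : 0 < d by rewrite lt_min ltr01 divr_gt0.
have d1 : d <= 1 by rewrite ge_min lexx.
have dk : d * k <= e by rewrite -ler_pdivlMr// ge_min lexx orbT.
have [b1 b10 near] : \forall w \near cone_infty a,
    normc ((w - (t * s)%:C * cauchy_transform rho w) *
      E_transform nu (w - (t * s)%:C * cauchy_transform rho w) - s%:C) <= e.
  have [b2 b20 H2] := cauchy_transform_asymptotic rho a0 d0.
  apply: filterS3 Hw (near_cone a b2) (near_cone a (2 / d)) => w -> wc2 wcd.
  have dd : 0 < 2 / d by rewrite divr_gt0.
  have w0 : 0 < Im w := cone_upper dd wcd.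
  have Gd : normc (cauchy_transform rho w) <= d.
    apply: (le_trans (normc_cauchy rho w0)).
    by rewrite ler_pdivrMr// mulrC -ler_pdivrMr//; case: wcd.
  have {}H2 := H2 w wc2.
  move: (cauchy_transform rho w) Gd H2 => G Gd H2.
  rewrite (_ : _ - s%:C = s%:C * (w * G - 1) - (t * s ^+ 2)%:C * (G * G)); last first.
    by rewrite !rmorphM /=; ring.
  apply: (le_trans (ler_normcB _ _)); rewrite !normcM !normc_real.
  rewrite (gtr0_norm s0) (ger0_norm (mulr_ge0 t0 (sqr_ge0 s))).
  apply: le_trans dk; rewrite /k mulrDr lerD//.
    by rewrite mulrC ler_wpM2r// ltW.
  rewrite mulrC; apply: ler_wpM2r; first by rewrite mulr_ge0 ?sqr_ge0.
  rewrite -[leRHS]mulr1; apply: ler_pM; rewrite ?normc_ge0//.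
  exact: le_trans Gd d1.
near=> n.
have nb : 2 * b0 + 2 * b1 <= n.+1%:R.
  apply: (@le_trans _ _ n%:R); last by rewrite ler_nat.
  by near: n; exact: nbhs_infty_ger.
have nc : truncated_cone (a / 2) n.+1%:R (imag n.+1%:R).
  by split => //=; rewrite normr0 mulr_ge0// ltW.
have [|w [wc Fw _]] := inv _ _ _ nc; first lra.
rewrite aE in wc.
have wb1 : truncated_cone a b1 w.
  by apply: coneS wc; rewrite ?lexx ?(ltW a0) ?divr_ge0//; lra.
have w0 := cone_upper b10 wb1.
by have := near _ wb1; rewrite -(mE w w0) Fw.
Unshelve. all: by end_near. Qed.

End divisibility.

Section equivalence.
Context {R : realType}.
Variables (mu : borel_probability R) (s t : R).
Hypothesis t0 : 0 <= t.

Definition belinschi_nica_image := exists nu, is_belinschi_nica t nu mu.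

Definition semicircular_component := exists nu rho : borel_probability R,
  is_free_convolution nu (semicircular (t * s)) rho /\
  forall z : R[i], upper_half_plane z ->
    E_transform mu z = s%:C * cauchy_transform rho z.

Let t1 : t + 1 != 0. Proof. by rewrite gt_eqF// ltr_wpDl. Qed.

(** With E_mu = 0 one can take mu for all the measures involved. *)
Lemma degenerate_component : s = 0 -> (forall z, 0 < Im z -> F_transform mu z = z) ->
  belinschi_nica_image /\ semicircular_component.
Proof.
move=> s0 FE; have E0 z : 0 < Im z -> E_transform mu z = 0.
  by move=> z0; rewrite /E_transform FE// subrr.
have near0 : \forall w \near cone_infty 1, 0 < Im w :> R.
  by exists 1 => // w; exact: cone_upper.
split.
  exists mu, mu; last by move=> z z0; rewrite !E0// mulr0.
  apply/free_powerP => //; exists 1 => //.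
  by apply: filterS near0 => w w0; rewrite E0// mulr0 subr0.
exists mu, mu; split; last by move=> z z0; rewrite s0 E0// mul0r.
apply/free_convolution_semicircularP; first by rewrite s0 mulr0.
exists 1 => //; apply: filterS near0 => w w0.
by rewrite s0 mulr0 mul0r subr0.
Qed.

Hypothesis s0 : 0 < s.

Let ts0 : 0 <= t * s. Proof. by rewrite mulr_ge0// ltW. Qed.

Let sC : s%:C != 0 :> R[i].
Proof. by apply/eqP => -[] /eqP; rewrite gt_eqF. Qed.

(** If nu1 is the (t + 1)-st free power of nu0 and E_nu1 = (t + 1) E_mu, then
    subordination gives E_nu0(w - t s G_rho(w)) = s G_rho(w). This controls
    E_nu0 at infinity, hence E_nu0 = s G_nu for some nu, and then
    G_nu(w - t s G_rho(w)) = G_rho(w). *)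
Lemma component_of_image (rho : borel_probability R) :
  (forall z, 0 < Im z -> E_transform mu z = s%:C * cauchy_transform rho z) ->
  belinschi_nica_image -> semicircular_component.
Proof.
move=> rhoE [nu0 [nu1 /(free_powerP _ _ t1)[a a0 P] bool]].
have E1 z : 0 < Im z -> E_transform nu1 z = ((t + 1) * s)%:C * cauchy_transform rho z.
  move=> z0; have := bool z z0; rewrite rhoE// => e.
  have tC : (t + 1)%:C != 0 :> R[i] by apply/eqP => -[] /eqP; rewrite (negbTE t1).
  by rewrite rmorphM -mulrA e fmorphV mulVKf.
have near : \forall w \near cone_infty a,
    E_transform nu0 (w - (t * s)%:C * cauchy_transform rho w) =
    s%:C * cauchy_transform rho w.
  apply: filterS2 P (near_cone a 1) => w + wc.
  have w0 := cone_upper ltr01 wc; rewrite E1// mulrA -rmorphM.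
  have -> : (1 - (t + 1)^-1) * ((t + 1) * s) = t * s by field.
  move=> FE; rewrite /E_transform FE.
  have -> : F_transform nu1 w = w - E_transform nu1 w by rewrite /E_transform; ring.
  by rewrite E1// !rmorphM rmorphD rmorph1 /=; ring.
have [i2 i1 m1 m2] := moments_of_E_transform (E_transform_imag_subordination s0 t0 a0 near).
have [nu nuE] := E_transform_representation s0 i2 i1 m1 m2.
exists nu, rho; split; last exact: rhoE.
apply/free_convolution_semicircularP => //; exists a => //.
apply: filterS2 near (near_cone a 1) => w + wc.
have w0 := cone_upper ltr01 wc; rewrite nuE; last first.
  exact: lt_le_trans (Im_sub_cauchy rho ts0 w0).
by move=> /(mulfI sC); rewrite /F_transform => ->.
Qed.

(** Take F_nu0 = z - s G_nu and F_nu1 = z - (t + 1) s G_rho. *)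
Lemma image_of_component : semicircular_component -> belinschi_nica_image.
Proof.
move=> [nu [rho [/(free_convolution_semicircularP _ _ ts0)[a a0 P] rhoE]]].
have [nu0 F0] := F_transform_sub_cauchy nu (ltW s0).
have t1s0 : 0 <= (t + 1) * s by rewrite mulr_ge0// ?addr_ge0// ltW.
have [nu1 F1] := F_transform_sub_cauchy rho t1s0.
exists nu0, nu1; last first.
  move=> z z0; rewrite rhoE// (E_of_F (F1 z z0)) mulrA -rmorphM.
  by rewrite mulKf.
apply/free_powerP => //; exists a => //.
apply: filterS2 P (near_cone a 1) => w FE wc.
have w0 := cone_upper ltr01 wc.
rewrite (E_of_F (F1 w w0)) F1// mulrA -rmorphM.
have -> : (1 - (t + 1)^-1) * ((t + 1) * s) = t * s by field.
rewrite F0; last exact: lt_le_trans (Im_sub_cauchy rho ts0 w0).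
have -> : cauchy_transform nu (w - (t * s)%:C * cauchy_transform rho w) =
    cauchy_transform rho w by apply: invr_inj; exact: FE.
by rewrite !rmorphM rmorphD rmorph1 /=; ring.
Qed.

End equivalence.

Theorem corollary4p4 (R : realType) (mu : borel_probability R) (sigma : R)
    (mean0 : ('E_mu[idfun] = 0)%E)
    (variance_sigma2 : ('V_mu[idfun] = (sigma ^+ 2)%:E)%E) :
  free_divisibility_indicator mu =
  ereal_sup [set t%:E | t in
    [set t : R | 0 <= t /\
      exists nu rho : borel_probability R,
        is_free_convolution nu (semicircular (t * sigma ^+ 2)) rho /\
        forall z : R[i], upper_half_plane z ->
          E_transform mu z = (sigma ^+ 2)%:C * cauchy_transform rho z]].
Proof.
have [i2 i1 m1 m2] := moments_of_variance mean0 variance_sigma2.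
rewrite /free_divisibility_indicator; congr (ereal_sup (_ @` _)).
apply/seteqP; split => t [t0 H]; split => //.
  have [s0|s0] := eqVneq (sigma ^+ 2) 0.
    rewrite s0 in m2 *; apply: (degenerate_component t0 erefl _).2 => z z0.
    exact: F_transform_variance0 i2 m2 z0.
  have {}s0 : 0 < sigma ^+ 2 by rewrite lt_neqAle eq_sym s0 sqr_ge0.
  have [rho rhoE] := E_transform_representation s0 i2 i1 m1 m2.
  exact: component_of_image t0 s0 rho rhoE H.
have [s0|s0] := eqVneq (sigma ^+ 2) 0.
  rewrite s0 in m2 *; apply: (degenerate_component t0 erefl _).1 => z z0.
  exact: F_transform_variance0 i2 m2 z0.
by apply: (image_of_component t0 _ H); rewrite lt_neqAle eq_sym s0 sqr_ge0.
Qed.
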